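(* Let $k$ be a commutative ring with unit. Let $A$ be a flat (resp., a flat unitary) $A_{\infty}$-algebra over $k$ provided with a compatible bigrading of $s$-th type, for some $s\in\mathbb{N}_0$, and let $A_{\hbar}$ be a formal bigraded deformation of $A$. Consider $H^{\bullet}(A)$ provided with a model compatible with the bigrading of $A$, and let $f_{\bullet}:H^{\bullet}(A)\to A$ be a quasi-isomorphism of (resp., strictly unitary) $A_{\infty}$-algebras compatible with the bigradings. Then there exist a formal bigraded deformation $H^{\bullet}(A)_{\hbar}$ of the (resp., unitary) $A_\infty$-algebra $H^{\bullet}(A)$ and a quasi-isomorphism $\tilde f_{\bullet}:H^{\bullet}(A)_{\hbar}\to A_{\hbar}$ of formal bigraded deformations of (resp., strictly unitary) $A_{\infty}$-algebras whose underlying morphism of $A_\infty$-algebras over $k$ is $f_\bullet$; that is, $\tilde f_\bullet$ is compatible with the bigradings and the square with horizontal arrows $\tilde f_{\bullet}:H^{\bullet}(A)_{\hbar}\to A_{\hbar}$ and $f_{\bullet}:H^{\bullet}(A)\to A$, and with vertical arrows the canonical projections $H^{\bullet}(A)_{\hbar}\to H^{\bullet}(A)$ and $A_{\hbar}\to A$ (reduction modulo $\hbar$), commutes. Moreover, all formal bigraded deformations of $H^{\bullet}(A)$ arising in this way are quasi-isomorphic to each other.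
   Context: Conventions: $\mathbb{N}$ is the set of positive integers, $\mathbb{N}_0=\mathbb{N}\cup\{0\}$, $\otimes=\otimes_k$, and the Koszul sign rule (for the cohomological degree) is used. $A_\infty$-algebras. An $A_\infty$-algebra over $k$ is a ($\mathbb{Z}$-)graded $k$-module $A$ with maps $m_i:A^{\otimes i}\to A$ of degree $2-i$, $i\in\mathbb{N}$, such that for all $n\in\mathbb{N}$ $$\sum_{r+s+t=n,\ r,t\ge 0,\ s\ge 1}(-1)^{r+st}\,m_{r+1+t}\circ(\mathrm{id}^{\otimes r}\otimes m_s\otimes \mathrm{id}^{\otimes t})=0 .$$ A morphism $f_\bullet:A\to B$ is a family $f_i:A^{\otimes i}\to B$ of degree $1-i$, $i\in\mathbb{N}$, such that for all $n\in\mathbb{N}$ $$\sum_{r+s+t=n}(-1)^{r+st}f_{r+1+t}\circ(\mathrm{id}^{\otimes r}\otimes m_s^A\otimes\mathrm{id}^{\otimes t})=\sum_{q\ge1}\ \sum_{i_1+\dots+i_q=n,\ i_j\ge1}(-1)^{w}m_q^B\circ(f_{i_1}\otimes\dots\otimes f_{i_q}),\quad w=\sum_{j=1}^q(q-j)(i_j-1).$$ It is a quasi-isomorphism if $f_1$ induces an isomorphism in cohomology with respect to $m_1$. $A$ is (strictly) unitary if it has a degree $0$ element $1_A$ that is a two-sided unit for $m_2$ and such that $m_i$, $i\neq2$, vanishes whenever one argument is $1_A$; a morphism is strictly unitary if $f_1(1_A)=1_B$ and $f_i$ ($i\ge2$) vanishes whenever one argument is $1_A$. $H^\bullet(A)=\ker(m_1)/\mathrm{Im}(m_1)$;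 $A$ is flat if $H^\bullet(A)$ is a (graded) projective $k$-module. Bigradings. $A$ has a compatible bigrading of $s$-th type if $A=\bigoplus_{p,q\in\mathbb{Z}}A^{p,q}$ with $A^n=\bigoplus_pA^{p,n-p}$ and $m_n$ is homogeneous of bidegree $(2-n)(s,-s+1)$ for all $n$ (and $1_A\in A^{0,0}$ if $A$ is unitary). A morphism $f_\bullet$ between such algebras is compatible with the bigradings if $f_n$ has bidegree $(1-n)(s,-s+1)$ for all $n$. Models. For $A$ flat (resp., flat unitary), let $g_1:H^\bullet(A)\to A$ be the composition of a section of the projection $\ker(m_1)\to H^\bullet(A)$ with the inclusion $\ker(m_1)\subseteq A$ (in the unitary case sending the class $1_{H^\bullet(A)}$ of $1_A$ to $1_A$). A model is a structure of (resp., unitary) $A_\infty$-algebra $\{\bar m_n\}$ on $H^\bullet(A)$ with $\bar m_1=0$, with $\bar m_2$ induced by $m_2$, and such that there is a quasi-isomorphism of (resp., unitary) $A_\infty$-algebras $H^\bullet(A)\to A$ with first component $g_1$. It is compatible with the bigrading of $A$ if the $\bar m_n$ have bidegree $(2-n)(s,-s+1)$ for the induced bigrading of $H^\bullet(A)$ and the quasi-isomorphism can be chosen compatible with the bigradings. Formal bigraded deformations. $k[\hbar]$ is bigraded with $\hbar$ in bidegree $(-1,1)$. The bigraded completion of a bigraded $k[\hbar]$-module $M$ is the inverse limit over $N$, in the category of bigraded $k[\hbar]$-modules, of $M\otimes_{k[\hbar]}k[\hbar]/(\hbar^N)$; $\hat\otimes^{\mathrm{bgr}}_{k[\hbar]}$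 denotes the bigraded completion of $\otimes_{k[\hbar]}$. For a bigraded $k$-module $V$, $V[[\hbar]]^{\mathrm{bgr}}$ is the bigraded completion of $V\otimes k[\hbar]$; explicitly $V[[\hbar]]^{\mathrm{bgr}}=\bigoplus_{p,q}\prod_{r\ge0}(V^{p+r,q-r}\otimes k\hbar^r)$. A formal bigraded deformation $A_\hbar$ of a (resp., unitary) $A_\infty$-algebra $(A,m_\bullet)$ with a compatible bigrading of $s$-th type is the bigraded $k[\hbar]$-module $A[[\hbar]]^{\mathrm{bgr}}$ with $k[\hbar]$-linear maps $\tilde m_n:A_\hbar^{\hat\otimes^{\mathrm{bgr}}_{k[\hbar]}n}\to A_\hbar$ of bidegree $(2-n)(s,-s+1)$, $n\in\mathbb{N}$, such that for every $N\in\mathbb{N}$ the reductions modulo $\hbar^{N+1}$ make $A\otimes k[\hbar]/(\hbar^{N+1})$ a (resp., unitary, with unit $1_A\otimes 1$) $A_\infty$-algebra over $k[\hbar]/(\hbar^{N+1})$, and such that the reduction of $\tilde m_n$ modulo $\hbar$ is $m_n$ for all $n$. A morphism of formal bigraded deformations from $A_\hbar$ (deformation of $A$) to $B_\hbar$ (deformation of $B$) is a morphism $f_\bullet:A\to B$ of (resp., unitary) $A_\infty$-algebras compatible with the bigradings, together with $k[\hbar]$-linear maps $\tilde f_n:A_\hbar^{\hat\otimes^{\mathrm{bgr}}_{k[\hbar]}n}\to B_\hbar$ of bidegree $(1-n)(s,-s+1)$ whose reductions modulo each $\hbar^{N+1}$ form a morphism of (resp., unitary) $A_\infty$-algebras over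 $k[\hbar]/(\hbar^{N+1})$ and whose reduction modulo $\hbar$ is $f_\bullet$. It is a quasi-isomorphism if $f_1$ and $\tilde f_1$ are quasi-isomorphisms of complexes. Two formal bigraded deformations are quasi-isomorphic if they are connected by a zigzag of quasi-isomorphisms of formal bigraded deformations. *)

(* Defs.v *)
From HB Require Import structures.
From Stdlib Require List Relation_Operators.
From mathcomp Require Import all_boot all_order all_algebra generic_quotient.
From mathcomp Require Import ring_quotient.
From mathcomp Require Import boolp functions.
Set Implicit Arguments.
Unset Strict Implicit.
Unset Printing Implicit Defensive.
Import GRing.Theory.
Local Open Scope ring_scope.
Local Open Scope quotient_scope.

Section Gradings.
Variables (R : pzRingType) (M : lmodType R).

Definition submod (P : M -> Prop) :=
  P 0 /\ forall a x y, P x -> P y -> P (a *: x + y).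

Definition in_sum (I : eqType) (P : I -> M -> Prop) (x : M) :=
  exists (s : seq I) (c : I -> M),
    [/\ uniq s, forall i, P i (c i) & x = \sum_(i <- s) c i].

Definition independent (I : eqType) (P : I -> M -> Prop) :=
  forall (s : seq I) (c : I -> M), uniq s -> (forall i, P i (c i)) ->
    \sum_(i <- s) c i = 0 -> forall i, i \in s -> c i = 0.

(* An internal direct sum decomposition of M; [G i x] reads "x lies in M^i".  *)
Record grading (I : eqType) := Grading {
  homog :> I -> M -> Prop;
  homog_submod : forall i, submod (homog i);
  homog_span : forall x, in_sum homog x;
  homog_indep : independent homog }.

Lemma submodD P x y : submod P -> P x -> P y -> P (x + y).
Proof. by case=> _ h px py; rewrite -[x]scale1r; apply: h. Qed.

Lemma submodZ P a x : submod P -> P x -> P (a *: x).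
Proof. by case=> p0 h px; rewrite -[_ *: _]addr0; apply: h. Qed.

Lemma submodB P x y : submod P -> P x -> P y -> P (x - y).
Proof. by move=> h px py; apply: submodD => //; rewrite -scaleN1r; apply: submodZ. Qed.

Lemma submod_sum P (J : Type) (r : seq J) (Q : pred J) (F : J -> M) :
  submod P -> (forall j, Q j -> P (F j)) -> P (\sum_(j <- r | Q j) F j).
Proof.
move=> h hF; elim/big_rec: _ => [|j x Qj px]; first by case: h.
by apply: submodD => //; apply: hF.
Qed.

Lemma in_sum_merge (I : eqType) (P : I -> M -> Prop) (J : eqType) (r : seq J)
    (i : J -> I) (F : J -> M) :
  (forall i, submod (P i)) -> (forall j, j \in r -> P (i j) (F j)) ->
  in_sum P (\sum_(j <- r) F j).
Proof.
move=> hP hF; exists (undup (map i r)), (fun a => \sum_(j <- r | i j == a) F j).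
split; first exact: undup_uniq.
  move=> a; rewrite big_seq_cond; apply: submod_sum => // j /andP[jr /eqP <-].
  exact: hF.
rewrite (exchange_big_dep xpredT) //= big_seq [RHS]big_seq; apply: eq_bigr => j jr.
rewrite big_mkcond (bigD1_seq (i j)) ?undup_uniq ?mem_undup ?map_f //= eqxx.
by rewrite big1 ?addr0 // => a /negPf; rewrite eq_sym => ->.
Qed.

Lemma in_sum_submod (I : eqType) (P : I -> M -> Prop) :
  (forall i, submod (P i)) -> submod (in_sum P).
Proof.
move=> hP; split=> [|a x y [s [c [us hc ->]]] [t [d [ut hd ->]]]].
  by exists [::], (fun=> 0); split=> // [i|]; [case: (hP i) | rewrite big_nil].
have -> : a *: (\sum_(i <- s) c i) + \sum_(i <- t) d i =
    \sum_(j <- map (pair true) s ++ map (pair false) t)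
      (if j.1 then a *: c j.2 else d j.2).
  by rewrite big_cat !big_map /= scaler_sumr.
apply: (in_sum_merge (i := snd)) => // -[[] i] _ /=; last exact: hd.
by apply: submodZ => //; apply: hc.
Qed.

Lemma in_sum1 (I : eqType) (P : I -> M -> Prop) i x :
  (forall i, submod (P i)) -> P i x -> in_sum P x.
Proof.
move=> hP hx.
have -> : x = \sum_(j <- [:: tt]) x by rewrite big_seq1.
exact: (in_sum_merge (i := fun=> i)).
Qed.

Section Components.
Variables (I : eqType) (G : grading I).

Let P0 i : G i 0. Proof. by case: (homog_submod G i). Qed.

Lemma components_exist x : exists sc : seq I * (I -> M),
  [/\ uniq sc.1, forall i, G i (sc.2 i), x = \sum_(i <- sc.1) sc.2 i
    & forall i, i \notin sc.1 -> sc.2 i = 0].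
Proof.
have [s [c [us hc ->]]] := homog_span G x.
exists (s, fun i => if i \in s then c i else 0); split=> //= [i||i].
- by case: ifP => // _; apply: P0.
- by rewrite big_seq [RHS]big_seq; apply: eq_bigr => i ->.
- by move/negPf=> ->.
Qed.

Definition gsupp x := (sval (cid (components_exist x))).1.
Definition gcomp i x := (sval (cid (components_exist x))).2 i.

Lemma gsupp_uniq x : uniq (gsupp x).
Proof. by rewrite /gsupp; case: cid => ? []. Qed.
Lemma gcomp_homog i x : G i (gcomp i x).
Proof. by rewrite /gcomp; case: cid => ? []. Qed.
Lemma gcomp_out i x : i \notin gsupp x -> gcomp i x = 0.
Proof. by rewrite /gcomp /gsupp; case: cid => ? [us hs xE h]; exact: h. Qed.
Lemma gcomp_sum x : x = \sum_(i <- gsupp x) gcomp i x.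
Proof. by rewrite /gcomp /gsupp; case: cid => ? []. Qed.

Lemma gcomp_sumW s x : uniq s -> {subset gsupp x <= s} ->
  x = \sum_(i <- s) gcomp i x.
Proof.
move=> us hs; rewrite {1}[x]gcomp_sum [RHS](bigID (mem (gsupp x))) /=.
rewrite [X in _ + X]big1 ?addr0; last by move=> i; exact: gcomp_out.
rewrite -[RHS]big_filter; apply: perm_big; apply: uniq_perm.
- exact: gsupp_uniq.
- exact: filter_uniq.
by move=> i; rewrite mem_filter; case: (boolP (_ \in gsupp x)) => //= /hs ->.
Qed.

Lemma gcomp_unique s (c : I -> M) x : uniq s -> (forall i, G i (c i)) ->
  (forall i, i \notin s -> c i = 0) -> x = \sum_(i <- s) c i ->
  forall i, gcomp i x = c i.
Proof.
move=> us hc c0 xE i; pose t := undup (i :: s ++ gsupp x).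
have ut : uniq t by apply: undup_uniq.
have sE : x = \sum_(i <- t) c i.
  rewrite xE [RHS](bigID (mem s)) /= [X in _ + X]big1 ?addr0 //.
  rewrite -[RHS]big_filter; apply: perm_big; apply: uniq_perm => //.
    exact: filter_uniq.
  move=> j; rewrite mem_filter mem_undup inE mem_cat.
  by case: (j \in s); rewrite ?orbT.
have tE : x = \sum_(i <- t) gcomp i x.
  by apply: gcomp_sumW => // j hj; rewrite mem_undup inE mem_cat hj !orbT.
apply/eqP; rewrite -subr_eq0; apply/eqP.
apply: (homog_indep ut (c := fun i => gcomp i x - c i)).
- move=> j; apply: submodB; [exact: homog_submod|exact: gcomp_homog|exact: hc].
- by rewrite big_split /= sumrN -tE -sE subrr.
- by rewrite mem_undup inE eqxx.
Qed.

Lemma gcompD i x y : gcomp i (x + y) = gcomp i x + gcomp i y.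
Proof.
apply: (@gcomp_unique (undup (gsupp x ++ gsupp y)) (fun i => gcomp i x + gcomp i y)).
- exact: undup_uniq.
- move=> j; apply: submodD; first exact: homog_submod.
    exact: gcomp_homog.
  exact: gcomp_homog.
- move=> j; rewrite mem_undup mem_cat negb_or => /andP[h1 h2].
  by rewrite !gcomp_out // addr0.
- rewrite big_split /=; congr (_ + _); apply: gcomp_sumW; rewrite ?undup_uniq // => j hj;
    by rewrite mem_undup mem_cat hj ?orbT.
Qed.

Lemma gcomp_homogE i x : G i x -> gcomp i x = x.
Proof.
move=> hx.
rewrite (@gcomp_unique [:: i] (fun j => if j == i then x else 0)) ?eqxx //.
- by move=> j; case: eqP => [->|] //.
- by move=> j; rewrite inE => /negPf ->.
- by rewrite big_seq1 eqxx.
Qed.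

Lemma gcomp_homog0 i j x : G i x -> j != i -> gcomp j x = 0.
Proof.
move=> hx ji.
rewrite (@gcomp_unique [:: i] (fun j => if j == i then x else 0)) ?(negPf ji) //.
- by move=> l; case: eqP => [->|] //.
- by move=> l; rewrite inE => /negPf ->.
- by rewrite big_seq1 eqxx.
Qed.

Lemma gcomp0 i : gcomp i 0 = 0.
Proof. by apply: gcomp_homogE. Qed.

Lemma gcomp_big i (J : Type) (r : seq J) (Q : pred J) (F : J -> M) :
  gcomp i (\sum_(j <- r | Q j) F j) = \sum_(j <- r | Q j) gcomp i (F j).
Proof. by elim/big_rec2: _ => [|j y z _ <-]; rewrite ?gcomp0 ?gcompD. Qed.

Lemma gcomp_eq0 x : (forall i, gcomp i x = 0) -> x = 0.
Proof. by move=> h; rewrite [x]gcomp_sum big1. Qed.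

End Components.
End Gradings.
Arguments homog {R M I} g i x.

Section TotalGrading.
Variables (R : pzRingType) (M : lmodType R) (G : grading M (int * int)%type).

Definition tot_homog (n : int) : M -> Prop :=
  in_sum (fun p : int => G (p, n - p)).

Lemma tot_homogP n x :
  tot_homog n x <-> (forall d, d.1 + d.2 != n -> gcomp G d x = 0).
Proof.
split=> [[s [c [us hc ->]]] d dn|h].
  rewrite gcomp_big big1 // => p _; apply: (gcomp_homog0 (hc p)).
  by apply: contraNneq dn => ->; rewrite /= addrC subrK.
rewrite [x](gcomp_sum G).
rewrite (bigID (fun d : int * int => d.1 + d.2 == n)) /=.
rewrite [X in _ + X]big1 ?addr0; last by move=> d; apply: h.
rewrite -big_filter; apply: (in_sum_merge (i := fst)).
  by move=> p; apply: homog_submod.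
move=> [p q]; rewrite mem_filter /= => /andP[/eqP <- _].
by rewrite [p + q]addrC addrK; apply: gcomp_homog.
Qed.

Lemma tot_submod n : submod (tot_homog n).
Proof. by apply: in_sum_submod => p; apply: homog_submod. Qed.

Lemma tot_span x : in_sum tot_homog x.
Proof.
rewrite [x](gcomp_sum G); apply: (in_sum_merge (i := fun d => d.1 + d.2)).
  exact: tot_submod.
move=> d _; apply/tot_homogP => e; case: (e =P d) => [-> /eqP //|/eqP ed _].
exact: gcomp_homog0 (gcomp_homog _ _ _) ed.
Qed.

Lemma tot_indep : independent tot_homog.
Proof.
move=> s c us hc s0 n ns; apply: (gcomp_eq0 (G := G)) => d.
have [dn|/eqP dn] := eqVneq (d.1 + d.2) n; last by apply: (tot_homogP _ _).1 => //; apply/eqP.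
have := congr1 (gcomp G d) s0; rewrite gcomp0 gcomp_big (bigD1_seq n) //=.
rewrite big1 ?addr0 // => m mn; apply: (tot_homogP m _).1 => //.
by rewrite dn eq_sym.
Qed.

(* The Z-grading M^n = (+)_p M^(p, n - p) underlying a bigrading.             *)
Definition tot : grading M int := Grading tot_submod tot_span tot_indep.

End TotalGrading.

Section Multilinear.
Variables (R : pzRingType) (M N : lmodType R).

(* A family (F_n)_(n >= 1) of maps M^n -> N is encoded by a single function   *)
(* F : seq M -> N, with F_n the restriction of F to lists of size n; linear   *)
(* maps out of the n-th tensor power of M are given as n-linear maps. The     *)
(* value of F on the empty list is irrelevant and unconstrained.              *)
Definition multilinear (F : seq M -> N) :=
  forall a x y xs ys,
    F (xs ++ (a *: x + y) :: ys) = a *: F (xs ++ x :: ys) + F (xs ++ y :: ys).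

Definition of_degree (I : zmodType) (G : grading M I) (G' : grading N I)
    (delta : nat -> I) (F : seq M -> N) :=
  forall ds xs, xs <> [::] -> List.Forall2 G ds xs ->
    G' (\sum_(d <- ds) d + delta (size xs)) (F xs).

End Multilinear.

Definition deg_op (n : nat) : int := 2 - n%:Z.
Definition deg_mor (n : nat) : int := 1 - n%:Z.

Section Ainfinity.
Variable R : comPzRingType.

Definition sign (e : int) : R := (-1) ^+ `|e|%N.

(* The value at xs (homogeneous of degrees ds) of                             *)
(*   sum_(r+s+t=n) (-1)^(r+st) f_(r+1+t) o (id^r (x) m_s (x) id^t).           *)
(* The Koszul rule contributes the sign of parity                             *)
(* |m_s| (|x_1| + ... + |x_r|).                                               *)
Definition insertions (M N : lmodType R) (m : seq M -> M) (f : seq M -> N)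
    (ds : seq int) (xs : seq M) : N :=
  let n := size xs in
  \sum_(0 <= r < n) \sum_(1 <= s < (n - r).+1)
    sign ((r + s * (n - r - s))%N%:Z + deg_op s * \sum_(d <- take r ds) d) *:
      f (take r xs ++ m (take s (drop r xs)) :: drop (r + s) xs).

Record Ainf (M : lmodType R) (G : grading M int) (m : seq M -> M) : Prop := {
  Ainf_multilinear : multilinear m;
  Ainf_degree : of_degree G G deg_op m;
  Ainf_relation : forall ds xs, xs <> [::] -> List.Forall2 G ds xs ->
    insertions m m ds xs = 0 }.

(* For a composition sh = (i_1, ..., i_q) of n.                               *)
Definition shape_sign (sh : seq nat) : nat :=
  \sum_(j < size sh) (size sh - j.+1) * (nth 0%N sh j - 1).

(* The exponent of the Koszul sign of (f_(i_1) (x) ... (x) f_(i_q))(xs), i.e. *)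
(* the sum over j of |f_(i_j)| times the degrees of all arguments preceding   *)
(* the j-th block.                                                            *)
Definition shape_koszul (sh : seq nat) (ds : seq int) : int :=
  \sum_(j < size sh)
    deg_mor (nth 0%N sh j) * \sum_(d <- take (sumn (take j sh)) ds) d.

Definition compositions (M N : lmodType R) (m : seq N -> N) (f : seq M -> N)
    (ds : seq int) (xs : seq M) : N :=
  let n := size xs in
  \sum_(1 <= q < n.+1)
    \sum_(i : q.-tuple 'I_n.+1 | all (leq 1) (map val i)
                                 && (sumn (map val i) == n))
      let sh := map val i in
      sign ((shape_sign sh)%:Z + shape_koszul sh ds) *: m (map f (reshape sh xs)).

Record Ainf_mor (M N : lmodType R) (G : grading M int) (G' : grading N int)
    (m : seq M -> M) (m' : seq N -> N) (f : seq M -> N) : Prop := {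
  Ainf_mor_multilinear : multilinear f;
  Ainf_mor_degree : of_degree G G' deg_mor f;
  Ainf_mor_relation : forall ds xs, xs <> [::] -> List.Forall2 G ds xs ->
    insertions m f ds xs = compositions m' f ds xs }.

Record strict_unit (M : lmodType R) (G : grading M int) (m : seq M -> M)
    (e : M) : Prop := {
  strict_unit_degree : G 0 e;
  strict_unitl : forall x, m [:: e; x] = x;
  strict_unitr : forall x, m [:: x; e] = x;
  strict_unit_vanish : forall xs, e \in xs -> size xs != 2%N -> m xs = 0 }.

(* Non-unitary and unitary algebras are treated together: the unit is an      *)
(* option, None meaning that the algebra is not unitary. Morphisms only exist *)
(* between algebras of the same kind.                                         *)
Definition unitary (M : lmodType R) (G : grading M int) (m : seq M -> M)
    (u : option M) : Prop :=
  if u is Some e then strict_unit G m e else True.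

Definition unitary_mor (M N : lmodType R) (u : option M) (u' : option N)
    (f : seq M -> N) : Prop :=
  match u, u' with
  | Some e, Some e' => f [:: e] = e' /\
      forall xs, e \in xs -> (2 <= size xs)%N -> f xs = 0
  | None, None => True
  | _, _ => False
  end.

End Ainfinity.

Section Cohomology.
Variables (R : pzRingType) (M : lmodType R) (d : {linear M -> M}).

Definition cocycle_pred : pred M := fun x => d x == 0.

Lemma cocycle_submod_closed : submod_closed cocycle_pred.
Proof.
split=> [|a x y]; rewrite /in_mem /= /cocycle_pred ?linear0 ?eqxx //.
by move=> /eqP hx /eqP hy; rewrite linearP hx hy scaler0 addr0.
Qed.

HB.instance Definition _ :=
  GRing.isSubmodClosed.Build R M cocycle_pred cocycle_submod_closed.

Record cocycle := Cocycle { cocycle_val :> M; _ : cocycle_pred cocycle_val }.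
HB.instance Definition _ := [isSub for cocycle_val].
HB.instance Definition _ := [Choice of cocycle by <:].
HB.instance Definition _ := [SubChoice_isSubLmodule of cocycle by <:].

Definition coboundary : pred cocycle := fun x => `[< exists z, val x = d z >].

Lemma coboundary_submod_closed : submod_closed coboundary.
Proof.
split=> [|a x y]; rewrite /in_mem /= /coboundary.
  by apply/asboolP; exists 0; rewrite !linear0.
move=> /asboolP[z hz] /asboolP[w hw]; apply/asboolP; exists (a *: z + w).
by rewrite [RHS]linearP -hz -hw [LHS]linearP.
Qed.

HB.instance Definition _ :=
  GRing.isSubmodClosed.Build R cocycle coboundary coboundary_submod_closed.

Definition cohomology :=
  Quotient.quot (GRing.ZmodClosed.clone cocycle coboundary _).
HB.instance Definition _ := GRing.Zmodule.on cohomology.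

Definition coh_scale (a : R) (c : cohomology) : cohomology :=
  \pi_cohomology (a *: repr c).

Lemma pi_scale a (x : cocycle) :
  coh_scale a (\pi_cohomology x) = \pi_cohomology (a *: x).
Proof.
rewrite /coh_scale; apply/eqP; rewrite -Quotient.idealrBE -scalerBr.
have h : repr (\pi_cohomology x) - x \in coboundary.
  by rewrite Quotient.idealrBE reprK.
exact: (rpredZ a h).
Qed.

Lemma pi_surj (c : cohomology) : exists x : cocycle, c = \pi_cohomology x.
Proof. by exists (repr c); rewrite reprK. Qed.

Lemma piD (x y : cocycle) :
  \pi_cohomology (x + y) = \pi_cohomology x + \pi_cohomology y.
Proof. exact: raddfD. Qed.

Lemma coh_scaleA a b c : coh_scale a (coh_scale b c) = coh_scale (a * b) c.
Proof.
by have [x ->] := pi_surj c; rewrite (pi_scale b x) (pi_scale a) (pi_scale _ x) scalerA.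
Qed.
Lemma coh_scale1 : left_id 1 coh_scale.
Proof. by move=> c; have [x ->] := pi_surj c; rewrite (pi_scale 1 x) scale1r. Qed.
Lemma coh_scaleDr : right_distributive coh_scale +%R.
Proof.
move=> a b c; have [x ->] := pi_surj b; have [y ->] := pi_surj c.
by rewrite -piD (pi_scale a (x + y)) (pi_scale a x) (pi_scale a y) scalerDr piD.
Qed.
Lemma coh_scaleDl c : {morph coh_scale^~ c : a b / a + b}.
Proof.
have [x ->] := pi_surj c => a b.
by rewrite (pi_scale a x) (pi_scale b x) (pi_scale _ x) scalerDl piD.
Qed.

HB.instance Definition _ := GRing.Zmodule_isLmodule.Build R cohomology
  coh_scaleA coh_scale1 coh_scaleDr coh_scaleDl.

(* The class of a cocycle x; a junk value (the class of 0) if d x <> 0.       *)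
Definition coh_class (x : M) : cohomology :=
  \pi_cohomology (insubd (0 : cocycle) x).

Lemma coh_class_lin a x y : d x = 0 -> d y = 0 ->
  coh_class (a *: x + y) = a *: coh_class x + coh_class y.
Proof.
move=> dx dy.
have hx : cocycle_pred x by rewrite /cocycle_pred dx.
have hy : cocycle_pred y by rewrite /cocycle_pred dy.
have hxy : cocycle_pred (a *: x + y).
  by rewrite /cocycle_pred linearP dx dy scaler0 addr0.
have -> : a *: coh_class x = \pi_cohomology (a *: insubd (0 : cocycle) x).
  exact: pi_scale.
rewrite /coh_class -piD; congr (\pi_cohomology _).
by apply: val_inj; rewrite linearP /= !insubdK.
Qed.

Lemma coh_class_eq0 x : d x = 0 -> coh_class x = 0 <-> exists z, x = d z.
Proof.
move=> dx; have hx : cocycle_pred x by rewrite /cocycle_pred dx.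
have -> : (coh_class x = 0) <-> (insubd (0 : cocycle) x \in coboundary).
  rewrite -[insubd _ _]subr0 Quotient.idealrBE; rewrite raddf0.
  by split=> [/eqP|/eqP].
split=> [/asboolP|hz]; first by rewrite insubdK.
by apply/asboolP; rewrite insubdK.
Qed.

Lemma coh_class_surj (c : cohomology) : exists2 x, d x = 0 & c = coh_class x.
Proof.
exists (val (repr c)); first by apply/eqP; exact: (valP (repr c)).
by rewrite /coh_class valKd reprK.
Qed.

Section CohomologyGrading.
Variables (I : zmodType) (G : grading M I) (delta : I).
Hypothesis d_degree : forall i x, G i x -> G (i + delta) (d x).

Definition coh_homog (i : I) (c : cohomology) :=
  exists x, [/\ d x = 0, G i x & c = coh_class x].

Lemma coh_class0 : coh_class 0 = 0.
Proof.
by apply/coh_class_eq0; [rewrite linear0|exists 0; rewrite linear0].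
Qed.

Lemma coh_class_sum (J : Type) (r : seq J) (F : J -> M) :
  (forall j, d (F j) = 0) ->
  coh_class (\sum_(j <- r) F j) = \sum_(j <- r) coh_class (F j).
Proof.
move=> hF; elim: r => [|j r IH]; first by rewrite !big_nil coh_class0.
rewrite !big_cons -IH -[F j]scale1r coh_class_lin ?scale1r //.
by rewrite linear_sum big1.
Qed.

Lemma gcomp_d i x : gcomp G (i + delta) (d x) = d (gcomp G i x).
Proof.
rewrite {1}[x](gcomp_sum G) linear_sum gcomp_big /=.
have [ix|ix] := boolP (i \in gsupp G x).
  rewrite (bigD1_seq i) ?gsupp_uniq //= big1 ?addr0.
    by rewrite gcomp_homogE //; apply/d_degree/gcomp_homog.
  move=> j ji; apply: (gcomp_homog0 (i := j + delta)).
    exact/d_degree/gcomp_homog.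
  by rewrite eq_sym (inj_eq (addIr _)).
rewrite [in RHS]gcomp_out // linear0 big_seq big1 // => j jx.
apply: (gcomp_homog0 (i := j + delta)); first exact/d_degree/gcomp_homog.
by rewrite (inj_eq (addIr _)); apply: contraNneq ix => ->.
Qed.

Lemma coh_submod i : submod (coh_homog i).
Proof.
have [G0 GP] := homog_submod G i; split.
  by exists 0; split; rewrite ?linear0 ?coh_class0.
move=> a _ _ [x [dx gx ->]] [y [dy gy ->]]; exists (a *: x + y); split.
- by rewrite linearP dx dy scaler0 addr0.
- exact: GP.
- by rewrite coh_class_lin.
Qed.

Lemma coh_span c : in_sum coh_homog c.
Proof.
have [x dx ->] := coh_class_surj c.
have dc i : d (gcomp G i x) = 0 by rewrite -gcomp_d dx gcomp0.
exists (gsupp G x), (fun i => coh_class (gcomp G i x)); split.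
- exact: gsupp_uniq.
- by move=> i; exists (gcomp G i x); split=> //; apply: gcomp_homog.
- by rewrite -coh_class_sum // -gcomp_sum.
Qed.

Lemma coh_indep : independent coh_homog.
Proof.
move=> s c us /(_ _)/cid-/all_sig[x hx].
have dx i : d (x i) = 0 by case: (hx i).
have cE i : c i = coh_class (x i) by case: (hx i).
under eq_bigr do rewrite cE.
rewrite -coh_class_sum // => /coh_class_eq0[|z hz i si].
  by rewrite linear_sum big1.
rewrite cE; apply/coh_class_eq0 => //; exists (gcomp G (i - delta) z).
rewrite -gcomp_d subrK -hz gcomp_big (bigD1_seq i) //= big1 ?addr0.
  by rewrite gcomp_homogE //; case: (hx i).
by move=> j ji; apply: (gcomp_homog0 (i := j)); [case: (hx j)|rewrite eq_sym].
Qed.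

Definition coh_grading : grading cohomology I :=
  Grading coh_submod coh_span coh_indep.

End CohomologyGrading.
End Cohomology.

Definition quasi_iso (R : pzRingType) (M N : lmodType R)
    (d : {linear M -> M}) (d' : {linear N -> N}) (f : M -> N) : Prop :=
  (forall x, f (d x) = d' (f x)) /\
  exists phi : {linear cohomology d -> cohomology d'}, bijective phi /\
    forall x, d x = 0 -> phi (coh_class d x) = coh_class d' (f x).

(* For a graded module, being projective in the graded category and being     *)
(* projective as an ungraded module are equivalent.                           *)
Definition projective (R : pzRingType) (P : lmodType R) : Prop :=
  forall (M N : lmodType R) (g : {linear M -> N}) (h : {linear P -> N}),
    (forall y, exists x, g x = y) ->
    exists h' : {linear P -> M}, forall p, g (h' p) = h p.

Section BigradedAinfinity.
Variables (k : comPzRingType) (s : nat).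

Definition bideg_op (n : nat) : int * int :=
  ((2 - n%:Z) * s%:Z, (2 - n%:Z) * (1 - s%:Z)).
Definition bideg_mor (n : nat) : int * int :=
  ((1 - n%:Z) * s%:Z, (1 - n%:Z) * (1 - s%:Z)).

(* A (possibly unitary) A-infinity algebra with a compatible bigrading of     *)
(* s-th type.                                                                 *)
Record bainf (M : lmodType k) (G : grading M (int * int)%type) := BAinf {
  bop : seq M -> M;
  bunit : option M;
  bop_ainf : Ainf (tot G) bop;
  bop_bidegree : of_degree G G bideg_op bop;
  bunit_unitary : unitary (tot G) bop bunit;
  bunit_bidegree : if bunit is Some e then G (0, 0) e else True }.

Record bmor (M N : lmodType k) (G : grading M (int * int)%type)
    (G' : grading N (int * int)%type) (A : bainf G) (B : bainf G') := BMor {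
  bfun : seq M -> N;
  bfun_ainf : Ainf_mor (tot G) (tot G') (bop A) (bop B) bfun;
  bfun_bidegree : of_degree G G' bideg_mor bfun;
  bfun_unitary : unitary_mor (bunit A) (bunit B) bfun }.

Section Differential.
Variables (M : lmodType k) (G : grading M (int * int)%type) (A : bainf G).

Definition bdiff (x : M) : M := bop A [:: x].

Lemma bdiff_linear : linear bdiff.
Proof. by move=> a x y; apply: (Ainf_multilinear (bop_ainf A) a x y [::] [::]). Qed.
HB.instance Definition _ := GRing.isLinear.Build k M M *:%R bdiff bdiff_linear.

Lemma bdiff_degree i x : G i x -> G (i + bideg_op 1) (bdiff x).
Proof.
move=> hx; have := @bop_bidegree _ _ A [:: i] [:: x]; rewrite big_seq1; apply=> //.
by constructor.
Qed.

Definition bcoh : lmodType k := cohomology bdiff.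
Definition bclass (x : M) : bcoh := coh_class bdiff x.
Definition bcoh_grading : grading bcoh (int * int)%type :=
  coh_grading bdiff_degree.

Definition flat : Prop := projective bcoh.

End Differential.

Definition bquasi_iso (M N : lmodType k) (G : grading M (int * int)%type)
    (G' : grading N (int * int)%type) (A : bainf G) (B : bainf G')
    (f : bmor A B) : Prop :=
  quasi_iso (bdiff A) (bdiff B) (fun x => bfun f [:: x]).

(* H is a model of A compatible with the bigrading of A.                      *)
Definition compatible_model (M : lmodType k) (G : grading M (int * int)%type)
    (A : bainf G) (H : bainf (bcoh_grading A)) : Prop :=
  [/\ forall c, bop H [:: c] = 0,
      forall x y, bdiff A x = 0 -> bdiff A y = 0 ->
        bop H [:: bclass A x; bclass A y] = bclass A (bop A [:: x; y]),
      bunit H = omap (bclass A) (bunit A)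
    & exists g1 : {linear bcoh A -> M},
        [/\ forall c, bdiff A (g1 c) = 0 /\ bclass A (g1 c) = c,
            if bunit A is Some e then g1 (bclass A e) = e else True
          & exists f : bmor H A,
              bquasi_iso f /\ forall c, bfun f [:: c] = g1 c] ].

End BigradedAinfinity.

(* V[h]/(h^(N+1)), as coefficient families (v_0, ..., v_N).                   *)
Definition truncated (N : nat) (V : Type) := {ffun 'I_N.+1 -> V}.

Section TruncatedZmodule.
Variables (N : nat) (V : zmodType).
HB.instance Definition _ := GRing.Zmodule.on (truncated N V).
End TruncatedZmodule.

Section TruncatedScale.
Variables (k : comPzRingType) (N : nat) (V : lmodType k).

Definition tscale (a : truncated N k) (x : truncated N V) : truncated N V :=
  [ffun i : 'I_N.+1 => \sum_(j < N.+1) \sum_(l < N.+1 | (j + l == i)%N) a j *: x l].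

End TruncatedScale.

Section TruncatedTheory.
Variables (k : comPzRingType) (N : nat).
Implicit Types V : lmodType k.

Definition tone : truncated N k := [ffun i => (i == ord0)%:R].

Lemma tscale1 V (x : truncated N V) : tscale tone x = x.
Proof.
apply/ffunP=> i; rewrite ffunE (bigD1 ord0) //= [X in _ + X]big1 ?addr0.
  by rewrite (big_pred1 i) ?ffunE ?eqxx ?scale1r // => l; rewrite add0n.
by move=> j /negPf j0; apply: big1 => l _; rewrite ffunE j0 scale0r.
Qed.

Lemma tscaleDr V (a : truncated N k) (x y : truncated N V) :
  tscale a (x + y) = tscale a x + tscale a y.
Proof.
apply/ffunP=> i; rewrite !ffunE -big_split; apply: eq_bigr => j _ /=.
by rewrite -big_split; apply: eq_bigr => l _ /=; rewrite ffunE scalerDr.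
Qed.

Lemma tscaleDl V (a b : truncated N k) (x : truncated N V) :
  tscale (a + b) x = tscale a x + tscale b x.
Proof.
apply/ffunP=> i; rewrite !ffunE -big_split; apply: eq_bigr => j _ /=.
by rewrite -big_split; apply: eq_bigr => l _ /=; rewrite ffunE scalerDl.
Qed.

Definition tmul (a b : truncated N k) : truncated N k :=
  tscale (V := k^o) a b.

Lemma tscaleA V (a b : truncated N k) (x : truncated N V) :
  tscale a (tscale b x) = tscale (tmul a b) x.
Proof.
apply/ffunP=> i; rewrite !ffunE.
transitivity (\sum_(j < N.+1) \sum_(u < N.+1) \sum_(v < N.+1 | (j + u + v == i)%N)
    (a j * b u) *: x v).
  apply: eq_bigr => j _.
  under eq_bigr => l _ do rewrite ffunE scaler_sumr.
  rewrite exchange_big /=; apply: eq_bigr => u _.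
  under eq_bigr => l _ do rewrite scaler_sumr.
  rewrite (exchange_big_dep xpredT) //= [RHS]big_mkcond; apply: eq_bigr => v _.
  case: ifP => [/eqP h|h].
    have lt : (u + v < N.+1)%N by rewrite (leq_ltn_trans _ (ltn_ord i)) // -h -addnA leq_addl.
    rewrite (big_pred1 (Ordinal lt)) ?scalerA // => l.
    apply/andP/eqP => [[_ /eqP uv]|->]; first exact/val_inj.
    by rewrite /= addnA h !eqxx.
  apply: big1 => l /andP[/eqP h1 /eqP h2]; move: h.
  by rewrite -addnA h2 h1 eqxx.
symmetry.
transitivity (\sum_(w < N.+1) \sum_(v < N.+1 | (w + v == i)%N)
   \sum_(j < N.+1) \sum_(u < N.+1 | (j + u == w)%N) (a j * b u) *: x v).
  apply: eq_bigr => w _; apply: eq_bigr => v _; rewrite ffunE scaler_suml.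
  by apply: eq_bigr => j _; rewrite scaler_suml.
under eq_bigr => w _ do rewrite exchange_big /=.
rewrite exchange_big /=; apply: eq_bigr => j _.
transitivity (\sum_(w < N.+1) \sum_(u < N.+1) \sum_(v < N.+1)
    if (w + v == i)%N && (j + u == w)%N then (a j * b u) *: x v else 0).
  apply: eq_bigr => w _; rewrite [RHS]exchange_big /= big_mkcond.
  apply: eq_bigr => v _; rewrite -big_mkcond /=; case: eqP => _ /=; first by [].
  by rewrite big_pred0.
rewrite exchange_big /=; apply: eq_bigr => u _.
rewrite exchange_big /= [RHS]big_mkcond; apply: eq_bigr => v _.
rewrite -big_mkcond; case: ifP => [/eqP h|h].
  have lt : (j + u < N.+1)%N.
    by rewrite (leq_ltn_trans _ (ltn_ord i)) // -h leq_addr.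
  rewrite (big_pred1 (Ordinal lt)) // => w.
  apply/andP/eqP => [[_ /eqP uw]|->]; first exact/val_inj.
  by rewrite /= h !eqxx.
apply: big1 => w /andP[/eqP h1 /eqP h2]; move: h.
by rewrite h2 h1 eqxx.
Qed.


Lemma tmulC : commutative tmul.
Proof.
move=> a b; apply/ffunP=> i; rewrite !ffunE (exchange_big_dep xpredT) //=.
apply: eq_bigr => l _; apply: eq_big => [j|j _]; first by rewrite addnC.
exact: mulrC.
Qed.

Lemma tmulA : associative tmul.
Proof. by move=> a b c; apply: (tscaleA (V := k^o)). Qed.
Lemma tmul1 : left_id tone tmul.
Proof. exact: (tscale1 (V := k^o)). Qed.
Lemma tmulDl : left_distributive tmul +%R.
Proof. by move=> a b c; apply: (tscaleDl (V := k^o)). Qed.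

End TruncatedTheory.

HB.instance Definition _ (k : comPzRingType) (N : nat) :=
  GRing.Zmodule_isComPzRing.Build (truncated N k)
    (@tmulA k N) (@tmulC k N) (@tmul1 k N) (@tmulDl k N).

HB.instance Definition _ (k : comPzRingType) (N : nat) (V : lmodType k) :=
  GRing.Zmodule_isLmodule.Build (truncated N k) (truncated N V)
    (@tscaleA k N V) (@tscale1 k N V) (@tscaleDr k N V)
    (fun x a b => @tscaleDl k N V a b x).

Section TruncatedGrading.
Variables (k : comPzRingType) (M : lmodType k) (G : grading M int) (N : nat).

Definition trunc_homog (n : int) (x : truncated N M) : Prop :=
  forall i, G n (x i).

Lemma trunc_submod n : submod (trunc_homog n).
Proof.
have hG := homog_submod G n; split=> [i|a x y hx hy i].
  by rewrite ffunE; case: hG.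
rewrite ffunE ffunE; apply: submodD => //; apply: submod_sum => // j _.
by apply: submod_sum => // l _; apply: submodZ.
Qed.

Lemma trunc_span x : in_sum trunc_homog x.
Proof.
exists (undup (flatten [seq gsupp G (x i) | i : 'I_N.+1])),
  (fun n => [ffun i => gcomp G n (x i)]).
split; first exact: undup_uniq.
  by move=> n i; rewrite ffunE; apply: gcomp_homog.
apply/ffunP=> i; rewrite sum_ffunE; under eq_bigr do rewrite ffunE.
apply: gcomp_sumW; first exact: undup_uniq.
move=> n hn; rewrite mem_undup; apply/flatten_mapP.
by exists i => //; rewrite mem_enum.
Qed.

Lemma trunc_indep : independent trunc_homog.
Proof.
move=> s c us hc s0 n ns; apply/ffunP=> i; rewrite ffunE.
have := congr1 (fun z : truncated N M => z i) s0; rewrite ffunE sum_ffunE => h.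
exact: (homog_indep us (fun n => hc n i) h ns).
Qed.

Definition trunc_grading : grading (truncated N M) int :=
  Grading trunc_submod trunc_span trunc_indep.

Definition trunc_const (e : M) : truncated N M :=
  [ffun i : 'I_N.+1 => if i == ord0 then e else 0].

End TruncatedGrading.

(* V[[h]]^bgr, realized inside the module of all sequences (v_r)_(r >= 0),    *)
(* read as formal sums of v_r h^r: it is the direct sum over (p, q) of the    *)
(* products over r of V^(p + r, q - r) h^r.                                   *)
Section Series.
Variables (k : comPzRingType) (V : lmodType k) (G : grading V (int * int)%type).

Definition shifted_homog (d : int * int) (v : nat -> V) : Prop :=
  forall r, G (d.1 + r%:Z, d.2 - r%:Z) (v r).

Lemma shifted_submod d : submod (shifted_homog d).
Proof.
split=> [r|a x y hx hy r]; have [G0 GP] := homog_submod G (d.1 + r%:Z, d.2 - r%:Z).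
  exact: G0.
exact: GP.
Qed.

Definition series_pred : pred (nat -> V) := fun v => `[< in_sum shifted_homog v >].

Lemma series_submod_closed : submod_closed series_pred.
Proof.
have [P0 PP] := in_sum_submod shifted_submod.
split=> [|a x y]; rewrite /in_mem /= /series_pred; first exact/asboolP.
by move=> /asboolP hx /asboolP hy; apply/asboolP/PP.
Qed.

HB.instance Definition _ :=
  GRing.isSubmodClosed.Build k (nat -> V) series_pred series_submod_closed.

Record series := Series { coef :> nat -> V; _ : series_pred coef }.
HB.instance Definition _ := [isSub for coef].
HB.instance Definition _ := [Choice of series by <:].
HB.instance Definition _ := [SubChoice_isSubLmodule of series by <:].

Lemma series_proof (v : nat -> V) : in_sum shifted_homog v -> series_pred v.
Proof. by move=> h; apply/asboolP. Qed.

Lemma coefD (x y : series) r : (x + y) r = x r + y r.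
Proof. by []. Qed.
Lemma coefZ a (x : series) r : (a *: x) r = a *: x r.
Proof. by []. Qed.
Lemma coef0 r : (0 : series) r = 0.
Proof. by []. Qed.
Lemma coef_sum (J : Type) (s : seq J) (F : J -> series) r :
  (\sum_(j <- s) F j) r = \sum_(j <- s) F j r.
Proof. by elim/big_rec2: _ => [|j y z _ <-]. Qed.

Definition series_homog (d : int * int) (x : series) : Prop :=
  shifted_homog d (coef x).

Lemma series_submod d : submod (series_homog d).
Proof.
have [P0 PP] := shifted_submod d.
by split=> [|a x y hx hy]; [exact: P0|exact: PP].
Qed.

Lemma series_span x : in_sum series_homog x.
Proof.
case: x => v hv; have /asboolP [s [c [us hc vE]]] := hv.
have hs d : series_pred (c d).
  by apply: series_proof; apply: (in_sum1 (i := d)) => //; apply: shifted_submod.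
exists s, (fun d => Series (hs d)); split=> //.
apply: val_inj; apply/funext=> r /=; rewrite -[RHS]/(coef _ r) coef_sum /= vE.
by rewrite fct_sumE.
Qed.

Lemma series_indep : independent series_homog.
Proof.
move=> s c us hc s0 d ds; apply: val_inj; apply/funext=> r /=.
have := congr1 (fun z => gcomp G (d.1 + r%:Z, d.2 - r%:Z) (coef z r)) s0.
rewrite /= coef_sum gcomp_big (bigD1_seq d) //= big1 ?addr0 => [|e ed].
  by rewrite gcomp_homogE ?gcomp0 //; apply: hc.
apply: (gcomp_homog0 (hc e r)); apply: contraNneq ed => -[h1 h2].
by case: d e {ds} h1 h2 => [d1 d2] [e1 e2] /= /addIr -> /addIr ->.
Qed.

Definition series_grading : grading series (int * int)%type :=
  Grading series_submod series_span series_indep.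

Lemma shift_proof (x : series) :
  series_pred (fun r => if r is r'.+1 then x r' else 0).
Proof.
apply: series_proof; case: (series_span x) => s [c [us hc ->]].
have -> : (fun r => if r is r'.+1 then (\sum_(i <- s) c i : series) r' else 0) =
    \sum_(i <- s) (fun r => if r is r'.+1 then c i r' else 0).
  apply/funext=> -[|r]; rewrite fct_sumE; [by rewrite big1|exact: coef_sum].
apply: (in_sum_merge (i := fun d => (d.1 - 1, d.2 + 1))).
  exact: shifted_submod.
move=> d _ [|r]; first by case: (homog_submod G (d.1 - 1 + 0, d.2 + 1 - 0)).
have := hc d r; rewrite /= -addn1 PoszD; congr (G (_, _) _).
  by rewrite [r%:Z + 1]addrC addrA subrK.
by rewrite opprD [- r%:Z - 1]addrC addrA addrK.
Qed.

(* Multiplication by h. The k[h]-module structure of V[[h]]^bgr consists of   *)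
(* its k-module structure and of this endomorphism.                           *)
Definition hmul (x : series) : series := Series (shift_proof x).

Lemma hmul_surj (x : series) : x 0%N = 0 -> exists z, x = hmul z.
Proof.
move=> x0; have zP : series_pred (fun r => x r.+1).
  apply: series_proof; case: (series_span x) => s [c [us hc ->]].
  have -> : (fun r => (\sum_(i <- s) c i : series) r.+1) =
      \sum_(i <- s) (fun r => c i r.+1).
    by apply/funext=> r; rewrite fct_sumE; apply: coef_sum.
  apply: (in_sum_merge (i := fun d => (d.1 + 1, d.2 - 1))).
    exact: shifted_submod.
  move=> d _ r; have := hc d r.+1; rewrite /= -add1n PoszD opprD.
  by rewrite !addrA.
by exists (Series zP); apply: val_inj; apply/funext=> -[|r].
Qed.

Lemma iter_hmul_surj n (x : series) : (forall i, (i < n)%N -> x i = 0) ->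
  exists z, x = iter n hmul z.
Proof.
elim: n x => [|n IH] x hx; first by exists x.
have [z zE] := hmul_surj (hx 0%N isT).
have [w wE] : exists w, z = iter n hmul w.
  by apply: IH => i ltin; have := hx i.+1 ltin; rewrite zE.
by exists w; rewrite zE wE.
Qed.

Lemma coef_iter_hmul n (x : series) i : (i < n)%N -> iter n hmul x i = 0.
Proof. by elim: n i => // n IH [|i] //= ltin; apply: IH. Qed.

Lemma trunc_lift_proof N (x : truncated N V) :
  series_pred (fun r => if insub r is Some i then x i else 0).
Proof.
apply: series_proof.
have -> : (fun r => if insub r is Some i then x i else 0) =
    \sum_(i < N.+1) \sum_(d <- gsupp G (x i))
      (fun r : nat => if r == i then gcomp G d (x i) else 0).
  apply/funext=> r; rewrite fct_sumE; under eq_bigr do rewrite fct_sumE.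
  case: insubP => [i _ ri|rN].
    rewrite (bigD1 i) //= [X in _ + X]big1 ?addr0 => [|j ji].
      by rewrite -ri eqxx -gcomp_sum.
    by apply: big1 => d _; rewrite -ri (inj_eq val_inj) eq_sym (negPf ji).
  rewrite big1 // => i _; apply: big1 => d _; case: eqP => // ri.
  by rewrite ri ltn_ord in rN.
apply: submod_sum; first exact/in_sum_submod/shifted_submod.
move=> i _; apply: (in_sum_merge (i := fun d => (d.1 - i%:Z, d.2 + i%:Z))).
  exact: shifted_submod.
move=> [p q] _ r /=; case: eqP => [->|_].
  by rewrite subrK addrK; apply: gcomp_homog.
by case: (homog_submod G (p - i%:Z + r%:Z, q + i%:Z - r%:Z)).
Qed.

(* The projection V[[h]]^bgr -> V[h]/(h^(N+1)) and its section by polynomials *)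
(* of degree at most N.                                                       *)
Definition trunc N (x : series) : truncated N V := [ffun i : 'I_N.+1 => x i].
Definition trunc_lift N (x : truncated N V) : series := Series (trunc_lift_proof x).

Lemma trunc_liftK N : cancel (@trunc_lift N) (trunc N).
Proof. by move=> x; apply/ffunP=> i; rewrite ffunE /= valK. Qed.

Definition mod_h (x : series) : V := x 0%N.

End Series.

Section Reduction.
Variables (k : comPzRingType) (V W : lmodType k).
Variables (G : grading V (int * int)%type) (G' : grading W (int * int)%type).

(* Since W[[h]]^bgr is complete, a homogeneous k[h]-multilinear map of n       *)
(* arguments in V[[h]]^bgr extends uniquely to the bigraded completion of the  *)
(* n-th tensor power over k[h]; k[h]-linear maps out of this completion are    *)
(* therefore given as k[h]-multilinear maps.                                   *)
Definition hmultilinear (F : seq (series G) -> series G') : Prop :=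
  multilinear F /\
  forall x xs ys, F (xs ++ hmul x :: ys) = hmul (F (xs ++ x :: ys)).

(* The map induced by F modulo h^(N+1), computed on representatives.          *)
Definition reduction N (F : seq (series G) -> series G')
    (xs : seq (truncated N V)) : truncated N W :=
  trunc N (F (map (@trunc_lift k V G N) xs)).

Lemma trunc_slot N (F : seq (series G) -> series G') xs x y ys :
  hmultilinear F -> trunc N x = trunc N y ->
  trunc N (F (xs ++ x :: ys)) = trunc N (F (xs ++ y :: ys)).
Proof.
move=> [Flin Fh] xy; have [z zE] : exists z, x - y = iter N.+1 (@hmul _ _ _) z.
  apply: iter_hmul_surj => i ltiN.
  have := congr1 (fun v : truncated N V => v (Ordinal ltiN)) xy.
  rewrite !ffunE /= => xyi; rewrite -[LHS]/(x i - y i).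
  by apply/eqP; rewrite subr_eq0; apply/eqP.
have FhN n : F (xs ++ iter n (@hmul _ _ _) z :: ys) =
    iter n (@hmul _ _ _) (F (xs ++ z :: ys)).
  by elim: n => //= n <-.
have -> : x = 1 *: iter N.+1 (@hmul _ _ _) z + y by rewrite scale1r -zE subrK.
rewrite Flin FhN scale1r; apply/ffunP=> i.
by rewrite [LHS]ffunE [RHS]ffunE coefD coef_iter_hmul ?add0r.
Qed.

Lemma reductionE N (F : seq (series G) -> series G') xs : hmultilinear F ->
  trunc N (F xs) = reduction F (map (trunc N) xs).
Proof.
move=> hF; rewrite /reduction -map_comp.
suff h pre : trunc N (F (pre ++ xs)) =
    trunc N (F (pre ++ map (@trunc_lift _ _ _ N \o trunc N) xs)) by exact: (h [::]).
elim: xs pre => [|x xs IH] pre //=.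
rewrite -cat_rcons IH cat_rcons; apply: trunc_slot => //.
by rewrite trunc_liftK.
Qed.

End Reduction.

Section Deformations.
Variables (k : comPzRingType) (s : nat).

Record deformation (M : lmodType k) (G : grading M (int * int)%type)
    (A : bainf s G) := Deformation {
  dop : seq (series G) -> series G;
  dop_hmultilinear : hmultilinear dop;
  dop_bidegree :
    of_degree (series_grading G) (series_grading G) (bideg_op s) dop;
  dop_ainf : forall N, Ainf (trunc_grading (tot G) N) (reduction (N := N) dop);
  dop_unitary : forall N,
    unitary (trunc_grading (tot G) N) (reduction (N := N) dop)
      (omap (trunc_const N) (bunit A));
  dop_mod_h : forall xs, xs <> [::] ->
    mod_h (dop xs) = bop A (map (@mod_h _ _ _) xs) }.

(* A morphism of formal bigraded deformations with underlying morphism f: the *)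
(* field dfun_mod_h is the commutation with the reductions modulo h.          *)
Record dmor (M N : lmodType k) (G : grading M (int * int)%type)
    (G' : grading N (int * int)%type) (A : bainf s G) (B : bainf s G')
    (f : bmor A B) (D : deformation A) (E : deformation B) := DMor {
  dfun : seq (series G) -> series G';
  dfun_hmultilinear : hmultilinear dfun;
  dfun_bidegree :
    of_degree (series_grading G) (series_grading G') (bideg_mor s) dfun;
  dfun_ainf : forall n,
    Ainf_mor (trunc_grading (tot G) n) (trunc_grading (tot G') n)
      (reduction (N := n) (dop D)) (reduction (N := n) (dop E))
      (reduction (N := n) dfun);
  dfun_unitary : forall n,
    unitary_mor (omap (trunc_const n) (bunit A)) (omap (trunc_const n) (bunit B))
      (reduction (N := n) dfun);
  dfun_mod_h : forall xs, xs <> [::] ->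
    mod_h (dfun xs) = bfun f (map (@mod_h _ _ _) xs) }.

Section Differential.
Variables (M : lmodType k) (G : grading M (int * int)%type).
Variables (A : bainf s G) (D : deformation A).

Definition ddiff (x : series G) : series G := dop D [:: x].

Lemma ddiff_linear : linear ddiff.
Proof. by move=> a x y; apply: ((dop_hmultilinear D).1 a x y [::] [::]). Qed.
HB.instance Definition _ :=
  GRing.isLinear.Build k (series G) (series G) *:%R ddiff ddiff_linear.

End Differential.

Definition dquasi_iso (M N : lmodType k) (G : grading M (int * int)%type)
    (G' : grading N (int * int)%type) (A : bainf s G) (B : bainf s G')
    (f : bmor A B) (D : deformation A) (E : deformation B)
    (F : dmor f D E) : Prop :=
  bquasi_iso f /\ quasi_iso (ddiff D) (ddiff E) (fun x => dfun F [:: x]).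

Record deformed := Deformed {
  deformed_module : lmodType k;
  deformed_grading : grading deformed_module (int * int)%type;
  deformed_base : bainf s deformed_grading;
  deformed_def : deformation deformed_base }.

Definition dquasi_iso_step (X Y : deformed) : Prop :=
  exists (f : bmor (deformed_base X) (deformed_base Y))
    (F : dmor f (deformed_def X) (deformed_def Y)), dquasi_iso F.

Definition quasi_isomorphic : deformed -> deformed -> Prop :=
  Relation_Operators.clos_refl_sym_trans deformed dquasi_iso_step.

End Deformations.

(* Main.v *)
From HB Require Import structures.
From mathcomp Require Import all_boot all_order all_algebra.
From mathcomp Require Import boolp functions.
From mathcomp Require Import zify.
Require Import Defs.
Set Implicit Arguments.
Unset Strict Implicit.
Unset Printing Implicit Defensive.
Import GRing.Theory.
Local Open Scope ring_scope.

(** The second assertion is formal: two deformations of H that both map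
quasi-isomorphically to A_h over f are joined by the zigzag through A_h. All the
work is in the construction of H_h and of the lift of f.

In the bar construction the operations become maps of degree 1, morphisms become
maps of degree 0, and the signs of the A-infinity relations are absorbed by the
sign operator of the suspended degree. Let b be the bar form of A_h. Wanted are a
power series B in h lifting the operations of H, and a power series F lifting f,
whose defect D = F B - b F (F extended as a morphism of coalgebras, B and b as
coderivations) vanishes. Since b b = 0, every pair (B, F) satisfies
    F (B B) = D B + b D        (lemma bar_obstruction).
Write D_(r,n) for the coefficient of h^r in arity n and suppose that all entries of
D of weight less than r + n vanish. As H is minimal, B has no term of order 0 in
arity one, so the lowest terms of the identity are
    f_1 (B B)_(r,n) = d D_(r,n)        (lemma defect_step).
Now f_1 is injective on cohomology, so (B B)_(r,n) = 0 and D_(r,n) takes its values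
in the cocycles; f_1 is surjective on cohomology, so D_(r,n) = d htp - f_1 op for
multilinear maps op and htp (lemma solve_exists). The map op is unique, hence
automatically multilinear, homogeneous, and zero on the unit. The map htp lifts a
multilinear map with values in the boundaries along d; such lifts exist because
H(A) is projective (graded_lift), and they can be made to vanish on the unit
because the line spanned by the unit is a direct summand of H(A)
(unit_projector). Adding op to B and htp to F kills D_(r,n) and does not change the
entries of lower weight (lemma defect_perturb). All entries of one weight are
treated simultaneously (lemma lifting_step); each entry is eventually constant along
this process, so there is a limit (transfer_exists), with D = 0 and hence B B = 0.

Finally the linear part of F is a quasi-isomorphism because its cone is complete and
without h-torsion and its reduction modulo h, the cone of f_1, is exact
(cone_exact). *)

(** * Splittings and segmentations of lists *)
Section Splits.
Variable T : Type.
Implicit Types xs u v w : seq T.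

Fixpoint splits xs : seq (seq T * seq T) :=
  ([::], xs) ::
    if xs is x :: xs' then [seq (x :: p.1, p.2) | p <- splits xs'] else [::].

Arguments splits : simpl never.

Section Sums.
Variable Z : zmodType.

Lemma big_splits_cons x xs (H : seq T * seq T -> Z) :
  \sum_(p <- splits (x :: xs)) H p =
    H ([::], x :: xs) + \sum_(p <- splits xs) H (x :: p.1, p.2).
Proof. by rewrite big_cons big_map. Qed.

Lemma big_splits_nil (H : seq T * seq T -> Z) :
  \sum_(p <- splits [::]) H p = H ([::], [::]).
Proof. by rewrite big_seq1. Qed.

(** Coassociativity of deconcatenation. *)
Lemma splitsA xs (K : seq T -> seq T -> seq T -> Z) :
  \sum_(p <- splits xs) \sum_(q <- splits p.2) K p.1 q.1 q.2 =
  \sum_(p <- splits xs) \sum_(q <- splits p.1) K q.1 q.2 p.2.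
Proof.
elim: xs K => [|x xs IH] K; first by rewrite !big_splits_nil.
rewrite big_splits_cons [in RHS]big_splits_cons [X in X + _ = _]big_splits_cons.
rewrite (IH (fun a => K (x :: a))) big_splits_nil -addrA -big_split; congr (_ + _).
by apply: eq_bigr => p _; rewrite [in RHS]big_splits_cons.
Qed.

(** A cut falls either before or after a marked entry. The lemmas on marked entries
    exhibit a sum over splittings as a function of one argument, which is how
    multilinearity of such sums is proved. *)
Lemma splits_mark u y w (H : seq T -> seq T -> Z) :
  \sum_(p <- splits (u ++ y :: w)) H p.1 p.2 =
    \sum_(p <- splits u) H p.1 (p.2 ++ y :: w) +
    \sum_(p <- splits w) H (u ++ y :: p.1) p.2.
Proof.
elim: u H => [|x u IH] H; first by rewrite big_splits_nil big_splits_cons.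
by rewrite !big_splits_cons /= (IH (fun a => H (x :: a))) addrA.
Qed.

Definition splits3 xs (K : seq T -> seq T -> seq T -> Z) :=
  \sum_(p <- splits xs) \sum_(q <- splits p.2) K p.1 q.1 q.2.

Lemma splits3_mark u y w (K : seq T -> seq T -> seq T -> Z) :
  splits3 (u ++ y :: w) K =
    splits3 u (fun a b c => K a b (c ++ y :: w)) +
    \sum_(p <- splits u) \sum_(q <- splits w) K p.1 (p.2 ++ y :: q.1) q.2 +
    splits3 w (fun a b c => K (u ++ y :: a) b c).
Proof.
rewrite /splits3 (splits_mark _ _ _ (fun a c => \sum_(q <- splits c) K a q.1 q.2)).
congr (_ + _); rewrite -big_split; apply: eq_bigr => p _ /=.
exact: (splits_mark _ _ _ (K p.1)).
Qed.

Lemma eq_splits xs (H H' : seq T -> seq T -> Z) :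
  (forall u v, u ++ v = xs -> H u v = H' u v) ->
  \sum_(p <- splits xs) H p.1 p.2 = \sum_(p <- splits xs) H' p.1 p.2.
Proof.
elim: xs H H' => [|x xs IH] H H' h; first by rewrite !big_splits_nil h.
rewrite !big_splits_cons /= h //; congr (_ + _).
by apply: (IH (fun a => H (x :: a)) (fun a => H' (x :: a))) => u v uv; apply: h; rewrite /= ?uv.
Qed.

Lemma eq_splits3 xs (K K' : seq T -> seq T -> seq T -> Z) :
  (forall u v w, u ++ v ++ w = xs -> K u v w = K' u v w) ->
  splits3 xs K = splits3 xs K'.
Proof.
move=> h; rewrite /splits3.
apply: (eq_splits (H := fun a c => \sum_(q <- splits c) K a q.1 q.2)
  (H' := fun a c => \sum_(q <- splits c) K' a q.1 q.2)) => u v uv.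
by apply: eq_splits => a c ac; apply: h; rewrite ac.
Qed.

Lemma splits_last xs (H : seq T -> seq T -> Z) :
  (forall u v, u ++ v = xs -> (size u < size xs)%N -> H u v = 0) ->
  \sum_(p <- splits xs) H p.1 p.2 = H xs [::].
Proof.
elim: xs H => [|x xs IH] H h; first by rewrite big_splits_nil.
rewrite big_splits_cons h // add0r (IH (fun a => H (x :: a))) // => u v uv lt.
by apply: h => //=; rewrite uv.
Qed.

Lemma splits_head xs (H : seq T -> seq T -> Z) :
  (forall u v, u ++ v = xs -> (0 < size u)%N -> H u v = 0) ->
  \sum_(p <- splits xs) H p.1 p.2 = H [::] xs.
Proof.
case: xs => [|x xs] h; first by rewrite big_splits_nil.
rewrite big_splits_cons (eq_splits (H := fun a => H (x :: a)) (H' := fun _ _ => 0)).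
  by rewrite big1_eq addr0.
by move=> u v uv; apply: h; rewrite /= ?uv.
Qed.

(** Isolates the term in which the middle part is everything: in the obstruction
    argument it is the only one that is not of higher order. *)
Lemma splits3_whole xs (K : seq T -> seq T -> seq T -> Z) :
  (forall u v w, u ++ v ++ w = xs -> (size v < size xs)%N -> K u v w = 0) ->
  splits3 xs K = K [::] xs [::].
Proof.
case: xs => [|x xs] h; first by rewrite /splits3 !big_splits_nil.
rewrite /splits3 big_splits_cons /=.
rewrite (splits_last (H := K [::])) => [|u v uv lt]; last exact: h.
rewrite [X in _ + X](eq_splits
  (H := fun a c => \sum_(q <- splits c) K (x :: a) q.1 q.2) (H' := fun _ _ => 0)).
  by rewrite big1 ?addr0.
move=> u v uv; rewrite (eq_splits (H := K (x :: u)) (H' := fun _ _ => 0)) ?big1 //.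
move=> a c ac; apply: h; rewrite ?ac /= ?uv // -uv -ac !size_cat; lia.
Qed.

Lemma big_splits_iota xs (H : seq T -> seq T -> Z) :
  \sum_(p <- splits xs) H p.1 p.2 =
  \sum_(0 <= i < (size xs).+1) H (take i xs) (drop i xs).
Proof.
elim: xs H => [|x xs IH] H; first by rewrite big_splits_nil big_nat1.
by rewrite big_splits_cons big_nat_recl //= (IH (fun a => H (x :: a))).
Qed.

End Sums.
End Splits.

Lemma big_splits_map (S T : Type) (g : S -> T) (Z : zmodType) xs
    (H : seq T -> seq T -> Z) :
  \sum_(p <- splits (map g xs)) H p.1 p.2 =
  \sum_(p <- splits xs) H (map g p.1) (map g p.2).
Proof.
elim: xs H => [|x xs IH] H; first by rewrite !big_splits_nil.
by rewrite !big_splits_cons /= (IH (fun a => H (g x :: a))).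
Qed.

Arguments splits : simpl never.

Section Segmentations.
Variable T : Type.
Implicit Types xs u v w : seq T.

Definition splits1 xs : seq (seq T * seq T) :=
  if xs is x :: xs' then [seq (x :: p.1, p.2) | p <- splits xs'] else [::].

Arguments splits1 : simpl never.

Fixpoint segs_fuel n xs : seq (seq (seq T)) :=
  if xs is [::] then [:: [::]] else
  if n is n'.+1 then [seq p.1 :: bs | p <- splits1 xs, bs <- segs_fuel n' p.2]
  else [::].

(** The blocks are nonempty, so the length of the list is enough fuel. *)
Definition segs xs := segs_fuel (size xs) xs.

Section Sums.
Variable Z : zmodType.

Lemma eq_splits1 xs (H H' : seq T -> seq T -> Z) :
  (forall u v, u ++ v = xs -> (0 < size u)%N -> H u v = H' u v) ->
  \sum_(p <- splits1 xs) H p.1 p.2 = \sum_(p <- splits1 xs) H' p.1 p.2.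
Proof.
case: xs => [|x xs] h; first by rewrite !big_nil.
rewrite /splits1 /= !big_map.
by apply: (eq_splits (H := fun a => H (x :: a)) (H' := fun a => H' (x :: a))) => u v uv; apply: h; rewrite /= ?uv.
Qed.

Lemma splits1E xs (H : seq T -> seq T -> Z) :
  \sum_(p <- splits xs) H p.1 p.2 = H [::] xs + \sum_(p <- splits1 xs) H p.1 p.2.
Proof. by case: xs => [|x xs]; rewrite /splits1 /= big_cons. Qed.

Lemma segs_fuelE n m xs (K : seq (seq T) -> Z) : (size xs <= n)%N -> (size xs <= m)%N ->
  \sum_(bs <- segs_fuel n xs) K bs = \sum_(bs <- segs_fuel m xs) K bs.
Proof.
elim: n m xs K => [|n IH] [|m] [|x xs] K //= hn hm.
rewrite !big_allpairs_dep.
apply: (eq_splits1 (H := fun u w => \sum_(bs <- segs_fuel n w) K (u :: bs))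
  (H' := fun u w => \sum_(bs <- segs_fuel m w) K (u :: bs))) => u v uv u0.
have sv : (size v <= size xs)%N.
  by have := congr1 size uv; rewrite size_cat /=; lia.
by apply: (IH _ _ (fun bs => K (u :: bs))); apply: leq_trans sv _.
Qed.

Lemma segs_nil (K : seq (seq T) -> Z) : \sum_(bs <- segs [::]) K bs = K [::].
Proof. by rewrite big_seq1. Qed.

Lemma segs_first x xs (K : seq (seq T) -> Z) :
  \sum_(bs <- segs (x :: xs)) K bs =
  \sum_(p <- splits1 (x :: xs)) \sum_(bs <- segs p.2) K (p.1 :: bs).
Proof.
rewrite /segs /= big_allpairs_dep.
apply: (eq_splits1 (H := fun u w => \sum_(bs <- segs_fuel (size xs) w) K (u :: bs))
  (H' := fun u w => \sum_(bs <- segs_fuel (size w) w) K (u :: bs))) => u v uv u0.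
have sv : (size v <= size xs)%N.
  by have := congr1 size uv; rewrite size_cat /=; lia.
exact: (segs_fuelE (fun bs => K (u :: bs))).
Qed.

Lemma segs_firstE xs (K : seq (seq T) -> Z) :
  \sum_(bs <- segs xs) K bs = (if xs is [::] then K [::] else 0) +
  \sum_(p <- splits1 xs) \sum_(bs <- segs p.2) K (p.1 :: bs).
Proof.
case: xs => [|x xs]; last by rewrite add0r segs_first.
by rewrite segs_nil big_nil addr0.
Qed.

Lemma splits1A xs (K : seq T -> seq T -> seq T -> Z) :
  \sum_(p <- splits1 xs) \sum_(q <- splits p.2) K p.1 q.1 q.2 =
  \sum_(p <- splits xs) \sum_(q <- splits1 p.1) K q.1 q.2 p.2.
Proof.
have := splitsA xs K.
rewrite (splits1E xs (fun a c => \sum_(q <- splits c) K a q.1 q.2)) => /(canRL (addKr _)) ->.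
rewrite -sumrN -big_split /=.
apply: eq_bigr => p _ /=.
by rewrite (splits1E p.1 (fun a c => K a c p.2)) addKr.
Qed.

(** Cutting a segmentation in two amounts to cutting the list and segmenting both
    parts; this is the compatibility of a morphism of tensor coalgebras with the
    coproduct. *)
Lemma segs_cut xs (K : seq (seq T) -> seq (seq T) -> Z) :
  \sum_(bs <- segs xs) \sum_(p <- splits bs) K p.1 p.2 =
  \sum_(p <- splits xs) \sum_(b <- segs p.1) \sum_(c <- segs p.2) K b c.
Proof.
have [n] := ubnP (size xs); elim: n xs K => // n IH xs K hn.
rewrite segs_firstE.
under [X in _ + X]eq_bigr => p _ do
  (under eq_bigr => bs _ do rewrite big_splits_cons /=; rewrite big_split /=).
rewrite big_split /= addrA.
have -> : (match xs with [::] => \sum_(p <- splits [::]) K p.1 p.2 | _ => 0 end)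
   + \sum_(p <- splits1 xs) \sum_(bs <- segs p.2) K [::] (p.1 :: bs) =
   \sum_(c <- segs xs) K [::] c.
  rewrite [RHS]segs_firstE; congr (_ + _).
  by case: (xs) => //; rewrite big_seq1.
rewrite (eq_splits1 (H := fun u w => \sum_(bs <- segs w) \sum_(p <- splits bs) K (u :: p.1) p.2)
  (H' := fun u w => \sum_(p <- splits w) \sum_(b <- segs p.1) \sum_(c <- segs p.2) K (u :: b) c)); last first.
  move=> u v uv u0; apply: (IH _ (fun a => K (u :: a))).
  by have := congr1 size uv; rewrite size_cat; lia.
rewrite (splits1A xs (fun u w1 w2 => \sum_(b <- segs w1) \sum_(c <- segs w2) K (u :: b) c)).
under [RHS]eq_bigr => p _ do rewrite segs_firstE.
rewrite big_split /=; congr (_ + _).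
rewrite (splits1E xs (fun a c => match a with [::] => \sum_(j <- segs c) K [::] j | _ => 0 end)).
rewrite [X in _ = _ + X](eq_splits1 (H' := fun _ _ => 0)
  (H := fun a c => match a with [::] => \sum_(j <- segs c) K [::] j | _ => 0 end)).
  by rewrite (big1_eq (splits1 xs)) addr0.
by case.
Qed.

(** The block of a marked entry y consists of the end of u, y and the beginning of
    w; the remaining blocks segment what is left on either side. *)
Lemma segs_mark u y w (K : seq (seq T) -> Z) :
  \sum_(bs <- segs (u ++ y :: w)) K bs =
  \sum_(p <- splits u) \sum_(q <- splits w)
    \sum_(b <- segs p.1) \sum_(c <- segs q.2) K (b ++ (p.2 ++ y :: q.1) :: c).
Proof.
have [n] := ubnP (size u); elim: n u K => // n IH u K hn.
have H1 : \sum_(bs <- segs (u ++ y :: w)) K bs =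
    \sum_(p <- splits1 (u ++ y :: w)) \sum_(bs <- segs p.2) K (p.1 :: bs).
  by rewrite segs_firstE; case: (u) => [|? ?] /=; rewrite add0r.
rewrite H1.
have := splits_mark u y w (fun a c => \sum_(bs <- segs c) K (a :: bs)).
rewrite (splits1E (u ++ y :: w) (fun a c => \sum_(bs <- segs c) K (a :: bs))).
rewrite (splits1E u (fun a c => \sum_(bs <- segs (c ++ y :: w)) K (a :: bs))).
rewrite -addrA => /addrI ->.
rewrite (eq_splits1 (H := fun a c => \sum_(bs <- segs (c ++ y :: w)) K (a :: bs))
  (H' := fun a c => \sum_(p <- splits c) \sum_(q <- splits w)
    \sum_(b <- segs p.1) \sum_(e <- segs q.2) K (a :: b ++ (p.2 ++ y :: q.1) :: e))); last first.
  move=> a c ac a0; apply: (IH _ (fun bs => K (a :: bs))).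
  by have := congr1 size ac; rewrite size_cat; lia.
rewrite (splits1A u (fun a c1 c2 => \sum_(q <- splits w)
    \sum_(b <- segs c1) \sum_(e <- segs q.2) K (a :: b ++ (c2 ++ y :: q.1) :: e))).
under [RHS]eq_bigr => p _ do under eq_bigr => q _ do rewrite segs_firstE.
under [RHS]eq_bigr => p _ do rewrite big_split.
rewrite big_split /= addrC; congr (_ + _); last first.
  apply: eq_bigr => p _; rewrite exchange_big /=; apply: eq_bigr => q _.
  by [].
rewrite (splits1E u (fun a c => \sum_(i <- splits w) match a with
  [::] => \sum_(e <- segs i.2) K ([::] ++ (c ++ y :: i.1) :: e) | _ => 0 end)).
rewrite [X in _ = _ + X](eq_splits1 (H' := fun _ _ => 0)
  (H := fun a c => \sum_(i <- splits w) match a with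
  [::] => \sum_(e <- segs i.2) K ([::] ++ (c ++ y :: i.1) :: e) | _ => 0 end)).
  by rewrite (big1_eq (splits1 u)) addr0.
by case=> // x a c _ _; rewrite big1.
Qed.

(** Isolates the segmentation with a single block. *)
Lemma segs_whole xs (K : seq (seq T) -> Z) : (0 < size xs)%N ->
  (forall bs, flatten bs = xs -> all (fun b => 0 < size b < size xs)%N bs -> K bs = 0) ->
  \sum_(bs <- segs xs) K bs = K [:: xs].
Proof.
case: xs => // x xs _ h; rewrite segs_first.
have segsP n (ys : seq T) (L : seq (seq T) -> Z) :
    (size ys <= n)%N ->
    (forall bs, flatten bs = ys -> all (fun b => 0 < size b)%N bs -> L bs = 0) ->
    \sum_(bs <- segs ys) L bs = 0.
  elim: n ys L => [|n IH] [|y ys] L //= hn hL; rewrite ?segs_nil ?hL // segs_first.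
  rewrite (eq_splits1 (H := fun a c => \sum_(bs <- segs c) L (a :: bs)) (H' := fun _ _ => 0)) ?big1 //.
  move=> a c ac a0; apply: (IH _ (fun bs => L (a :: bs))) => [|bs fbs hbs].
    by have := congr1 size ac; rewrite size_cat /=; lia.
  by apply: hL; rewrite /= ?fbs ?ac // a0.
rewrite (eq_splits1 (H := fun a c => \sum_(bs <- segs c) K (a :: bs))
   (H' := fun a c => if c is [::] then K [:: a] else 0)).
  rewrite /splits1 /= big_map.
  rewrite (splits_last (H := fun a c => if c is [::] then K [:: x :: a] else 0)) // => u [|? ?] //.
  by rewrite cats0 => ->; rewrite ltnn.
move=> a [|y c] ac a0; first by rewrite segs_nil.
apply: (segsP _ _ _ (leqnn _)) => bs fbs abs; apply: h; rewrite /= ?fbs //.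
have sz := congr1 size ac; rewrite size_cat /= in sz.
rewrite a0 /=; apply/andP; split; first by lia.
have {}fbs : (size (flatten bs) <= size xs)%N by rewrite fbs /=; lia.
elim: bs abs fbs => //= b bs IH /andP[b0 abs]; rewrite size_cat => hb.
by rewrite IH ?b0 //=; lia.
Qed.

End Sums.
End Segmentations.
Arguments splits1 : simpl never.

Lemma segs_map (S T : Type) (g : S -> T) (Z : zmodType) xs (K : seq (seq T) -> Z) :
  \sum_(bs <- segs (map g xs)) K bs = \sum_(bs <- segs xs) K (map (map g) bs).
Proof.
have [n] := ubnP (size xs); elim: n xs K => // n IH [|x xs] K hn.
  by rewrite !segs_nil.
rewrite [LHS](segs_first (g x) (map g xs)) segs_first /splits1 /= !big_map.
rewrite (big_splits_map g xs (fun a c => \sum_(bs <- segs c) K ((g x :: a) :: bs))).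
apply: (eq_splits (H := fun a c => \sum_(bs <- segs (map g c)) K ((g x :: map g a) :: bs))
  (H' := fun a c => \sum_(bs <- segs c) K ((g x :: map g a) :: map (map g) bs))) => u v uv.
apply: (IH _ (fun bs => K ((g x :: map g u) :: bs))).
by move: hn; rewrite -uv /= size_cat; lia.
Qed.

(** * Insertions and compositions without signs *)

Section SplitSums.
Variables (T : Type) (Z : zmodType).
Implicit Types N : seq T -> seq T -> seq T -> seq T -> seq T -> Z.

(** The next two lemmas compare sums over the factorisations of xs in five parts. *)
Lemma splits5_mid xs N :
  splits3 xs (fun u v w => \sum_(p <- splits u) \sum_(q <- splits w) N p.1 p.2 v q.1 q.2) =
  splits3 xs (fun u v w => splits3 v (fun a c e => N u a c e w)).
Proof.
rewrite /splits3.
transitivity (\sum_(p <- splits xs) \sum_(r <- splits p.2) \sum_(q <- splits r.2)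
  \sum_(t <- splits q.2) N p.1 r.1 q.1 t.1 t.2).
  rewrite (splitsA xs (fun a c d => \sum_(q <- splits d) \sum_(t <- splits q.2) N a c q.1 t.1 t.2)).
  by apply: eq_bigr => p _; rewrite exchange_big.
apply: eq_bigr => p _.
rewrite -[RHS](splitsA p.2 (fun a c' f => \sum_(t <- splits c') N p.1 a t.1 t.2 f)).
apply: eq_bigr => q _.
exact: (splitsA q.2 (fun a c d => N p.1 q.1 a c d)).
Qed.

Lemma splits5_left xs N :
  splits3 xs (fun u v w => splits3 u (fun a c e => N a c e v w)) =
  splits3 xs (fun u v w => splits3 w (fun a c e => N u v a c e)).
Proof.
rewrite /splits3.
transitivity (\sum_(p <- splits xs) \sum_(r <- splits p.1) \sum_(t <- splits r.2)
   \sum_(q <- splits p.2) N r.1 t.1 t.2 q.1 q.2).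
  apply: eq_bigr => p _; rewrite exchange_big /=; apply: eq_bigr => r _.
  by rewrite exchange_big.
rewrite -(splitsA xs (fun a c' d => \sum_(t <- splits c') \sum_(q <- splits d) N a t.1 t.2 q.1 q.2)).
apply: eq_bigr => p _.
rewrite -(splitsA p.2 (fun c e d => \sum_(q <- splits d) N p.1 c e q.1 q.2)).
by [].
Qed.

Lemma splits3D xs (K K' : seq T -> seq T -> seq T -> Z) :
  splits3 xs (fun u v w => K u v w + K' u v w) = splits3 xs K + splits3 xs K'.
Proof. by rewrite /splits3 -big_split; apply: eq_bigr => p _ /=; rewrite -big_split. Qed.

Lemma splits3N xs (K : seq T -> seq T -> seq T -> Z) :
  splits3 xs (fun u v w => - K u v w) = - splits3 xs K.
Proof. by rewrite /splits3 -sumrN; apply: eq_bigr => p _ /=; rewrite -sumrN. Qed.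

Lemma splits3_eq0 xs (K : seq T -> seq T -> seq T -> Z) :
  (forall u v w, u ++ v ++ w = xs -> K u v w = 0) -> splits3 xs K = 0.
Proof.
move=> h; rewrite (eq_splits3 (K' := fun _ _ _ => 0)) //.
by rewrite /splits3 big1 // => p _; rewrite big1.
Qed.

End SplitSums.

Lemma splits3_map (S T : Type) (g : S -> T) (Z : zmodType) xs
    (K : seq T -> seq T -> seq T -> Z) :
  splits3 (map g xs) K = splits3 xs (fun u v w => K (map g u) (map g v) (map g w)).
Proof.
rewrite /splits3 (big_splits_map g xs (fun a c => \sum_(q <- splits c) K a q.1 q.2)).
by apply: eq_bigr => p _; rewrite (big_splits_map g p.2 (K (map g p.1))).
Qed.

Section Slots.
Variables (k : comPzRingType) (X Z : lmodType k) (F : seq X -> Z).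
Hypothesis Flin : multilinear F.

Lemma mlinD u w x y : F (u ++ (x + y) :: w) = F (u ++ x :: w) + F (u ++ y :: w).
Proof. by have := Flin 1 x y u w; rewrite !scale1r. Qed.

Lemma mlin0 u w : F (u ++ 0 :: w) = 0.
Proof. by apply: (addIr (F (u ++ 0 :: w))); rewrite -mlinD !add0r. Qed.

Lemma mlinZ u w a x : F (u ++ (a *: x) :: w) = a *: F (u ++ x :: w).
Proof. by have := Flin a x 0 u w; rewrite mlin0 !addr0. Qed.

Lemma mlinN u w x : F (u ++ (- x) :: w) = - F (u ++ x :: w).
Proof. by rewrite -scaleN1r mlinZ scaleN1r. Qed.

Lemma mlinB u w x y : F (u ++ (x - y) :: w) = F (u ++ x :: w) - F (u ++ y :: w).
Proof. by rewrite mlinD mlinN. Qed.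

Lemma mlin_sum u w (J : Type) (r : seq J) (f : J -> X) :
  F (u ++ (\sum_(j <- r) f j) :: w) = \sum_(j <- r) F (u ++ f j :: w).
Proof.
elim: r => [|j r IH]; first by rewrite !big_nil mlin0.
by rewrite !big_cons mlinD IH.
Qed.

End Slots.

Section BarOperations.
Variable k : comPzRingType.

(** G composed with the coderivation induced by b; sg is the sign operator of the
    suspended degree, which produces the Koszul sign of the odd map b. *)
Definition bar_insert (X Z : lmodType k) (sg : X -> X) (b : seq X -> X) (G : seq X -> Z) xs : Z :=
  splits3 xs (fun u v w => G (map sg u ++ b v :: w)).

(** G composed with the morphism of tensor coalgebras induced by F. *)
Definition bar_compose (X Y Z : lmodType k) (F : seq X -> Y) (G : seq Y -> Z) xs : Z :=
  \sum_(bs <- segs xs) G (map F bs).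

(** G composed with the coderivation along F whose corestriction is D. *)
Definition bar_mix (X Y Z : lmodType k) (sg : Y -> Y) (F D : seq X -> Y) (G : seq Y -> Z) xs : Z :=
  splits3 xs (fun u v w => \sum_(b <- segs u) \sum_(c <- segs w)
    G (map sg (map F b) ++ D v :: map F c)).

Section Identities.
Variables (X Y Z : lmodType k) (sX : X -> X) (sY : Y -> Y).

(** The square of an odd coderivation is the coderivation induced by its
    corestriction: two nested insertions give the right-hand side, and two disjoint
    ones occur twice, with opposite signs because b changes the parity. *)
Lemma bar_insert_insert (b : seq X -> X) (G : seq X -> Z) xs :
  multilinear G -> involutive sX -> (forall v, b (map sX v) = - sX (b v)) ->
  bar_insert sX b (bar_insert sX b G) xs = splits3 xs (fun u v w => G (u ++ bar_insert sX b b v :: w)).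
Proof.
move=> Glin sK bs; rewrite {1 2}/bar_insert.
have mK (l : seq X) : map sX (map sX l) = l by rewrite -map_comp map_id_in // => x _; exact: sK.
under eq_splits3 => u v w _ do rewrite splits3_mark.
rewrite !splits3D addrAC.
rewrite [X in X + _](_ : _ = 0) ?add0r; last first.
  pose N u v w c d := G (u ++ sX (b v) :: map sX w ++ b c :: d).
  rewrite -[X in _ + X]/(splits3 xs (fun u v w => splits3 w (fun a c e =>
     G (map sX (map sX u ++ b v :: a) ++ b c :: e)))).
  rewrite [X in _ + X](_ : _ = splits3 xs (fun u v w => splits3 w (N u v))); last first.
    by apply: eq_splits3 => u v w _; apply: eq_splits3 => a c e _; rewrite map_cat mK -catA.
  rewrite -splits5_left -splits3D; apply: splits3_eq0 => u v w _.
  rewrite splits3_map -splits3D; apply: splits3_eq0 => a c e _.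
  by rewrite mK bs mlinN // addNr.
rewrite -[RHS](_ : splits3 xs (fun u v w => splits3 v (fun a c e => G (u ++ b (map sX a ++ b c :: e) :: w))) = _); last first.
  apply: eq_splits3 => u v w _; rewrite {1}/bar_insert /splits3 mlin_sum //.
  by apply: eq_bigr => p _; rewrite mlin_sum.
rewrite -[RHS](splits5_mid xs (fun a c v e f => G (a ++ b (map sX c ++ b v :: e) :: f))).
apply: eq_splits3 => u v w _.
rewrite (big_splits_map sX u (fun a c => \sum_(q <- splits w) G (map sX a ++ b (c ++ b v :: q.1) :: q.2))).
by apply: eq_bigr => p _; rewrite mK.
Qed.

(** The inserted value lies in exactly one block of each segmentation; summing over
    the insertions into that block gives the corestriction. *)
Lemma bar_insert_compose (B : seq X -> X) (F : seq X -> Y) (G : seq Y -> Z) xs :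
  multilinear G -> (forall v, F (map sX v) = sY (F v)) ->
  bar_insert sX B (bar_compose F G) xs = bar_mix sY F (bar_insert sX B F) G xs.
Proof.
move=> Glin Fs; rewrite /bar_insert /bar_compose /bar_mix.
under eq_splits3 => u v w _ do rewrite segs_mark.
transitivity (splits3 xs (fun u v w => splits3 v (fun a c e =>
   \sum_(b <- segs u) \sum_(f <- segs w)
      G (map sY (map F b) ++ F (map sX a ++ B c :: e) :: map F f)))).
  rewrite -(splits5_mid xs (fun u a c e w => \sum_(b <- segs u) \sum_(f <- segs w)
      G (map sY (map F b) ++ F (map sX a ++ B c :: e) :: map F f))).
  apply: eq_splits3 => u v w _.
  rewrite (big_splits_map sX u (fun a c => \sum_(q <- splits w)
    \sum_(b <- segs a) \sum_(f <- segs q.2) G (map F (b ++ (c ++ B v :: q.1) :: f)))).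
  apply: eq_bigr => p _; apply: eq_bigr => q _; rewrite segs_map.
  apply: eq_bigr => b _; apply: eq_bigr => f _; rewrite map_cat /=; congr (G (_ ++ _)).
  by rewrite -!map_comp; apply: eq_map => v' /=; rewrite Fs.
apply: eq_splits3 => u v w _; rewrite /splits3.
under eq_bigr => p _ do rewrite exchange_big.
rewrite exchange_big; apply: eq_bigr => b _ /=.
under eq_bigr => p _ do rewrite exchange_big.
rewrite exchange_big; apply: eq_bigr => f _ /=.
by rewrite mlin_sum //; apply: eq_bigr => p _; rewrite mlin_sum.
Qed.

(** The arguments of b form a sublist of the blocks, hence a segmentation of a
    sublist of the arguments. *)
Lemma bar_compose_insert (F : seq X -> Y) (b : seq Y -> Y) (G : seq Y -> Z) xs :
  multilinear G -> bar_compose F (bar_insert sY b G) xs = bar_mix sY F (bar_compose F b) G xs.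
Proof.
move=> Glin; rewrite /bar_insert /bar_compose /bar_mix.
under eq_bigr => bs _ do rewrite splits3_map.
rewrite (segs_cut xs (fun u vw => \sum_(q <- splits vw)
  G (map sY (map F u) ++ b (map F q.1) :: map F q.2))).
apply: eq_bigr => p _; rewrite /=.
under eq_bigr => u _ do
  rewrite (segs_cut p.2 (fun v w => G (map sY (map F u) ++ b (map F v) :: map F w))).
rewrite exchange_big; apply: eq_bigr => q _; apply: eq_bigr => u _ /=.
rewrite exchange_big; apply: eq_bigr => w _.
by rewrite mlin_sum.
Qed.

End Identities.

(** The obstruction identity F (B B) = D B + b D with D = F B - b F: the terms b F B
    cancel and b b F = 0. *)
Lemma bar_obstruction (X Y : lmodType k) (sX : X -> X) (sY : Y -> Y)
    (B : seq X -> X) (b : seq Y -> Y) (F : seq X -> Y) xs :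
  multilinear F -> multilinear b ->
  involutive sX -> (forall v, B (map sX v) = - sX (B v)) ->
  (forall v, F (map sX v) = sY (F v)) ->
  (forall ys, bar_insert sY b b ys = 0) ->
  splits3 xs (fun u v w => F (u ++ bar_insert sX B B v :: w)) =
  bar_insert sX B (fun v => bar_insert sX B F v - bar_compose F b v) xs +
  bar_mix sY F (fun v => bar_insert sX B F v - bar_compose F b v) b xs.
Proof.
move=> Flin blin sK Bs Fs bb.
have -> : bar_mix sY F (fun v => bar_insert sX B F v - bar_compose F b v) b xs = bar_insert sX B (bar_compose F b) xs.
  rewrite (bar_insert_compose B xs blin Fs).
  have e0 : bar_mix sY F (bar_compose F b) b xs = 0.
    by rewrite -bar_compose_insert // /bar_compose big1.
  rewrite -[RHS]subr0 -{1}e0 /bar_mix -splits3N -splits3D; apply: eq_splits3 => u v w _.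
  rewrite -sumrB; apply: eq_bigr => p _.
  by rewrite -sumrB; apply: eq_bigr => q _ /=; rewrite mlinB.
rewrite -(bar_insert_insert xs Flin sK Bs) /bar_insert -splits3D.
by apply: eq_splits3 => u v w _; rewrite subrK.
Qed.

End BarOperations.

Section Hlinear.
Variable k : comPzRingType.

(** The operators hX and hZ are multiplication by h on power series, or 0 when only
    linearity over k matters; both cases share the closure lemmas below. *)
Definition hlin (X Z : lmodType k) (hX : X -> X) (hZ : Z -> Z) (f : X -> Z) :=
  (forall a x y, f (a *: x + y) = a *: f x + f y) /\ (forall x, f (hX x) = hZ (f x)).

Definition hmlin (X Z : lmodType k) (hX : X -> X) (hZ : Z -> Z) (F : seq X -> Z) :=
  forall u w, hlin hX hZ (fun x => F (u ++ x :: w)).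

Lemma hmlin_multilinear (X Z : lmodType k) hX hZ (F : seq X -> Z) :
  hmlin hX hZ F -> multilinear F.
Proof. by move=> h a x y u w; case: (h u w) => ->. Qed.

Lemma multilinear_hmlin (X Z : lmodType k) (F : seq X -> Z) :
  multilinear F -> hmlin (fun=> 0) (fun=> 0) F.
Proof. by move=> h u w; split=> [a x y|x]; [exact: h|exact: mlin0]. Qed.

Section Closure.
Variables (X Z : lmodType k) (hX : X -> X) (hZ : {additive Z -> Z}).
Implicit Types f : X -> Z.

Lemma hlinD f g : hlin hX hZ f -> hlin hX hZ g -> hlin hX hZ (fun x => f x + g x).
Proof.
move=> [f1 f2] [g1 g2]; split=> [a x y|x]; last by rewrite f2 g2 raddfD.
by rewrite f1 g1 scalerDr addrACA.
Qed.

Lemma hlinN f : hlin hX hZ f -> hlin hX hZ (fun x => - f x).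
Proof.
move=> [f1 f2]; split=> [a x y|x]; last by rewrite f2 raddfN.
by rewrite f1 opprD scalerN.
Qed.

Lemma hlin_sum (J : Type) (r : seq J) (F : J -> X -> Z) :
  (forall j, hlin hX hZ (F j)) -> hlin hX hZ (fun x => \sum_(j <- r) F j x).
Proof.
move=> h; split=> [a x y|x].
  by rewrite scaler_sumr -big_split; apply: eq_bigr => j _; case: (h j) => ->.
by rewrite raddf_sum; apply: eq_bigr => j _; case: (h j) => _ ->.
Qed.

Lemma eq_hlin f g : f =1 g -> hlin hX hZ f -> hlin hX hZ g.
Proof. by move=> /funext ->. Qed.

End Closure.

Lemma hmlin_bar_insert (X Z : lmodType k) (hX : {additive X -> X}) (hZ : {additive Z -> Z})
    (sg : {linear X -> X}) b (G : seq X -> Z) :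
  (forall x, sg (hX x) = hX (sg x)) ->
  hmlin hX hX b -> hmlin hX hZ G -> hmlin hX hZ (bar_insert sg b G).
Proof.
move=> sh hb hG u w.
apply: (@eq_hlin _ _ _ _ (fun x =>
  splits3 u (fun a v c => G ((map sg a ++ b v :: c) ++ x :: w)) +
  \sum_(p <- splits u) \sum_(q <- splits w)
    G (map sg p.1 ++ b (map sg [::] ++ p.2 ++ x :: q.1) :: q.2) +
  splits3 w (fun a v c => G (map sg u ++ sg x :: (map sg a ++ b v :: c))))).
  move=> x; rewrite /bar_insert splits3_mark; congr (_ + _ + _).
    by apply: eq_splits3 => a v c _; rewrite -catA.
  by apply: eq_splits3 => a v c _; rewrite map_cat /= -catA.
apply: hlinD; first apply: hlinD.
- apply: hlin_sum => p; apply: hlin_sum => q; exact: hG.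
- apply: hlin_sum => p; apply: hlin_sum => q.
  have [f1 f2] := hb p.2 q.1; have [g1 g2] := hG (map sg p.1) q.2.
  by split=> [a x y|x] /=; rewrite ?f1 ?f2 ?g1 ?g2.
apply: hlin_sum => p; apply: hlin_sum => q.
have [g1 g2] := hG (map sg u) (map sg p.1 ++ b q.1 :: q.2).
by split=> [a x y|x] /=; rewrite ?sh ?linearP ?g1 ?g2.
Qed.

Lemma hmlin_bar_compose (X Y Z : lmodType k) (hX : {additive X -> X}) (hY : {additive Y -> Y})
    (hZ : {additive Z -> Z}) (F : seq X -> Y) (G : seq Y -> Z) :
  hmlin hX hY F -> hmlin hY hZ G -> hmlin hX hZ (bar_compose F G).
Proof.
move=> hF hG u w.
apply: (@eq_hlin _ _ _ _ (fun x =>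
  \sum_(p <- splits u) \sum_(q <- splits w) \sum_(b <- segs p.1) \sum_(c <- segs q.2)
     G (map F b ++ F (p.2 ++ x :: q.1) :: map F c))).
  move=> x; rewrite /bar_compose segs_mark.
  apply: eq_bigr => p _; apply: eq_bigr => q _; apply: eq_bigr => b _.
  by apply: eq_bigr => c _; rewrite map_cat.
apply: hlin_sum => p; apply: hlin_sum => q; apply: hlin_sum => b; apply: hlin_sum => c.
have [f1 f2] := hF p.2 q.1; have [g1 g2] := hG (map F b) (map F c).
by split=> [a x y|x] /=; rewrite ?f1 ?f2 ?g1 ?g2.
Qed.

Lemma hmlinB (X Z : lmodType k) (hX : {additive X -> X}) (hZ : {additive Z -> Z})
    (F G : seq X -> Z) :
  hmlin hX hZ F -> hmlin hX hZ G -> hmlin hX hZ (fun xs => F xs - G xs).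
Proof. by move=> hF hG u w; apply: hlinD => //; apply: hlinN. Qed.

End Hlinear.

(** * Parity and multilinear maps on graded modules *)

(** Signs only depend on parities, so they are computed in bool. *)
Definition parity (e : int) : bool := odd `|e|%N.

Lemma parityN e : parity (- e) = parity e.
Proof. by rewrite /parity abszN. Qed.

Lemma parityD a b : parity (a + b) = parity a (+) parity b.
Proof. rewrite /parity; lia. Qed.

Lemma parityB a b : parity (a - b) = parity a (+) parity b.
Proof. by rewrite parityD parityN. Qed.

Lemma parityM a b : parity (a * b) = parity a && parity b.
Proof. by rewrite /parity abszM oddM. Qed.

Lemma parity_nat n : parity n%:Z = odd n.
Proof. by []. Qed.

Section SignAction.
Definition signb (V : zmodType) (b : bool) (x : V) : V := if b then - x else x.

Lemma signbK (V : zmodType) b c (x : V) : signb b (signb c x) = signb (b (+) c) x.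
Proof. by case: b c => [] [] //=; rewrite opprK. Qed.

Lemma signb0 (V : zmodType) b : signb b (0 : V) = 0.
Proof. by case: b => //=; rewrite oppr0. Qed.

Lemma signb_sum (V : zmodType) b (J : Type) (r : seq J) (Q : pred J) (f : J -> V) :
  signb b (\sum_(j <- r | Q j) f j) = \sum_(j <- r | Q j) signb b (f j).
Proof. by case: b => //=; rewrite -sumrN. Qed.

Lemma signb_lin (k : pzRingType) (V : lmodType k) b a (x y : V) :
  signb b (a *: x + y) = a *: signb b x + signb b y.
Proof. by case: b => //=; rewrite opprD scalerN. Qed.

Lemma signb_morph (V W : zmodType) (f : {additive V -> W}) b x : f (signb b x) = signb b (f x).
Proof. by case: b => //=; rewrite raddfN. Qed.

Lemma signb_eq0 (V : zmodType) b (x : V) : signb b x = 0 -> x = 0.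
Proof. by case: b => //= /eqP; rewrite oppr_eq0 => /eqP. Qed.

Lemma signE (k : comPzRingType) (V : lmodType k) e (x : V) :
  sign k e *: x = signb (parity e) x.
Proof. by rewrite /sign /parity -signr_odd scaler_sign; case: (odd _). Qed.

Lemma mlin_signb (k : comPzRingType) (X Z : lmodType k) (F : seq X -> Z) u w b x :
  multilinear F -> F (u ++ signb b x :: w) = signb b (F (u ++ x :: w)).
Proof. by case: b => //= h; rewrite mlinN. Qed.

Lemma submod_signb (k : pzRingType) (V : lmodType k) (P : V -> Prop) b x :
  submod P -> P x -> P (signb b x).
Proof. by case: b => //= h px; rewrite -scaleN1r; apply: submodZ. Qed.
End SignAction.

Section GradedSum.
Variables (R : pzRingType) (M V : lmodType R) (I : eqType) (G : grading M I).

Lemma gcompZ i a x : gcomp G i (a *: x) = a *: gcomp G i x.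
Proof.
apply: (@gcomp_unique _ _ _ G (gsupp G x) (fun j => a *: gcomp G j x)).
- exact: gsupp_uniq.
- by move=> j; apply: submodZ; [exact: homog_submod|exact: gcomp_homog].
- by move=> j /gcomp_out ->; rewrite scaler0.
- by rewrite -scaler_sumr -gcomp_sum.
Qed.

Variable Phi : I -> M -> V.
Hypothesis Phi_lin : forall i a x y, Phi i (a *: x + y) = a *: Phi i x + Phi i y.

(** The linear map given by Phi i in degree i. *)
Definition gsum x := \sum_(i <- gsupp G x) Phi i (gcomp G i x).

Let Phi0 i : Phi i 0 = 0.
Proof. by have := Phi_lin i (-1) 0 0; rewrite scaler0 addr0 scaleN1r addNr. Qed.

Lemma gsumW s x : uniq s -> {subset gsupp G x <= s} ->
  gsum x = \sum_(i <- s) Phi i (gcomp G i x).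
Proof.
move=> us hs; rewrite [RHS](bigID (mem (gsupp G x))) /=.
rewrite [X in _ + X]big1 ?addr0 => [|i /gcomp_out ->]; last exact: Phi0.
rewrite -[RHS]big_filter; apply: perm_big; apply: uniq_perm.
- exact: gsupp_uniq.
- exact: filter_uniq.
by move=> i; rewrite mem_filter; case: (boolP (_ \in gsupp G x)) => //= /hs ->.
Qed.

Lemma gsum_linear a x y : gsum (a *: x + y) = a *: gsum x + gsum y.
Proof.
set z := _ + y; pose s := undup (gsupp G x ++ gsupp G y ++ gsupp G z).
have us : uniq s by apply: undup_uniq.
rewrite !(gsumW us); try by move=> i hi; rewrite mem_undup !mem_cat hi ?orbT.
rewrite scaler_sumr -big_split; apply: eq_bigr => i _ /=.
by rewrite gcompD gcompZ Phi_lin.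
Qed.

Lemma gsum_homog i x : G i x -> gsum x = Phi i x.
Proof.
move=> hx; have us : uniq (undup (i :: gsupp G x)) by apply: undup_uniq.
rewrite (gsumW us) => [|j hj]; last by rewrite mem_undup inE hj orbT.
rewrite (bigD1_seq i) ?mem_undup ?inE ?eqxx //= big1 ?addr0 ?gcomp_homogE // => j ji.
by rewrite (gcomp_homog0 hx).
Qed.

End GradedSum.

Section MultilinearInduction.
Variables (k : pzRingType) (X Z : lmodType k).
Implicit Types (F : seq X -> Z) (P : Z -> Prop).

(** A multilinear map is determined by its values on lists of generators; arguments
    may range over different sets of generators Cs. *)
Lemma mlin_ind F P (Cs : seq (X -> Prop)) : multilinear F -> submod P ->
  (forall ys, List.Forall2 (fun C y => C y) Cs ys -> P (F ys)) ->
  forall xs, List.Forall2 (fun C x => exists2 s : seq X, List.Forall C s & x = \sum_(y <- s) y) Cs xs ->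
  P (F xs).
Proof.
move=> Flin Psub h xs hxs.
have F0 u w : F (u ++ 0 :: w) = 0.
  by have := Flin (-1) 0 0 u w; rewrite scaler0 addr0 scaleN1r addNr.
suff gen : forall Cs1 ys1, List.Forall2 (fun C y => C y) Cs1 ys1 ->
    (forall ys, List.Forall2 (fun C y => C y) (Cs1 ++ Cs) ys -> P (F ys)) ->
    P (F (ys1 ++ xs)).
  by apply: (gen [::] [::]) => //; constructor.
elim: hxs {h} => {Cs xs} [|C x Cs xs [s hs ->] _ IH] Cs1 ys1 h1 h.
  by apply: h; apply: List.Forall2_app => //; constructor.
elim: hs => {s x} [|y s Cy _ IHs]; first by rewrite big_nil F0; case: Psub.
rewrite big_cons -[y]scale1r Flin scale1r; apply: submodD => //.
rewrite -cat_rcons; apply: (IH (rcons Cs1 C)).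
  by rewrite -!cats1; apply: List.Forall2_app => //; constructor => //; constructor.
by move=> ys; rewrite cat_rcons; apply: h.
Qed.

Variables (I : eqType) (G : grading X I).

Lemma mlin_homog F P : multilinear F -> submod P -> forall xs,
  (forall ds ys, size ys = size xs -> List.Forall2 G ds ys -> P (F ys)) -> P (F xs).
Proof.
move=> Flin Psub xs h.
apply: (@mlin_ind F P (map (fun _ y => exists d, G d y) xs)) => // [ys hys|].
  have [ds hds] : exists ds, List.Forall2 G ds ys.
    elim: xs ys hys {h} => [|x xs IH] ys H; inversion_clear H.
      by exists [::]; constructor.
    case: H0 => d hd; have [ds hds] := IH _ H1.
    by exists (d :: ds); constructor.
  apply: (h ds) => //; elim: xs ys hys {h ds hds} => [|x xs IH] ys H; inversion_clear H => //=.
  by rewrite IH.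
elim: xs {h} => [|x xs IH]; first by constructor.
constructor => //; exists [seq gcomp G i x | i <- gsupp G x].
  elim: (gsupp G x) => [|i s IHs]; constructor => //.
  by exists i; apply: gcomp_homog.
by rewrite big_map -gcomp_sum.
Qed.

Lemma mlin_eq F F' : multilinear F -> multilinear F' -> forall xs,
  (forall ds ys, size ys = size xs -> List.Forall2 G ds ys -> F ys = F' ys) -> F xs = F' xs.
Proof.
move=> Fl Fl' xs h; apply/eqP; rewrite -subr_eq0; apply/eqP.
apply: (@mlin_homog (fun xs => F xs - F' xs) (fun z => z = 0)) => [a x y u w||ds ys sy hy].
- by rewrite Fl Fl' scalerBr opprD addrACA.
- by split=> // a x y -> ->; rewrite scaler0 addr0.
by rewrite (h ds) ?subrr.
Qed.

End MultilinearInduction.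

Section Parity.
Variables (k : comPzRingType) (M : lmodType k) (G : grading M (int * int)%type).

(** Locked because unification would otherwise unfold the sum and identify it with
    other sums. *)
Definition bpar := locked (gsum G (fun d (x : M) => signb (parity (d.1 + d.2)) x)).

Lemma bpar_linear : linear bpar.
Proof. by rewrite /bpar -lock; apply: gsum_linear => d; apply: signb_lin. Qed.
HB.instance Definition _ := GRing.isLinear.Build k M M *:%R bpar bpar_linear.

Lemma bpar_homog d x : G d x -> bpar x = signb (parity (d.1 + d.2)) x.
Proof. by rewrite /bpar -lock; apply: gsum_homog => ?; apply: signb_lin. Qed.

Lemma bpar_degree d x : G d x -> G d (bpar x).
Proof. by move=> hx; rewrite (bpar_homog hx); apply: submod_signb => //; apply: homog_submod. Qed.

Lemma bparK : involutive bpar.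
Proof.
move=> x; rewrite [x](gcomp_sum G) 2!linear_sum; apply: eq_bigr => d _.
have hx := gcomp_homog G d x.
by rewrite /= (bpar_homog (bpar_degree hx)) (bpar_homog hx) signbK addbb.
Qed.

Lemma bpar_tot n x : tot G n x -> bpar x = signb (parity n) x.
Proof.
move=> [s [c [us hc ->]]]; rewrite linear_sum signb_sum; apply: eq_bigr => p _.
by rewrite /= (bpar_homog (hc p)) /= [p + _]addrC subrK.
Qed.

End Parity.

Section MultilinearParity.
Variables (k : comPzRingType) (X Z : lmodType k).
Variables (G : grading X (int * int)%type) (G' : grading Z (int * int)%type).
Variables (delta : nat -> (int * int)%type) (F : seq X -> Z).
Hypotheses (Flin : multilinear F) (Fdeg : of_degree G G' delta F).

Lemma Forall2_size (S T : Type) (Q : S -> T -> Prop) xs ys :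
  List.Forall2 Q xs ys -> size xs = size ys.
Proof. by elim=> //= x y xs' ys' _ _ ->. Qed.

(** A homogeneous multilinear map multiplies the sign of its arguments by the sign of
    its degree. This replaces all reasoning on degrees in the sign computations. *)
Lemma mlin_bpar xs : xs <> [::] ->
  F (map (bpar G) xs) = signb (parity ((delta (size xs)).1 + (delta (size xs)).2)) (bpar G' (F xs)).
Proof.
move=> xs0.
apply: (@mlin_eq _ _ _ _ G (fun xs => F (map (bpar G) xs)) (fun ys =>
  signb (parity ((delta (size xs)).1 + (delta (size xs)).2)) (bpar G' (F ys)))).
- by move=> a x y u w; rewrite !map_cat /= linearP Flin.
- by move=> a x y u w; rewrite Flin linearP signb_lin.
move=> ds ys sy hys; have ys0 : ys <> [::] by move=> ys0; case: (xs) sy xs0; rewrite ys0.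
rewrite (bpar_homog (Fdeg ys0 hys)) signbK sy.
suff gen u : F (u ++ map (bpar G) ys) = signb (\big[addb/false]_(d <- ds) parity (d.1 + d.2)) (F (u ++ ys)).
  rewrite (gen [::]); congr (signb _ _) => /=.
  have -> : \big[addb/false]_(d <- ds) parity (d.1 + d.2) = parity ((\sum_(d <- ds) d).1 + (\sum_(d <- ds) d).2).
    by elim: (ds) => [|d l IH]; rewrite ?big_nil ?big_cons //= IH -parityD addrACA.
  by rewrite !parityD; do 4 case: (parity _).
elim: hys u {sy ys0} => [|d x ds' ys' hx hys IH] u; first by rewrite big_nil.
rewrite /= (bpar_homog hx) mlin_signb // -cat_rcons IH cat_rcons signbK big_cons.
by rewrite addbC.
Qed.

(** An element of total degree n is a sum of bihomogeneous elements of total degree n,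
    so multilinearity passes from bidegrees to total degrees. *)
Lemma mlin_tot : of_degree (tot G) (tot G') (fun n => (delta n).1 + (delta n).2) F.
Proof.
move=> ds xs xs0 hxs.
apply: (@mlin_ind _ _ _ F _ (map (fun n x => exists2 d, d.1 + d.2 = n & G d x) ds)) => //.
- exact: homog_submod.
- move=> ys hys.
  have [es he hes] : exists2 es, List.Forall2 G es ys & map (fun d => d.1 + d.2) es = ds.
    elim: ds ys hys {xs xs0 hxs} => [|d ds IH] ys H; inversion_clear H.
      by exists [::]; first by constructor.
    case: H0 => e ed he; have [es hes esd] := IH _ H1.
    by exists (e :: es); [constructor|rewrite /= ed esd].
  have sz : size ys = size xs.
    by rewrite -(Forall2_size hxs) -hes size_map (Forall2_size he).
  have ys0 : ys <> [::] by move=> ys0; case: (xs) sz xs0; rewrite ys0.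
  have := Fdeg ys0 he; set D := _ + delta _ => hF.
  have -> : \sum_(d <- ds) d + ((delta (size xs)).1 + (delta (size xs)).2) = D.1 + D.2.
    rewrite /D -hes big_map -sz /= addrACA; congr (_ + _).
    by elim: (es) => [|e l IH]; rewrite ?big_nil ?big_cons //= IH addrACA.
  apply/tot_homogP => e eD; apply: (gcomp_homog0 hF).
  by apply: contraNneq eD => ->.
elim: hxs {xs0} => [|d x ds' xs' hx _ IH]; [exact: List.Forall2_nil|rewrite /=; apply: List.Forall2_cons => //].
case: hx => s [c [us hc ->]]; exists (map c s); last by rewrite big_map.
elim: s {us} => [|p s IHs]; constructor => //.
by exists (p, d - p) => //=; rewrite addrC subrK.
Qed.

End MultilinearParity.

(** * Removing the signs of A-infinity relations *)

Section BarConstruction.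
Variables (k : comPzRingType) (X Z : lmodType k).

Definition susp_sign (t : {linear X -> X}) (x : X) := - t x.
Lemma susp_sign_linear t : linear (susp_sign t).
Proof. by move=> a x y; rewrite /susp_sign linearP opprD scalerN. Qed.
HB.instance Definition _ t := GRing.isLinear.Build k X X *:%R (susp_sign t) (susp_sign_linear t).

Variable t : X -> X.

(** The suspension of a tensor product: moving n symbols s into their places past the
    arguments multiplies by the parity operator t on the i-th argument n - i times. *)
Fixpoint twist (xs : seq X) : seq X :=
  if xs is x :: xs' then iter (size xs') t x :: twist xs' else [::].

(** The bar form of m; the value on the empty list is normalised to 0, so that
    insertions and compositions need not exclude empty parts. *)
Definition bar (m : seq X -> Z) xs := if xs is [::] then 0 else m (twist xs).

Lemma size_twist xs : size (twist xs) = size xs.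
Proof. by elim: xs => //= x xs ->. Qed.

Lemma twistK : involutive t -> involutive twist.
Proof.
move=> tK; elim=> //= x xs IH; rewrite size_twist IH; congr (_ :: _).
by elim: (size xs) => //= n IHn; rewrite -iterSr iterS tK.
Qed.

Lemma bar_nonempty m xs : xs <> [::] -> bar m xs = m (twist xs).
Proof. by case: xs. Qed.

Lemma twist_cons_cat u x w : twist (u ++ x :: w) =
  map (iter (size w).+1 t) (twist u) ++ iter (size w) t x :: twist w.
Proof.
elim: u => //= y u ->; congr (_ :: _).
by rewrite size_cat /= addnC iterD.
Qed.

(** A degree only enters through the eigenvalue of the parity operator. *)
Definition eigen (V : lmodType k) (tV : V -> V) (d : int) (x : V) := tV x = signb (parity d) x.

(** The parity of the Koszul sign of the suspension, on arguments of degrees ds. *)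
Fixpoint eps (ds : seq int) : bool :=
  if ds is d :: ds' then (odd (size ds') && parity d) (+) eps ds' else false.

Definition psum (ds : seq int) := parity (\sum_(d <- ds) d).

Lemma psum_cons d ds : psum (d :: ds) = parity d (+) psum ds.
Proof. by rewrite /psum big_cons parityD. Qed.

Lemma eps_cat a c : eps (a ++ c) = eps a (+) (odd (size c) && psum a) (+) eps c.
Proof.
elim: a => [|d a IH] /=; first by rewrite /psum big_nil andbF.
rewrite IH psum_cons size_cat oddD.
by case: (odd (size a)) (odd (size c)) (parity d) (psum a) (eps a) (eps c) => [] [] [] [] [] [].
Qed.

Lemma mlin_twist (F : seq X -> Z) u ds xs : multilinear F -> linear t ->
  List.Forall2 (eigen t) ds xs -> F (u ++ twist xs) = signb (eps ds) (F (u ++ xs)).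
Proof.
move=> Fl tl h; elim: h u => //= {ds xs} d x ds xs hx h IH u.
have -> : iter (size xs) t x = signb (odd (size xs) && parity d) x.
  elim: (size xs) => //= n ->.
  have tN y : t (- y) = - t y.
    by have := tl (-1) y 0; rewrite !scaleN1r !addr0 => ->; have := tl (-1) 0 0;
      rewrite scaler0 addr0 scaleN1r addNr => ->; rewrite addr0.
  have -> : t (signb (odd n && parity d) x) = signb (odd n && parity d) (t x).
    by case: (_ && _) => //=; rewrite tN.
  by rewrite hx signbK; congr (signb _ _); case: (odd n) (parity d) => [] [].
rewrite mlin_signb // -cat_rcons IH cat_rcons signbK (Forall2_size h).
by [].
Qed.

End BarConstruction.

Lemma Forall2_take (S T : Type) (Q : S -> T -> Prop) n xs ys :
  List.Forall2 Q xs ys -> List.Forall2 Q (take n xs) (take n ys).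
Proof.
move=> h; elim: h n => [|x y xs' ys' hxy _ IH] [|n] /=; by constructor.
Qed.

Lemma Forall2_drop (S T : Type) (Q : S -> T -> Prop) n xs ys :
  List.Forall2 Q xs ys -> List.Forall2 Q (drop n xs) (drop n ys).
Proof.
by move=> h; elim: h n => [|x y xs' ys' hxy h' IH] [|n] //=; constructor.
Qed.

Section BarInsertions.
Variables (k : comPzRingType) (X Z : lmodType k) (t : {linear X -> X}).
Variables (m : seq X -> X) (f : seq X -> Z).
Hypotheses (mlin : multilinear m) (flin : multilinear f).
Hypothesis mt : forall v, v <> [::] -> m (map t v) = signb (odd (size v)) (t (m v)).

Lemma mlin_map_eigen (V : lmodType k) (F : seq X -> V) u ds xs : multilinear F ->
  List.Forall2 (eigen t) ds xs -> F (u ++ map t xs) = signb (psum ds) (F (u ++ xs)).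
Proof.
move=> Fl h; elim: h u => [|d x ds' xs' hx _ IH] u; first by rewrite /psum big_nil.
by rewrite /= hx mlin_signb // -cat_rcons IH cat_rcons signbK psum_cons.
Qed.

Lemma mlin_susp_sign_eigen (F : seq X -> Z) u ds xs w : multilinear F ->
  List.Forall2 (eigen t) ds xs ->
  F (u ++ map (susp_sign t) xs ++ w) = signb (psum ds (+) odd (size ds)) (F (u ++ xs ++ w)).
Proof.
move=> Fl h; elim: h u => [|d x ds' xs' hx _ IH] u; first by rewrite /psum big_nil.
rewrite /= /susp_sign hx -[- _]/(signb true _) signbK mlin_signb // -cat_rcons IH cat_rcons signbK psum_cons.
by congr (signb _ _); case: (parity d) (psum ds') (odd (size ds')) => [] [] [].
Qed.

Lemma eigen_m ds v : v <> [::] -> List.Forall2 (eigen t) ds v ->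
  eigen t (\sum_(d <- ds) d + (size v)%:Z) (m v).
Proof.
move=> v0 h; have := mt v0; rewrite (mlin_map_eigen [::] mlin h) /= => /(congr1 (signb (odd (size v)))).
by rewrite signbK signbK addbb /= /eigen => <-; rewrite parityD addbC.
Qed.

Lemma eigen_signb (V : lmodType k) (tV : {linear V -> V}) d b (x : V) :
  eigen tV d x -> eigen tV d (signb b x).
Proof. by rewrite /eigen => h; rewrite signb_morph /= h !signbK addbC. Qed.

(** The sign (-1)^(r + s t) of the A-infinity relation and the Koszul sign of m_s are
    what remains of the suspension signs of the outer, inner and total arguments. *)
Lemma insertion_term u v w du dv dw : v <> [::] ->
  List.Forall2 (eigen t) du u -> List.Forall2 (eigen t) dv v -> List.Forall2 (eigen t) dw w ->
  signb (eps (du ++ dv ++ dw)) (bar t f (map (susp_sign t) u ++ bar t m v :: w)) =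
  signb (parity ((size u + size v * size w)%N%:Z + deg_op (size v) * \sum_(d <- du) d))
    (f (u ++ m v :: w)).
Proof.
move=> v0 hu hv hw.
have tl : linear t by exact: linearP.
have bv : bar t m v = signb (eps dv) (m v).
  by rewrite bar_nonempty // (mlin_twist [::] mlin tl hv).
have hsu : List.Forall2 (eigen t) du (map (susp_sign t) u).
  elim: hu => [|d x du' u' hx _ IH] /=; constructor => //.
  by rewrite /susp_sign hx -[- _]/(signb true _); do 2 apply: eigen_signb.
have hl : List.Forall2 (eigen t) (du ++ (\sum_(d <- dv) d + (size v)%:Z) :: dw)
    (map (susp_sign t) u ++ bar t m v :: w).
  apply: List.Forall2_app => //; constructor => //.
  by rewrite bv; apply: eigen_signb; apply: eigen_m.
rewrite bar_nonempty; last by case: (u).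
rewrite (mlin_twist [::] flin tl hl) /= (mlin_susp_sign_eigen [::] _ flin hu) /=.
rewrite bv mlin_signb // !signbK; congr (signb _ _).
rewrite !eps_cat /= !size_cat /= parityD parityM /deg_op parityB parityD !parity_nat !oddD oddM.
rewrite (Forall2_size hu) (Forall2_size hv) (Forall2_size hw).
rewrite -!/(psum _).
by case: (odd (size u)) (odd (size v)) (odd (size w)) (psum du) (psum dv)
  (eps du) (eps dv) (eps dw) => [] [] [] [] [] [] [] [].
Qed.

Lemma bar_hmlin (V : lmodType k) (hX : {additive X -> X}) (hV : {additive V -> V}) (g : seq X -> V) :
  (forall x, t (hX x) = hX (t x)) -> hmlin hX hV g -> hmlin hX hV (bar t g).
Proof.
move=> th hg u w; apply: (@eq_hlin _ _ _ _ _ (fun x =>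
  g (map (iter (size w).+1 t) (twist t u) ++ iter (size w) t x :: twist t w))).
  by move=> x; rewrite bar_nonempty ?twist_cons_cat //; case: (u).
have [g1 g2] := hg (map (iter (size w).+1 t) (twist t u)) (twist t w).
have il n a x y : iter n t (a *: x + y) = a *: iter n t x + iter n t y.
  by elim: n => //= n ->; rewrite linearP.
have ih n x : iter n t (hX x) = hX (iter n t x) by elim: n => //= n ->; rewrite th.
by split=> [a x y|x]; rewrite ?il ?ih ?g1 ?g2.
Qed.

Lemma bar_multilinear (V : lmodType k) (g : seq X -> V) :
  multilinear g -> multilinear (bar t g).
Proof.
move=> hg; apply: (@hmlin_multilinear _ _ _ \0 \0).
by apply: bar_hmlin => [x|]; [rewrite /= linear0|exact: multilinear_hmlin].
Qed.

(** The common sign eps ds is the suspension sign of all the arguments. *)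
Lemma insertions_bar ds xs : xs <> [::] -> List.Forall2 (eigen t) ds xs ->
  insertions m f ds xs = signb (eps ds) (bar_insert (susp_sign t) (bar t m) (bar t f) xs).
Proof.
move=> xs0 hxs; rewrite /bar_insert /splits3.
have blin := bar_multilinear flin.
rewrite (big_splits_iota xs (fun a c => \sum_(q <- splits c) bar t f (map (susp_sign t) a ++ bar t m q.1 :: q.2))).
rewrite big_nat_recr //= drop_size big_splits_nil /= mlin0 // addr0.
rewrite /insertions signb_sum; apply: eq_big_nat => r /andP[_ rn].
rewrite (big_splits_iota (drop r xs) (fun a c => bar t f (map (susp_sign t) (take r xs) ++ bar t m a :: c))).
rewrite [in RHS]big_nat_recl // take0 /= mlin0 // add0r size_drop signb_sum.
rewrite big_add1 /=; apply: eq_big_nat => s /andP[_ sn].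
rewrite signE; set v := take s.+1 (drop r xs); set w := drop s.+1 (drop r xs).
have sv : size v = s.+1 by rewrite size_take size_drop; case: ltnP => //; lia.
have sw : size w = (size xs - r - s.+1)%N by rewrite /w !size_drop.
have su : size (take r xs) = r by rewrite size_take rn.
have dE : ds = take r ds ++ take s.+1 (drop r ds) ++ drop s.+1 (drop r ds).
  by rewrite !cat_take_drop.
rewrite {2}dE insertion_term; first last.
- exact/Forall2_drop/Forall2_drop.
- exact/Forall2_take/Forall2_drop.
- exact/Forall2_take.
- by move=> v0; rewrite v0 in sv.
by rewrite sv sw su /w drop_drop [(s.+1 + r)%N]addnC.
Qed.

End BarInsertions.

Section Compositions.

Fixpoint comps_fuel m n : seq (seq nat) :=
  if n == 0%N then [:: [::]] else
  if m is m'.+1 then [seq i :: sh | i <- iota 1 n, sh <- comps_fuel m' (n - i)%N]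
  else [::].

Lemma comps_fuelS m n : comps_fuel m.+1 n.+1 =
  [seq i :: sh | i <- iota 1 n.+1, sh <- comps_fuel m (n.+1 - i)%N].
Proof. by []. Qed.

Lemma mem_comps m n sh : (n <= m)%N ->
  (sh \in comps_fuel m n) = all (leq 1) sh && (sumn sh == n).
Proof.
elim: m n sh => [|m IH] [|n] sh // hn; rewrite ?inE.
- by case: sh => [|[|i] sh] //=; rewrite andbF.
- by case: sh => [|[|i] sh] //=; rewrite andbF.
rewrite comps_fuelS; apply/allpairsPdep/andP => [[i [sh' [hi hsh ->]]]|[]].
  move: hi hsh; rewrite mem_iota => hi; rewrite IH; last by lia.
  by move=> /andP[a /eqP b] /=; rewrite a b; split; lia.
case: sh => [|i sh] // /andP[i0 a] /eqP e; rewrite /= in e; exists i, sh; split => //.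
  by rewrite mem_iota; lia.
have i1 : (0 < i)%N by exact: i0.
have e2 : (n.+1 - i = sumn sh)%N by lia.
by rewrite e2 IH ?eqxx ?andbT //; lia.
Qed.

Lemma uniq_comps m n : (n <= m)%N -> uniq (comps_fuel m n).
Proof.
elim: m n => [|m IH] [|n] // hn; rewrite comps_fuelS.
apply: allpairs_uniq_dep; first exact: iota_uniq.
  by move=> i; rewrite mem_iota => hi; apply: IH; lia.
by move=> [i sh] [j sh'] _ _ [-> ->].
Qed.

Lemma big_segs_comps (T : Type) (Z : zmodType) m (xs : seq T) (K : seq (seq T) -> Z) :
  (size xs <= m)%N ->
  \sum_(bs <- segs xs) K bs = \sum_(sh <- comps_fuel m (size xs)) K (reshape sh xs).
Proof.
elim: m xs K => [|m IH] [|x xs] K // hn; rewrite ?segs_nil ?big_seq1 //.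
rewrite segs_first /splits1 big_map comps_fuelS [RHS]big_allpairs_dep /=.
rewrite (big_splits_iota xs (fun a c => \sum_(bs <- segs c) K ((x :: a) :: bs))).
rewrite -[1%N :: _]/(iota 1 (size xs).+1).
have -> : iota 1 (size xs).+1 = [seq i.+1 | i <- iota 0 (size xs).+1] by rewrite -(iotaDl 1).
rewrite big_map /index_iota subn0 big_seq [RHS]big_seq; apply: eq_bigr => i.
rewrite mem_iota => hi; rewrite IH ?size_drop ?subSS //.
have hm : (size xs <= m)%N by exact: hn.
by apply: leq_trans (leq_subr _ _) hm.
Qed.

(** Both sums range over the compositions of n, on the left by number of parts. *)
Lemma compositions_reindex (Z : zmodType) n (Phi : seq nat -> Z) : (0 < n)%N ->
  \sum_(1 <= q < n.+1) \sum_(i : q.-tuple 'I_n.+1 | all (leq 1) (map val i)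
       && (sumn (map val i) == n)) Phi (map val i) =
  \sum_(sh <- comps_fuel n n) Phi sh.
Proof.
move=> n0.
transitivity (\sum_(1 <= q < n.+1) \sum_(sh <- comps_fuel n n | size sh == q) Phi sh).
  apply: eq_bigr => q _.
  rewrite -big_filter -[RHS]big_filter.
  rewrite -(big_map (fun i : q.-tuple 'I_n.+1 => map val i) xpredT Phi).
  apply: perm_big; apply: uniq_perm.
  - rewrite map_inj_uniq; first by apply: filter_uniq; apply: index_enum_uniq.
    by move=> i j /(inj_map val_inj) /val_inj.
  - by apply: filter_uniq; apply: uniq_comps.
  move=> sh; rewrite mem_filter mem_comps //; apply/mapP/andP.
    move=> [i]; rewrite mem_filter => /andP[h _] ->; split => //.
    by rewrite size_map size_tuple.
  move=> [/eqP sq h]; have [a /eqP b] := andP h.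
  have sb i : i \in sh -> (i <= n)%N.
    rewrite -b; elim: (sh) => //= j l IH; rewrite inE => /orP[/eqP ->|/IH]; lia.
  pose l := [seq (inord i : 'I_n.+1) | i <- sh].
  have ls : size l == q by rewrite size_map sq.
  have lE : map val l = sh.
    by rewrite -map_comp map_id_in // => i /sb hi /=; rewrite inordK.
  by exists (Tuple ls); rewrite ?mem_filter /= lE // h mem_index_enum.
rewrite (exchange_big_dep xpredT) //= big_seq [RHS]big_seq; apply: eq_bigr => sh.
rewrite mem_comps // => /andP[a /eqP b].
rewrite (eq_bigl (pred1 (size sh))); last by move=> q /=; rewrite eq_sym.
have sz : (size sh <= n)%N.
  rewrite -b; elim: (sh) a => //= j l IH /andP[j0 /IH]; lia.
have s0 : (0 < size sh)%N by case: (sh) b n0 => [<-|].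
rewrite -big_filter filter_pred1_uniq ?iota_uniq ?big_seq1 //.
by rewrite mem_index_iota; lia.
Qed.

Lemma shape_sign_cons i sh :
  shape_sign (i :: sh) = (size sh * (i - 1) + shape_sign sh)%N.
Proof. by rewrite /shape_sign big_ord_recl /= subSS subn0. Qed.

Lemma shape_koszul_cons i sh d1 d2 : size d1 = i ->
  shape_koszul (i :: sh) (d1 ++ d2) =
  (\sum_(d <- d1) d) * (\sum_(j < size sh) deg_mor (nth 0%N sh j)) + shape_koszul sh d2.
Proof.
move=> si; rewrite /shape_koszul big_ord_recl /= take0 big_nil mulr0 add0r.
rewrite mulr_sumr -big_split; apply: eq_bigr => j _ /=.
rewrite take_cat si ltnNge leq_addr /= addKn big_cat /= mulrDr.
by congr (_ + _); rewrite mulrC.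
Qed.

Lemma parity_sum_deg_mor sh :
  parity (\sum_(j < size sh) deg_mor (nth 0%N sh j)) = odd (size sh) (+) odd (sumn sh).
Proof.
elim: sh => [|i sh IH]; first by rewrite big_ord0.
rewrite big_ord_recl /= parityD IH parityB !parity_nat oddD.
by case: (odd i) (odd (size sh)) (odd (sumn sh)) => [] [] [].
Qed.

Section BarCompositions.
Variables (k : comPzRingType) (X Y : lmodType k).
Variables (tX : {linear X -> X}) (tY : {linear Y -> Y}).
Variables (f : seq X -> Y) (m : seq Y -> Y).
Hypotheses (flin : multilinear f) (mlin : multilinear m).
Hypothesis ft : forall v, v <> [::] -> f (map tX v) = signb (~~ odd (size v)) (tY (f v)).

Lemma eigen_f ds v : v <> [::] -> List.Forall2 (eigen tX) ds v ->
  eigen tY (\sum_(d <- ds) d + deg_mor (size v)) (f v).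
Proof.
move=> v0 h; have := ft v0; rewrite (mlin_map_eigen [::] flin h) /=.
move=> /(congr1 (signb (~~ odd (size v)))); rewrite !signbK addbb /= /eigen => <-.
by rewrite parityD /deg_mor parityB !parity_nat addbC.
Qed.

(** By induction on the blocks: the suspension signs of the blocks and of the list of
    their values differ from that of all the arguments by the sign of the relation. *)
Lemma composition_term bs ds : all (fun b => 0 < size b)%N bs ->
  List.Forall2 (eigen tX) ds (flatten bs) ->
  exists (es : seq int) (c : bool), [/\ List.Forall2 (eigen tY) es (map (bar tX f) bs),
    forall u, m (u ++ map (bar tX f) bs) = signb c (m (u ++ map f bs)) &
    eps ds = eps es (+) c (+)
      parity ((shape_sign (map size bs))%:Z + shape_koszul (map size bs) ds)].
Proof.
elim: bs ds => [|b bs IH] ds /= => [_ h|/andP[b0 hbs] h].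
  inversion h; exists [::], false; split=> //=.
  by rewrite /shape_sign /shape_koszul !big_ord0.
have [d1 [d2 [h1 [h2 ->]]]] := List.Forall2_app_inv_r _ _ h.
have [es [c [hes hm hE]]] := IH _ hbs h2.
have {}b0 : b <> [::] by move=> b0'; rewrite b0' in b0.
have bf : bar tX f b = signb (eps d1) (f b).
  by rewrite bar_nonempty // (mlin_twist [::] flin _ h1) //; exact: linearP.
have s1 := Forall2_size h1; have s2 := Forall2_size h2.
exists (\sum_(d <- d1) d + deg_mor (size b) :: es), (eps d1 (+) c); split.
- by constructor => //; rewrite bf; apply: eigen_signb; apply: eigen_f.
- by move=> u; rewrite bf mlin_signb // -cat_rcons hm cat_rcons signbK.
rewrite eps_cat hE /= shape_sign_cons shape_koszul_cons // !parityD parityM parity_sum_deg_mor.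
rewrite PoszD PoszM !parityD parityM parity_nat -/(psum d1) size_map.
have -> : size es = size bs by rewrite (Forall2_size hes) size_map.
have -> : sumn (map size bs) = size d2 by rewrite s2 size_flatten.
have -> : parity (size b - 1)%N = ~~ odd (size b).
  by rewrite parity_nat; case: (b) b0 => //= x l _; rewrite subn1 negbK.
rewrite parityN !parity_nat; move: c {hm hE}.
by case: (odd (size b)) (odd (size bs)) (odd (size d2)) (psum d1) (eps d1) (eps es)
  (odd (shape_sign _)) (parity (shape_koszul _ _)) => [] [] [] [] [] [] [] [] [].
Qed.

Lemma compositions_bar ds xs : xs <> [::] -> List.Forall2 (eigen tX) ds xs ->
  compositions m f ds xs = signb (eps ds) (bar_compose (bar tX f) (bar tY m) xs).
Proof.
move=> xs0 hxs; rewrite /compositions /bar_compose signb_sum.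
have n0 : (0 < size xs)%N by case: (xs) xs0.
rewrite (compositions_reindex (fun sh => sign k ((shape_sign sh)%:Z + shape_koszul sh ds) *:
   m (map f (reshape sh xs)))) //.
rewrite (big_segs_comps _ (leqnn _)) big_seq [RHS]big_seq; apply: eq_bigr => sh.
rewrite mem_comps // => /andP[a /eqP b].
have rK : map size (reshape sh xs) = sh by apply: reshapeKl; rewrite b.
have fl : flatten (reshape sh xs) = xs by apply: reshapeKr; rewrite b.
have al : all (fun b => 0 < size b)%N (reshape sh xs).
  by move: a; rewrite -{1}rK all_map.
have [|es [c [hes hm ->]]] := composition_term (ds := ds) al; first by rewrite fl.
rewrite signE rK bar_nonempty; last by case: (reshape sh xs) fl n0 => // <-.
rewrite (mlin_twist [::] mlin _ hes) ?(hm [::]) /= ?signbK; last exact: linearP.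
congr (signb _ _).
by move: c {hm}; case: (eps es) (parity _) => [] [] [].
Qed.

End BarCompositions.
End Compositions.

(** * Power series in h *)

Section SeriesTheory.
Variables (k : comPzRingType) (V : lmodType k) (G : grading V (int * int)%type).
Implicit Types (x y z : series G).

Lemma series_ext x y : (forall r, x r = y r) -> x = y.
Proof. by move=> h; apply: val_inj; apply/funext. Qed.

Lemma coefN x r : (- x) r = - x r.
Proof. by []. Qed.

Lemma coefB x y r : (x - y) r = x r - y r.
Proof. by []. Qed.

Lemma coef_signb b x r : (signb b x) r = signb b (x r).
Proof. by case: b. Qed.

(** Constant power series; locked so that simplification keeps it folded. *)
Definition cst (v : V) : series G := locked (trunc_lift G (trunc_const 0 v)).

Lemma cst_coef v r : cst v r = if r == 0%N then v else 0.
Proof. by rewrite /cst -lock /=; case: r => [|r]; [rewrite insubT /= ffunE|rewrite insubF]. Qed.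

Lemma trunc_lift_const N v : trunc_lift G (trunc_const N v) = cst v.
Proof.
apply: series_ext => r; rewrite cst_coef /=.
by case: insubP => [i _ <-|]; [rewrite ffunE|case: r].
Qed.

Lemma cst_linear : linear cst.
Proof.
move=> a x y; apply: series_ext => -[|r]; rewrite coefD coefZ !cst_coef //=.
by rewrite scaler0 addr0.
Qed.
HB.instance Definition _ := GRing.isLinear.Build k V (series G) *:%R cst cst_linear.

Lemma cst_homog d v : G d v -> series_homog d (cst v).
Proof.
move=> hv r; rewrite cst_coef; case: eqP => [->|_].
  by rewrite addr0 subr0 -surjective_pairing.
by case: (homog_submod G (d.1 + r%:Z, d.2 - r%:Z)).
Qed.

Lemma hmul_linear : linear (@hmul k V G).
Proof.
by move=> a x y; apply: series_ext => -[|r]; rewrite coefD coefZ //= scaler0 addr0.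
Qed.
HB.instance Definition _ := GRing.isLinear.Build k (series G) (series G) *:%R (@hmul k V G) hmul_linear.

Lemma hmul_inj : injective (@hmul k V G).
Proof. by move=> x y xy; apply: series_ext => r; have := congr1 (fun z : series G => z r.+1) xy. Qed.

Lemma hmul_homog d x : series_homog d x -> series_homog (d.1 - 1, d.2 + 1) (hmul x).
Proof.
move=> hx [|r]; first by case: (homog_submod G (d.1 - 1 + 0, d.2 + 1 - 0)).
have := hx r; rewrite /= -addn1 PoszD; congr (G (_, _) _); lia.
Qed.

Lemma iter_hmul_homog n d x : series_homog d x ->
  series_homog (d.1 - n%:Z, d.2 + n%:Z) (iter n (@hmul k V G) x).
Proof.
elim: n => [|n IH] hx; first by rewrite subr0 addr0 -surjective_pairing.
have := hmul_homog (IH hx); congr (series_homog (_, _) _) => /=; lia.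
Qed.

Lemma iter_hmul_coef n x i : (iter n (@hmul k V G) x) (n + i)%N = x i.
Proof. by elim: n. Qed.

Lemma iter_hmulD n x y :
  iter n (@hmul k V G) (x + y) = iter n (@hmul k V G) x + iter n (@hmul k V G) y.
Proof. by elim: n => //= n ->; rewrite linearD. Qed.

Lemma iter_hmul_inj n : injective (iter n (@hmul k V G)).
Proof. by elim: n => //= n IH x y /hmul_inj /IH. Qed.

Lemma bpar_coef x r : bpar (series_grading G) x r = bpar G (x r).
Proof.
rewrite {1 2}[x](gcomp_sum (series_grading G)) linear_sum !coef_sum linear_sum.
apply: eq_bigr => d _ /=; have hx := gcomp_homog (series_grading G) d x.
rewrite (bpar_homog hx) coef_signb (bpar_homog (hx r)) /=.
by congr (signb (parity _) _); lia.
Qed.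

Lemma bpar_hmul x : bpar (series_grading G) (hmul x) = hmul (bpar (series_grading G) x).
Proof. by apply: series_ext => -[|r]; rewrite bpar_coef /= ?linear0 ?bpar_coef. Qed.

(** Divisibility by h^R. *)
Definition hord R x := forall i, (i < R)%N -> x i = 0.

Lemma hordD R x y : hord R x -> hord R y -> hord R (x + y).
Proof. by move=> hx hy i hi; rewrite coefD hx ?hy ?addr0. Qed.

Lemma hordN R x : hord R x -> hord R (- x).
Proof. by move=> hx i hi; rewrite coefN hx ?oppr0. Qed.

Lemma hord_iter R x : hord R x -> exists z, x = iter R (@hmul k V G) z.
Proof. exact: iter_hmul_surj. Qed.

Lemma iter_hord R z : hord R (iter R (@hmul k V G) z).
Proof. by move=> i; apply: coef_iter_hmul. Qed.

Lemma hord_le R R' x : (R <= R')%N -> hord R' x -> hord R x.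
Proof. by move=> h hx i hi; apply: hx; apply: leq_trans h. Qed.

Lemma hord_all x : (forall R, hord R x) -> x = 0.
Proof. by move=> h; apply: series_ext => r; apply: (h r.+1). Qed.

Lemma trunc_eq0 N x : trunc N x = 0 <-> hord N.+1 x.
Proof.
split=> [h i hi|h].
  have := congr1 (fun v : truncated N V => v (Ordinal hi)) h.
  by rewrite !ffunE.
by apply/ffunP=> i; rewrite !ffunE h.
Qed.

Lemma truncD N x y : trunc N (x + y) = trunc N x + trunc N y.
Proof. by apply/ffunP=> i; rewrite !ffunE. Qed.

Lemma truncN N x : trunc N (- x) = - trunc N x.
Proof. by apply/ffunP=> i; rewrite !ffunE. Qed.

Lemma trunc_signb N b x : trunc N (signb b x) = signb b (trunc N x).
Proof. by case: b => //=; rewrite truncN. Qed.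

Lemma trunc_sum N (J : Type) (r : seq J) (Q : pred J) (F : J -> series G) :
  trunc N (\sum_(j <- r | Q j) F j) = \sum_(j <- r | Q j) trunc N (F j).
Proof.
elim/big_rec2: _ => [|j y z _ <-]; last by rewrite truncD.
by apply/ffunP=> i; rewrite !ffunE.
Qed.

Lemma cst_split x : exists z, x = cst (x 0%N) + hmul z.
Proof.
have [|z zE] := @hmul_surj _ _ _ (x - cst (x 0%N)).
  by rewrite coefB cst_coef subrr.
by exists z; rewrite -zE addrC subrK.
Qed.

Lemma tot_series n x : (forall r, tot G n (x r)) -> tot (series_grading G) n x.
Proof.
move=> h; apply/tot_homogP => d dn; apply: series_ext => r.
have := (tot_homogP G n (x r)).1 (h r) (d.1 + r%:Z, d.2 - r%:Z).
rewrite {1}[x](gcomp_sumW (s := undup (d :: gsupp (series_grading G) x)) (G := series_grading G));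
  [|exact: undup_uniq|by move=> e he; rewrite mem_undup inE he orbT].
rewrite coef_sum gcomp_big (bigD1_seq d) ?undup_uniq ?mem_undup ?inE ?eqxx //= big1 ?addr0.
  rewrite gcomp_homogE; last exact: (gcomp_homog (series_grading G) d x r).
  by apply; rewrite addrACA addrN addr0.
move=> e ed; apply: (gcomp_homog0 (gcomp_homog (series_grading G) e x r)).
apply: contraNneq ed => -[h1 h2].
by case: d e {dn} h1 h2 => [d1 d2] [e1 e2] /= /addIr -> /addIr ->.
Qed.

End SeriesTheory.
Arguments hord {k V G} R x.
Arguments cst {k V} G v.

Section SeriesMaps.
Variables (k : comPzRingType) (V W : lmodType k).
Variables (G : grading V (int * int)%type) (G' : grading W (int * int)%type).
Implicit Types F : seq (series G) -> series G'.
Local Notation hm F := (hmlin (@hmul k V G) (@hmul k W G') F).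

Lemma hmultilinear_hmlin F : hmultilinear F <-> hm F.
Proof.
split=> [[Fl Fh] u w|h]; first by split=> [a x y|x].
by split=> [|x u w]; [exact: hmlin_multilinear h|case: (h u w) => _ ->].
Qed.

Lemma hmlin_iter F n u z w : hm F ->
  F (u ++ iter n (@hmul _ _ _) z :: w) = iter n (@hmul _ _ _) (F (u ++ z :: w)).
Proof. by move=> h; elim: n => //= n <-; case: (h u w) => _ ->. Qed.

Lemma hmlin_hord F R u x w : hm F -> hord R x -> hord R (F (u ++ x :: w)).
Proof. by move=> h /hord_iter [z ->]; rewrite hmlin_iter //; apply: iter_hord. Qed.

(** A factor h in one argument raises the order of the value by one. *)
Lemma hmlin_hord2 F R u x w : hm F -> hord 1 x ->
  (forall z, hord R (F (u ++ z :: w))) -> hord R.+1 (F (u ++ x :: w)).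
Proof.
move=> h /hord_iter [z ->] hz; rewrite (hmlin_iter 1) //= => -[|i] // hi.
exact: hz.
Qed.

(** Since x = x_0 + h z, an h-multilinear map is determined modulo h^R by its values on
    constant series. *)
Lemma hmlin_cst F R n : hm F ->
  (forall vs : seq V, size vs = n -> hord R (F (map (cst G) vs))) ->
  forall xs, size xs = n -> hord R (F xs).
Proof.
move=> hF h xs; have Fl := hmlin_multilinear hF.
suff gen (us : seq V) : (size us + size xs)%N = n -> hord R (F (map (cst G) us ++ xs)).
  exact: (gen [::]).
elim: xs us => [|x xs IH] us sz.
  by rewrite cats0; apply: h; rewrite addn0 in sz.
suff gen j z i : (i < j)%N -> (i < R)%N -> F (map (cst G) us ++ z :: xs) i = 0.
  by move=> i hi; apply: (gen i.+1).
elim: j z i => // j IHj z i ij iR.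
have [z' ->] := cst_split z.
rewrite mlinD // coefD.
rewrite -cat_rcons -map_rcons IH //; last by rewrite size_rcons -sz /= addnS.
rewrite add0r; have [_ ->] := hF (map (cst G) us) xs.
by case: i ij iR => //= i ij iR; apply: IHj => //; apply: ltnW.
Qed.

Lemma coef_multilinear F r : multilinear F -> multilinear (fun vs => F (map (cst G) vs) r).
Proof.
by move=> Fl a x y u w; rewrite !map_cat !map_cons cst_linear Fl coefD coefZ.
Qed.

Lemma hmlin_hord_eq F R us bs cs : hm F ->
  (forall i, hord R (nth 0 bs i - nth 0 cs i)) -> size bs = size cs ->
  hord R (F (us ++ bs) - F (us ++ cs)).
Proof.
move=> hF; have Fl := hmlin_multilinear hF.
elim: bs cs us => [|b bs IH] [|c cs] us //= h sz; first by rewrite subrr.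
have -> : F (us ++ b :: bs) - F (us ++ c :: cs) =
   F (us ++ (b - c) :: bs) + (F (rcons us c ++ bs) - F (rcons us c ++ cs)).
  by rewrite mlinB // !cat_rcons addrA subrK.
apply: hordD; first by apply: hmlin_hord => //; exact: (h 0%N).
by apply: IH => [i|]; [exact: (h i.+1)|case: sz].
Qed.

Lemma map_trunc_lift N (xs : seq (truncated N V)) :
  map (trunc N) (map (@trunc_lift k V G N) xs) = xs.
Proof. by rewrite -map_comp map_id_in // => x _; apply: trunc_liftK. Qed.

End SeriesMaps.

(** * A-infinity relations modulo powers of h *)

Section Truncation.
Variables (k : comPzRingType) (V W : lmodType k).
Variables (G : grading V (int * int)%type) (G' : grading W (int * int)%type).

Lemma trunc_insertions N (m : seq (series G) -> series G) (f : seq (series G) -> series G') ds xs :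
  hmultilinear m -> hmultilinear f ->
  insertions (reduction (N := N) m) (reduction (N := N) f) ds (map (trunc N) xs) =
  trunc N (insertions m f ds xs).
Proof.
move=> hm hf; rewrite /insertions size_map trunc_sum; apply: eq_bigr => r _.
rewrite trunc_sum; apply: eq_bigr => q _.
rewrite !signE trunc_signb (reductionE _ _ hf) map_cat /= (reductionE _ _ hm).
by rewrite !map_take !map_drop.
Qed.

Lemma trunc_compositions N (m : seq (series G') -> series G') (f : seq (series G) -> series G') ds xs :
  hmultilinear m -> hmultilinear f ->
  compositions (reduction (N := N) m) (reduction (N := N) f) ds (map (trunc N) xs) =
  trunc N (compositions m f ds xs).
Proof.
move=> hm hf; rewrite /compositions size_map trunc_sum; apply: eq_bigr => q _.
rewrite trunc_sum; apply: eq_bigr => i _ /=.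
rewrite !signE trunc_signb (reductionE _ _ hm) -map_comp -map_reshape -map_comp.
by congr (signb _ (reduction _ _)); apply: eq_map => v /=; rewrite (reductionE _ _ hf).
Qed.

Section TruncatedScalars.
Variable N : nat.

(** The action of k[h]/(h^(N+1)) lifted to power series; it is an action modulo
    h^(N+1) only. *)
Definition tact (U : lmodType k) (H : grading U (int * int)%type) (a : truncated N k) (x : series H) :=
  \sum_(j < N.+1) a j *: iter j (@hmul _ _ _) x.

Lemma trunc_tact U H a (x : @series k U H) : trunc N (tact a x) = a *: trunc N x.
Proof.
apply/ffunP => i; rewrite !ffunE coef_sum; apply: eq_bigr => j _.
rewrite coefZ; have [ji|ij] := leqP j i.
  have lt : (i - j < N.+1)%N by rewrite (leq_ltn_trans (leq_subr _ _)).
  rewrite (big_pred1 (Ordinal lt)) ?ffunE /=.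
    by rewrite -{1}(subnKC ji) iter_hmul_coef.
  move=> l /=; apply/eqP/eqP => [e|->]; last by rewrite /= subnKC.
  by apply: val_inj; rewrite /= -e addKn.
rewrite coef_iter_hmul // scaler0 big_pred0 // => l.
by apply/eqP => e; move: ij; rewrite -e ltnNge leq_addr.
Qed.

Lemma tact_hmlin (F : seq (series G) -> series G') u w a x : hmultilinear F ->
  F (u ++ tact a x :: w) = tact a (F (u ++ x :: w)).
Proof.
move=> hF; have [Fl _] := hF; rewrite /tact mlin_sum //; apply: eq_bigr => j _.
by rewrite mlinZ // hmlin_iter //; apply/hmultilinear_hmlin.
Qed.

Lemma reduction_multilinear (F : seq (series G) -> series G') :
  hmultilinear F -> multilinear (reduction (N := N) F).
Proof.
move=> hF a x y xs ys; rewrite /reduction !map_cat /=.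
set u := map _ xs; set w := map _ ys.
rewrite (@trunc_slot _ _ _ _ _ N F u _ (tact a (trunc_lift G x) + trunc_lift G y)) //; last first.
  by rewrite truncD trunc_tact !trunc_liftK.
by rewrite mlinD ?tact_hmlin ?truncD ?trunc_tact //; case: hF.
Qed.

End TruncatedScalars.

End Truncation.

Lemma Forall2_map2 (S S' T T' : Type) (P : S -> T -> Prop) (Q : S' -> T' -> Prop) f g xs ys :
  (forall x y, P x y -> Q (f x) (g y)) -> List.Forall2 P xs ys ->
  List.Forall2 Q (map f xs) (map g ys).
Proof. by move=> h; elim=> /=; constructor; auto. Qed.

Section SeriesDegree.
Variables (k : comPzRingType) (V : lmodType k) (G : grading V (int * int)%type).

Lemma trunc_homog_lift N n (x : truncated N V) : trunc_grading (tot G) N n x ->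
  tot (series_grading G) n (trunc_lift G x).
Proof.
move=> hx; apply: tot_series => r /=; case: insubP => [i _ _|_]; first exact: hx.
by case: (homog_submod (tot G) n).
Qed.

Lemma homog_tot (U : lmodType k) (H : grading U (int * int)%type) d x :
  H d x -> tot H (d.1 + d.2) x.
Proof.
move=> hx; apply/tot_homogP => e ed; apply: (gcomp_homog0 hx).
by apply: contraNneq ed => ->.
Qed.

Lemma homog_coef d (x : series G) r : series_homog d x -> tot G (d.1 + d.2) (x r).
Proof.
move=> /(_ r) /homog_tot; rewrite /=; congr (tot_homog _ _ _); lia.
Qed.

Lemma tot_coef n (x : series G) r : tot (series_grading G) n x -> tot G n (x r).
Proof.
move=> [l [c [us hc ->]]]; rewrite coef_sum; apply: submod_sum; first exact: homog_submod.
move=> p _; have := homog_coef r (hc p); congr (tot_homog _ _ _); rewrite /=; lia.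
Qed.

Definition spar (U : lmodType k) (H : grading U (int * int)%type) : {linear series H -> series H} :=
  bpar (series_grading H).

Lemma sparK (U : lmodType k) (H : grading U (int * int)%type) : involutive (spar H).
Proof. exact: bparK. Qed.

Lemma eigen_spar (U : lmodType k) (H : grading U (int * int)%type) n x :
  tot (series_grading H) n x -> eigen (spar H) n x.
Proof. exact: bpar_tot. Qed.

Lemma eigen_homog ds (xs : seq (series G)) : List.Forall2 (series_grading G) ds xs ->
  List.Forall2 (eigen (spar G)) (map (fun d => d.1 + d.2) ds) xs.
Proof.
move=> h; rewrite -[xs]map_id; apply: Forall2_map2 h => d x h.
by apply: eigen_spar; apply: homog_tot.
Qed.

Lemma eigen_lift N ds (xs : seq (truncated N V)) :
  List.Forall2 (trunc_grading (tot G) N) ds xs ->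
  List.Forall2 (eigen (spar G)) ds (map (@trunc_lift k V G N) xs).
Proof.
move=> h; rewrite -[ds]map_id; apply: Forall2_map2 h => d x h.
by apply: eigen_spar; apply: trunc_homog_lift.
Qed.

Lemma trunc_homogs N ds (xs : seq (series G)) : List.Forall2 (series_grading G) ds xs ->
  List.Forall2 (trunc_grading (tot G) N) (map (fun d => d.1 + d.2) ds) (map (trunc N) xs).
Proof.
apply: Forall2_map2 => d x h i; rewrite ffunE; exact: homog_coef.
Qed.

End SeriesDegree.

Section ReductionDegree.
Variables (k : comPzRingType) (V W : lmodType k).
Variables (G : grading V (int * int)%type) (G' : grading W (int * int)%type).

Lemma reduction_degree N delta (F : seq (series G) -> series G') : multilinear F ->
  of_degree (series_grading G) (series_grading G') delta F ->
  of_degree (trunc_grading (tot G) N) (trunc_grading (tot G') N)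
    (fun n => (delta n).1 + (delta n).2) (reduction F).
Proof.
move=> Fl Fd ds xs xs0 hxs i; rewrite ffunE; apply: tot_coef.
have := mlin_tot Fl Fd (ds := ds) (xs := map (@trunc_lift k V G N) xs).
rewrite size_map; apply; first by case: (xs) xs0.
by rewrite -[ds]map_id; apply: Forall2_map2 hxs => d x; apply: trunc_homog_lift.
Qed.

End ReductionDegree.

Section Relations.
Variables (k : comPzRingType) (s : nat).

Lemma parity_bideg_op n : parity ((bideg_op s n).1 + (bideg_op s n).2) = odd n.
Proof.
rewrite /bideg_op /= -mulrDr addrCA subrr addr0 mulr1 parityB.
by rewrite (_ : parity 2 = false).
Qed.

Lemma parity_bideg_mor n : parity ((bideg_mor s n).1 + (bideg_mor s n).2) = ~~ odd n.
Proof.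
rewrite /bideg_mor /= -mulrDr addrCA subrr addr0 mulr1 parityB.
by rewrite (_ : parity 1 = true).
Qed.

Lemma tot_bideg_op n : (bideg_op s n).1 + (bideg_op s n).2 = deg_op n.
Proof. by rewrite /bideg_op /= -mulrDr addrCA subrr addr0 mulr1. Qed.

Lemma tot_bideg_mor n : (bideg_mor s n).1 + (bideg_mor s n).2 = deg_mor n.
Proof. by rewrite /bideg_mor /= -mulrDr addrCA subrr addr0 mulr1. Qed.

Section Op.
Variables (V : lmodType k) (G : grading V (int * int)%type).
Variable m : seq (series G) -> series G.
Hypothesis mh : hmultilinear m.
Hypothesis md : of_degree (series_grading G) (series_grading G) (bideg_op s) m.

Lemma op_spar v : v <> [::] -> m (map (spar G) v) = signb (odd (size v)) (spar G (m v)).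
Proof.
by move=> v0; rewrite /spar (mlin_bpar (mh.1) md v0) parity_bideg_op.
Qed.

End Op.

Lemma mlin_susp_sign (X Y : lmodType k) (t : {linear X -> X}) (g : seq X -> Y) v : multilinear g ->
  g (map (susp_sign t) v) = signb (odd (size v)) (g (map t v)).
Proof.
move=> gl; suff gen u : g (u ++ map (susp_sign t) v) = signb (odd (size v)) (g (u ++ map t v)).
  exact: (gen [::]).
elim: v u => //= x v IH u.
by rewrite {1}/susp_sign -[- _]/(signb true _) mlin_signb // -cat_rcons IH cat_rcons signbK.
Qed.

Section Sgm.
Variables (X Y : lmodType k) (t : {linear X -> X}) (t' : {linear Y -> Y}).

End Sgm.

Section SeriesRelations.
Variables (V W : lmodType k) (G : grading V (int * int)%type) (G' : grading W (int * int)%type).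
Variables (m : seq (series G) -> series G) (m' : seq (series G') -> series G').
Variable f : seq (series G) -> series G'.
Hypotheses (mh : hmultilinear m) (mh' : hmultilinear m') (fh : hmultilinear f).
Hypothesis md : of_degree (series_grading G) (series_grading G) (bideg_op s) m.
Hypothesis md' : of_degree (series_grading G') (series_grading G') (bideg_op s) m'.
Hypothesis fd : of_degree (series_grading G) (series_grading G') (bideg_mor s) f.

Lemma mor_spar v : v <> [::] -> f (map (spar G) v) = signb (~~ odd (size v)) (spar G' (f v)).
Proof.
by move=> v0; rewrite /spar (mlin_bpar (fh.1) fd v0) parity_bideg_mor.
Qed.

Lemma spar_hmul (U : lmodType k) (H : grading U (int * int)%type) (x : series H) :
  spar H (hmul x) = hmul (spar H x).
Proof. exact: bpar_hmul. Qed.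

(** The parity operator commutes with h because h has total degree 0. *)
Lemma bar_series_hmlin (U : lmodType k) (H : grading U (int * int)%type) (g : seq (series G) -> series H) :
  hmultilinear g -> hmlin (@hmul _ _ G) (@hmul _ _ H) (bar (spar G) g).
Proof.
move=> /hmultilinear_hmlin hg.
by apply: (bar_hmlin (hX := @hmul _ _ G) (hV := @hmul _ _ H)) => // x; apply: spar_hmul.
Qed.

(** A power series vanishes as soon as its reductions modulo all powers of h do. *)
Lemma Ainf_ins_bar : (forall N, Ainf (trunc_grading (tot G) N) (reduction (N := N) m)) ->
  forall xs, bar_insert (susp_sign (spar G)) (bar (spar G) m) (bar (spar G) m) xs = 0.
Proof.
move=> hm xs; have bh := bar_series_hmlin mh; have bl := hmlin_multilinear bh.
apply: (@mlin_homog _ _ _ _ (series_grading G) _ (fun z => z = 0)).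
- apply: (@hmlin_multilinear _ _ _ (@hmul _ _ G) (@hmul _ _ G)).
  apply: (hmlin_bar_insert (hX := @hmul _ _ G) (hZ := @hmul _ _ G)) => // x.
  by rewrite /= /susp_sign spar_hmul linearN.
- by split=> // a x y -> ->; rewrite scaler0 addr0.
move=> ds [|y ys] _ h; first by rewrite /bar_insert /splits3 !big_splits_nil; exact: (mlin0 bl [::] [::]).
have y0 : y :: ys <> [::] by [].
apply: (@signb_eq0 _ (eps [seq d.1 + d.2 | d <- ds])).
rewrite -(insertions_bar mh.1 mh.1 (op_spar mh md) y0 (eigen_homog h)).
apply: hord_all => R; apply: (@hord_le _ _ _ _ R.+1) => //.
apply/trunc_eq0; rewrite -trunc_insertions //.
by apply: (Ainf_relation (hm R)) => //; apply: trunc_homogs.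
Qed.

Lemma ins_bar_Ainf :
  (forall xs, bar_insert (susp_sign (spar G)) (bar (spar G) m) (bar (spar G) m) xs = 0) ->
  forall N, Ainf (trunc_grading (tot G) N) (reduction (N := N) m).
Proof.
move=> hm N; split; first exact: reduction_multilinear.
  have := reduction_degree (N := N) mh.1 md.
  by congr of_degree; apply/funext => n; rewrite tot_bideg_op.
move=> ds xs xs0 h; rewrite -[xs](map_trunc_lift G) trunc_insertions //.
rewrite (@insertions_bar _ _ _ (spar G) m m mh.1 mh.1 (op_spar mh md)) ?hm; last exact: eigen_lift.
  by rewrite signb0; apply/ffunP => i; rewrite !ffunE.
by case: (xs) xs0.
Qed.

Lemma comp_bar_Ainf_mor :
  (forall xs, bar_insert (susp_sign (spar G)) (bar (spar G) m) (bar (spar G) f) xs -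
     bar_compose (bar (spar G) f) (bar (spar G') m') xs = 0) ->
  forall N, Ainf_mor (trunc_grading (tot G) N) (trunc_grading (tot G') N)
    (reduction (N := N) m) (reduction (N := N) m') (reduction (N := N) f).
Proof.
move=> hm N; split; first exact: reduction_multilinear.
  have := reduction_degree (N := N) fh.1 fd.
  by congr of_degree; apply/funext => n; rewrite tot_bideg_mor.
move=> ds xs xs0 h; rewrite -[xs](map_trunc_lift G) trunc_insertions // trunc_compositions //.
have xs1 : map (@trunc_lift _ _ G N) xs <> [::] by case: (xs) xs0.
have he := eigen_lift h.
rewrite (@insertions_bar _ _ _ (spar G) m f mh.1 fh.1 (op_spar mh md) _ _ xs1 he).
rewrite (@compositions_bar _ _ _ (spar G) (spar G') f m' fh.1 mh'.1 mor_spar _ _ xs1 he).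
by congr (trunc _ (signb _ _)); apply/eqP; rewrite -subr_eq0 hm.
Qed.

End SeriesRelations.
End Relations.

(** * Orders in h of the defect of a morphism *)

(** The lowest coefficient of F [:: x] only involves the lowest coefficients of x and
    of F. *)
Lemma coef_slot1 (k : comPzRingType) (V W : lmodType k)
    (G : grading V (int * int)%type) (G' : grading W (int * int)%type)
    (F : seq (series G) -> series G') (f1 : V -> W) R x : hmlin (@hmul _ _ _) (@hmul _ _ _) F ->
  (forall z, F [:: z] 0%N = f1 (z 0%N)) -> hord R x -> F [:: x] R = f1 (x R).
Proof.
move=> hF h0 /hord_iter [z ->]; rewrite (hmlin_iter R [::] z [::] hF) /=.
by rewrite -{2 4}[R]addn0 !iter_hmul_coef.
Qed.

Section Orders.
Variables (k : comPzRingType) (V W : lmodType k).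
Variables (G : grading V (int * int)%type) (G' : grading W (int * int)%type).
Local Notation X := (series G).
Local Notation Y := (series G').
Local Notation hX := (@hmul k V G).
Local Notation hY := (@hmul k W G').
Local Notation sX := (susp_sign (spar G)).
Local Notation sY := (susp_sign (spar G')).

Lemma susp_sign_sparK : involutive sX.
Proof. by move=> x; rewrite /susp_sign linearN opprK sparK. Qed.

Lemma susp_sign_spar_hmul x : sX (hX x) = hX (sX x).
Proof. by rewrite /= /susp_sign spar_hmul linearN. Qed.

Lemma splits3_coef (T : Type) (U : lmodType k) (H : grading U (int * int)%type)
    (xs : seq T) (K : seq T -> seq T -> seq T -> series H) R :
  splits3 xs K R = splits3 xs (fun u v w => K u v w R).
Proof. by rewrite /splits3 coef_sum; apply: eq_bigr => p _; rewrite coef_sum. Qed.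

Section Defect.
Variables (B : seq X -> X) (F : seq X -> Y) (b : seq Y -> Y).
Hypotheses (Bh : hmlin hX hX B) (Fh : hmlin hX hY F) (bh : hmlin hY hY b).

(** The failure of F to be a morphism from B to b. *)
Definition defect xs := bar_insert sX B F xs - bar_compose F b xs.
Definition curvature xs := bar_insert sX B B xs.

Lemma hmlin_defect : hmlin hX hY defect.
Proof.
apply: (hmlinB (hX := hX) (hZ := hY)).
  by apply: (hmlin_bar_insert (hX := hX) (hZ := hY)) => // x; apply: susp_sign_spar_hmul.
exact: (hmlin_bar_compose (hX := hX) (hY := hY) (hZ := hY)).
Qed.

Hypotheses (B0 : B [::] = 0) (b0 : b [::] = 0).

Lemma defect0 : defect [::] = 0.
Proof.
rewrite /defect /bar_insert /splits3 !big_splits_nil /bar_compose segs_nil /= b0 subr0 B0.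
exact: (mlin0 (hmlin_multilinear Fh) [::] [::]).
Qed.

Lemma hord_splits3 R xs (K : seq X -> seq X -> seq X -> Y) :
  (forall u v w, u ++ v ++ w = xs -> hord R (K u v w)) -> hord R (splits3 xs K).
Proof.
by move=> h i hi; rewrite splits3_coef; apply: splits3_eq0 => u v w /h ->.
Qed.

(** An insertion of at least two arguments leaves D with fewer arguments, and an
    insertion of one argument contributes a factor h. *)
Lemma hord_insertions (B' : seq X -> X) (D : seq X -> Y) R n xs : hmlin hX hY D ->
  hmlin hX hX B' -> B' [::] = 0 -> (forall x, hord 1 (B' [:: x])) ->
  (forall ys, (0 < size ys < n)%N -> hord R.+1 (D ys)) ->
  (forall ys, size ys = n -> hord R (D ys)) -> size xs = n ->
  hord R.+1 (bar_insert sX B' D xs).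
Proof.
move=> hD hB' B'0 B'1 lt eq sz; apply: hord_splits3 => u [|x [|y v]] w uvw.
- by rewrite B'0 (mlin0 (hmlin_multilinear hD)).
- apply: hmlin_hord2 => // z; apply: eq.
  by rewrite -sz -uvw !size_cat /= size_map.
- apply: lt; rewrite size_cat /= size_map addnS /= -sz -uvw !size_cat /=; lia.
Qed.

(** The coefficient of h^R of the obstruction identity in arity n, when everything of
    lower order or arity vanishes. *)
Lemma defect_step (f1 : V -> W) (d : W -> W) R n :
  (forall v, B (map sX v) = - sX (B v)) -> (forall v, F (map sX v) = sY (F v)) ->
  (forall ys, bar_insert sY b b ys = 0) -> (forall x, hord 1 (B [:: x])) ->
  (forall z, F [:: z] 0%N = f1 (z 0%N)) -> (forall z, b [:: z] 0%N = d (z 0%N)) ->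
  (forall ys, (size ys < n)%N -> hord R.+1 (defect ys)) ->
  (forall ys, size ys = n -> hord R (defect ys)) ->
  (forall ys, (size ys < n)%N -> hord R.+1 (curvature ys)) ->
  (forall ys, size ys = n -> hord R (curvature ys)) ->
  forall xs, size xs = n -> f1 (curvature xs R) = d (defect xs R).
Proof.
move=> Bs Fs bb B1 F1 b1 Dlt Deq Wlt Weq xs sz.
have := bar_obstruction xs (hmlin_multilinear Fh) (hmlin_multilinear bh) susp_sign_sparK Bs Fs bb.
move/(congr1 (fun z : Y => z R)); rewrite coefD.
rewrite [X in _ = X + _](hord_insertions (R := R) hmlin_defect Bh B0 B1 _ _ sz) //; last by move=> ys /andP[_ /Dlt].
rewrite add0r -[defect]/(fun v => bar_insert sX B F v - bar_compose F b v).
have -> : (splits3 xs (fun u v w => F (u ++ bar_insert sX B B v :: w))) R = f1 (curvature xs R).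
  rewrite -(coef_slot1 Fh F1 (Weq _ sz)) splits3_coef.
  rewrite (splits3_whole (K := fun u v w => F (u ++ bar_insert sX B B v :: w) R)) // => u v w _ lt.
  by apply: (hmlin_hord _ _ Fh (R := R.+1)) => //; apply: Wlt; rewrite -sz.
move=> ->; rewrite -(coef_slot1 bh b1 (Deq _ sz)) /bar_mix splits3_coef.
rewrite (splits3_whole (K := fun u v w => (\sum_(b0 <- segs u) \sum_(c <- segs w)
  b (map sY (map F b0) ++ (bar_insert sX B F v - bar_compose F b v) :: map F c)) R)) => [|u v w _ lt].
  by rewrite !segs_nil.
rewrite coef_sum big1 // => p _; rewrite coef_sum big1 // => q _.
by apply: (hmlin_hord _ _ bh (R := R.+1)) => //; apply: Dlt; rewrite -sz.
Qed.

End Defect.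

Section Perturbation.
Variables (B B' : seq X -> X) (F F' : seq X -> Y) (b : seq Y -> Y).
Hypotheses (Fh : hmlin hX hY F) (bh : hmlin hY hY b).
Hypotheses (Bh' : hmlin hX hX B') (Fh' : hmlin hX hY F').
Hypothesis B0' : B' [::] = 0.

(** A perturbation of order R in arity n enters the defect linearly, through the arity
    one parts of F and b; all its other effects have higher order. *)
Lemma defect_perturb (f1 : V -> W) (d : W -> W) R n :
  (forall x, hord 1 (B' [:: x])) ->
  (forall z, F [:: z] 0%N = f1 (z 0%N)) -> (forall z, b [:: z] 0%N = d (z 0%N)) ->
  (forall ys, (size ys < n)%N -> hord R.+1 (B' ys - B ys)) ->
  (forall ys, size ys = n -> hord R (B' ys - B ys)) ->
  (forall ys, (size ys < n)%N -> hord R.+1 (F' ys - F ys)) ->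
  (forall ys, size ys = n -> hord R (F' ys - F ys)) -> (0 < n)%N ->
  forall xs, size xs = n -> defect B' F' b xs R =
    defect B F b xs R + f1 ((B' xs - B xs) R) - d ((F' xs - F xs) R).
Proof.
move=> B1 F1 b1 Blt Beq Flt Feq n0 xs sz.
have E1 : bar_insert sX B' F' xs - bar_insert sX B' F xs = bar_insert sX B' (fun ys => F' ys - F ys) xs.
  by rewrite /bar_insert -splits3N -splits3D.
have H1 : (bar_insert sX B' F' xs - bar_insert sX B' F xs) R = 0.
  rewrite E1; apply: (@hord_insertions _ _ R n) => //.
    exact: (hmlinB (hX := hX) (hZ := hY)).
  by move=> ys /andP[_ /Flt].
have H2 : (bar_insert sX B' F xs - bar_insert sX B F xs) R = f1 ((B' xs - B xs) R).
  rewrite -(coef_slot1 Fh F1 (Beq _ sz)) /bar_insert -splits3N -splits3D splits3_coef.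
  rewrite (splits3_whole (K := fun u v w => (F (map sX u ++ B' v :: w) - F (map sX u ++ B v :: w)) R)).
    by have /= -> := mlinB (hmlin_multilinear Fh) [::] [::] (B' xs) (B xs).
  move=> u v w _ lt; rewrite -mlinB; last exact: hmlin_multilinear Fh.
  by apply: (hmlin_hord _ _ Fh (R := R.+1)) => //; apply: Blt; rewrite -sz.
have H3 : (bar_compose F' b xs - bar_compose F b xs) R = d ((F' xs - F xs) R).
  rewrite -(coef_slot1 bh b1 (Feq _ sz)) /bar_compose -sumrB coef_sum.
  rewrite (segs_whole (K := fun bs => (b (map F' bs) - b (map F bs)) R)) ?sz //.
    by have /= -> := mlinB (hmlin_multilinear bh) [::] [::] (F' xs) (F xs).
  move=> bs _ al; apply: (hmlin_hord_eq (R := R.+1) [::] bh) => //; last by rewrite !size_map.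
  move=> i; have [ib|ib] := ltnP i (size bs); last by rewrite !nth_default ?subrr ?size_map.
  rewrite !(nth_map [::]) //; apply: Flt.
  by move/(all_nthP [::]): al => /(_ i ib) /andP[].
move/eqP: H1; rewrite coefB subr_eq0 => /eqP H1.
rewrite -H2 -H3 /defect !coefB H1.
by rewrite [_ - _ + _]addrC addrA subrK opprB addrA subrK.
Qed.

End Perturbation.
End Orders.

(** * Extending families of multilinear maps to power series *)

Section Extension.
Variables (k : comPzRingType) (V W : lmodType k).
Variables (G : grading V (int * int)%type) (G' : grading W (int * int)%type).

(** The coefficient of h^R of the h-multilinear extension of the family beta, where
    beta r is the coefficient of h^r. *)
Fixpoint extend_coef (beta : nat -> seq V -> W) (xs : seq (nat -> V)) (R : nat) : W :=
  if xs is x :: xs' then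
    \sum_(i < R.+1) extend_coef (fun r ys => beta r (x i :: ys)) xs' (R - i)%N
  else beta R [::].

Lemma multilinear_cons (beta : seq V -> W) x : multilinear beta -> multilinear (fun ys => beta (x :: ys)).
Proof. by move=> h a y z u w; apply: (h a y z (x :: u) w). Qed.

Lemma eq_extend_coef beta beta' xs R :
  (forall r ys, (r <= R)%N -> size ys = size xs -> beta r ys = beta' r ys) ->
  extend_coef beta xs R = extend_coef beta' xs R.
Proof.
elim: xs beta beta' R => [|x xs IH] beta beta' R h /=; first exact: h.
apply: eq_bigr => i _; apply: IH => r ys rR sz; apply: h; rewrite /= ?sz //.
by apply: leq_trans rR (leq_subr _ _).
Qed.

Lemma extend_coef_eq0 beta xs R : (forall r ys, size ys = size xs -> beta r ys = 0) ->
  extend_coef beta xs R = 0.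
Proof.
elim: xs beta R => [|x xs IH] beta R h /=; first exact: h.
by rewrite big1 // => i _; apply: IH => r ys sz; apply: h; rewrite /= sz.
Qed.

Lemma extend_coef_linear beta : (forall r, multilinear (beta r)) ->
  forall a x y u w R, extend_coef beta (u ++ (a *: x + y : nat -> V) :: w) R =
    a *: extend_coef beta (u ++ x :: w) R + extend_coef beta (u ++ y :: w) R.
Proof.
move=> bl a x y u; elim: u beta bl => [|z u IH] beta bl w R /=.
  rewrite scaler_sumr -big_split; apply: eq_bigr => i _ /=.
  have gen (p q r' : nat -> seq V -> W) l S :
      (forall r ys, p r ys = a *: q r ys + r' r ys) ->
      extend_coef p l S = a *: extend_coef q l S + extend_coef r' l S.
    elim: l p q r' S => [|v l IHl] p q r' S h /=; first exact: h.
    rewrite scaler_sumr -big_split; apply: eq_bigr => j _ /=.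
    by apply: IHl => r ys; apply: h.
  by apply: gen => r ys; apply: (bl r a (x i) (y i) [::] ys).
rewrite scaler_sumr -big_split; apply: eq_bigr => i _ /=.
by apply: IH => r; apply: multilinear_cons.
Qed.

Lemma extend_coef_shift beta : (forall r, multilinear (beta r)) -> forall x u w R,
  extend_coef beta (u ++ (fun r => if r is r'.+1 then x r' else 0) :: w) R =
  if R is R'.+1 then extend_coef beta (u ++ x :: w) R' else 0.
Proof.
move=> bl x u; elim: u beta bl => [|z u IH] beta bl w R /=.
  rewrite big_ord_recl /= extend_coef_eq0 ?add0r => [|r ys _]; last exact: (mlin0 (bl r) [::] ys).
  by case: R => [|R]; [rewrite big_ord0|apply: eq_bigr => i _].
rewrite (eq_bigr (fun i : 'I_R.+1 => if (R - i)%N is R'.+1 then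
   extend_coef (fun r ys => beta r (z i :: ys)) (u ++ x :: w) R' else 0)); last first.
  by move=> i _; apply: IH => r; apply: multilinear_cons.
case: R => [|R]; first by rewrite big_ord_recl big_ord0 addr0.
rewrite big_ord_recr /= subnn addr0; apply: eq_bigr => i _ /=.
by rewrite subSn // -ltnS.
Qed.

Lemma extend_coef_homog beta D ds xs :
  (forall r ds ys, size ys = size xs -> List.Forall2 G ds ys ->
     G' (\sum_(d <- ds) d + D + (r%:Z, - r%:Z)) (beta r ys)) ->
  List.Forall2 (shifted_homog G) ds xs ->
  forall R, G' (\sum_(d <- ds) d + D + (R%:Z, - R%:Z)) (extend_coef beta xs R).
Proof.
move=> hb h; elim: h beta D hb => [|d x ds' xs' hx h IH] beta D hb R /=.
  by apply: hb => //; constructor.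
apply: submod_sum; first exact: homog_submod.
move=> i _.
have iR : (i <= R)%N by rewrite -ltnS.
have := IH (fun r ys => beta r (x i :: ys)) (D + (d.1 + i%:Z, d.2 - i%:Z)) _ (R - i)%N.
have -> : \sum_(d <- ds') d + (D + (d.1 + i%:Z, d.2 - i%:Z)) + ((R - i)%N%:Z, - (R - i)%N%:Z) =
    \sum_(d <- d :: ds') d + D + (R%:Z, - R%:Z).
  rewrite big_cons -subzn //; case: (\sum_(d <- ds') d) (D) (d) => [a b] [p q] [v w].
  by congr (_, _); rewrite /=; lia.
apply=> r es ys sz hes.
have := hb r ((d.1 + i%:Z, d.2 - i%:Z) :: es) (x i :: ys); rewrite /= sz => /(_ erefl).
rewrite big_cons => hG; rewrite [\sum_(d0 <- es) d0 + _]addrA [X in X + _]addrC addrA; apply: hG.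
by constructor => //; apply: hx.
Qed.

Lemma extend_coef_const beta vs R : (forall r, multilinear (beta r)) ->
  extend_coef beta (map (fun v => coef (cst G v)) vs) R = beta R vs.
Proof.
elim: vs beta R => [|v vs IH] beta R bl //=.
rewrite big_ord_recl subn0 big1 ?addr0 => [|i _].
  by rewrite IH => [|r]; [rewrite cst_coef|apply: multilinear_cons].
apply: extend_coef_eq0 => r ys _; rewrite cst_coef /=.
exact: (mlin0 (bl r) [::] ys).
Qed.

Lemma extend_coef_at0 beta xs : extend_coef beta xs 0 = beta 0%N (map (fun x => x 0%N) xs).
Proof.
elim: xs beta => [|x xs IH] beta //=.
by rewrite big_ord_recl big_ord0 addr0 IH.
Qed.

Lemma extend_coef_unit beta e xs R : (forall r, multilinear (beta r)) ->
  (forall r ys, size ys = size xs -> List.In e ys -> beta r ys = 0) ->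
  List.In (coef (cst G e)) xs -> extend_coef beta xs R = 0.
Proof.
elim: xs beta R => [|x xs IH] beta R bl h //= [xe|xe].
  rewrite big1 // => i _; apply: extend_coef_eq0 => r ys sz; rewrite xe cst_coef.
  case: eqP => _; last exact: (mlin0 (bl r) [::] ys).
  by apply: h; [rewrite /= sz|left].
rewrite big1 // => i _; apply: IH => // [r|r ys sz ye]; first exact: multilinear_cons.
by apply: h; [rewrite /= sz|right].
Qed.

(** The coefficient of h^r has the degree of the operation shifted by (r, -r), the
    opposite of the bidegree of h^r. *)
Record family (delta : nat -> int * int) (beta : nat -> seq V -> W) : Prop := Family {
  fam_lin : forall r, multilinear (beta r);
  fam_nil : forall r, beta r [::] = 0;
  fam_deg : forall r ds xs, xs <> [::] -> List.Forall2 G ds xs ->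
    G' (\sum_(d <- ds) d + delta (size xs) + (r%:Z, - r%:Z)) (beta r xs) }.

(** The sequence of coefficients is a power series only when beta is homogeneous,
    which extend_proof shows; the default value 0 is never used then. *)
Definition extend (beta : nat -> seq V -> W) (xs : seq (series G)) : series G' :=
  insubd (0 : series G') (extend_coef beta (map (@coef _ _ G) xs)).

Section Family.
Variables (delta : nat -> int * int) (beta : nat -> seq V -> W).
Hypothesis fam : family delta beta.

Lemma extend_coef_series_homog ds xs : xs <> [::] -> List.Forall2 (series_grading G) ds xs ->
  shifted_homog G' (\sum_(d <- ds) d + delta (size xs)) (extend_coef beta (map (@coef _ _ G) xs)).
Proof.
move=> xs0 h R.
have := @extend_coef_homog beta (delta (size xs)) ds (map (@coef _ _ G) xs) _ _ R.
have -> : (\sum_(d <- ds) d + delta (size xs) + (R%:Z, - R%:Z)) =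
  ((\sum_(d <- ds) d + delta (size xs)).1 + R%:Z, (\sum_(d <- ds) d + delta (size xs)).2 - R%:Z) by [].
apply; last by rewrite -[ds]map_id; apply: Forall2_map2 h.
move=> r es ys; rewrite size_map => sz hes; rewrite -sz; apply: (fam_deg fam) => //.
by move=> ys0; move: sz; rewrite ys0; case: (xs) xs0.
Qed.

Lemma extend_coef_linear_series a (x y : series G) u w :
  extend_coef beta (map (@coef _ _ G) (u ++ (a *: x + y) :: w)) =
  a *: (extend_coef beta (map (@coef _ _ G) (u ++ x :: w)) : nat -> W) +
  extend_coef beta (map (@coef _ _ G) (u ++ y :: w)).
Proof.
apply/funext => R; rewrite !map_cat /=.
exact: (extend_coef_linear (fam_lin fam)).
Qed.

Lemma extend_proof xs : series_pred G' (extend_coef beta (map (@coef _ _ G) xs)).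
Proof.
apply: series_proof; case: xs => [|x xs].
  have -> : extend_coef beta (map (@coef _ _ G) [::]) = 0 by apply/funext => R; apply: (fam_nil fam).
  by case: (in_sum_submod (shifted_submod G')).
apply: (@mlin_homog _ _ _ _ (series_grading G) (fun xs => extend_coef beta (map (@coef _ _ G) xs) : nat -> W)
  (in_sum (shifted_homog G'))).
- by move=> a x' y u w; apply: extend_coef_linear_series.
- exact: (in_sum_submod (shifted_submod G')).
move=> ds [|y ys] // _ h; apply: in_sum1; first exact: shifted_submod.
by apply: extend_coef_series_homog h.
Qed.

Lemma extend_coefE xs : coef (extend beta xs) = extend_coef beta (map (@coef _ _ G) xs).
Proof. by rewrite /extend insubdK //; apply: extend_proof. Qed.

Lemma extend_cst vs R : extend beta (map (cst G) vs) R = beta R vs.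
Proof.
by rewrite extend_coefE -map_comp (extend_coef_const _ _ (fam_lin fam)).
Qed.

Lemma extend_nil : extend beta [::] = 0.
Proof. by apply: series_ext => r; rewrite extend_coefE /= (fam_nil fam). Qed.

Lemma extend_at0 xs : extend beta xs 0%N = beta 0%N (map (fun x : series G => x 0%N) xs).
Proof. by rewrite extend_coefE extend_coef_at0 -map_comp. Qed.

Lemma extend_hmultilinear : hmultilinear (extend beta).
Proof.
split=> [a x y u w|x u w]; apply: series_ext => R.
  by rewrite coefD coefZ !extend_coefE extend_coef_linear_series.
rewrite extend_coefE !map_cat /= (extend_coef_shift (fam_lin fam)).
by case: R => [|R] //=; rewrite extend_coefE map_cat.
Qed.

Lemma extend_degree : of_degree (series_grading G) (series_grading G') delta (extend beta).
Proof.
move=> ds xs xs0 h; rewrite /= /series_homog extend_coefE.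
exact: extend_coef_series_homog.
Qed.

Lemma extend_hmlin : hmlin (@hmul _ _ G) (@hmul _ _ G') (extend beta).
Proof. exact/hmultilinear_hmlin/extend_hmultilinear. Qed.

Lemma extend_unit n e xs :
  (forall r ys, size ys = n -> List.In e ys -> beta r ys = 0) -> size xs = n ->
  List.In (cst G e) xs -> extend beta xs = 0.
Proof.
move=> h sz xe; apply: series_ext => R; rewrite extend_coefE.
apply: (@extend_coef_unit _ e) => //; first exact: (fam_lin fam).
  by move=> r ys; rewrite size_map sz; apply: h.
exact: List.in_map.
Qed.

End Family.

Lemma extend_sub_hord delta beta beta' R n (xs : seq (series G)) :
  family delta beta -> family delta beta' ->
  (forall r ys, (r < R)%N -> size ys = n -> beta' r ys = beta r ys) ->
  size xs = n -> hord R (extend beta' xs - extend beta xs).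
Proof.
move=> fb fb' h sz i iR; rewrite coefB (extend_coefE fb) (extend_coefE fb').
rewrite (@eq_extend_coef beta' beta) ?subrr // => r ys ri; rewrite size_map sz => sy.
by apply: h => //; apply: leq_ltn_trans iR.
Qed.

Lemma eq_extend_coef_series delta beta beta' R n (xs : seq (series G)) :
  family delta beta -> family delta beta' ->
  (forall r ys, (r <= R)%N -> size ys = n -> beta' r ys = beta r ys) ->
  size xs = n -> extend beta' xs R = extend beta xs R.
Proof.
move=> fb fb' h sz; rewrite (extend_coefE fb) (extend_coefE fb').
by apply: eq_extend_coef => r ys ri; rewrite size_map sz; apply: h.
Qed.

End Extension.

(** * Strict units in the bar form *)

Section Unit.
Variables (k : comPzRingType) (X Y : lmodType k).
Variables (sX : X -> X) (sY : Y -> Y).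
Variables (B : seq X -> X) (F : seq X -> Y) (b : seq Y -> Y) (e : X) (e' : Y).
Hypotheses (Fl : multilinear F) (bl : multilinear b).
Hypothesis Fs : forall v, F (map sX v) = sY (F v).
Hypothesis se : sX e = - e.
Hypotheses (Bel : forall x, B [:: e; x] = x) (Ber : forall x, B [:: x; e] = - sX x).
Hypothesis Be : forall v, e \in v -> size v != 2%N -> B v = 0.
Hypotheses (bel : forall y, b [:: e'; y] = y) (ber : forall y, b [:: y; e'] = - sY y).
Hypothesis be : forall v, e' \in v -> size v != 2%N -> b v = 0.
Hypotheses (Fe1 : F [:: e] = e') (Fe : forall v, e \in v -> (2 <= size v)%N -> F v = 0).

(** Only the insertions of the unit together with one neighbour survive. When the unit
    is an inner entry, those of the left and of the right neighbour cancel. *)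
Lemma bar_insert_unit u w :
  bar_insert sX B F (u ++ e :: w) = (if w is [::] then 0 else F (map sX u ++ w)) -
    (if u is [::] then 0 else F (map sX u ++ w)).
Proof.
rewrite /bar_insert splits3_mark.
rewrite [X in X + _ + _]splits3_eq0 ?add0r => [|a v c _]; last first.
  by apply: Fe; rewrite ?mem_cat ?inE ?mem_cat ?inE ?eqxx ?orbT // !size_cat /= size_cat /=; lia.
rewrite [X in _ + X]splits3_eq0 ?addr0 => [|a v c _]; last first.
  rewrite map_cat /= se -catA /= mlinN // Fe ?oppr0 //.
    by rewrite mem_cat inE eqxx orbT.
  by rewrite size_cat /= size_cat /=; lia.
pose H a c := \sum_(q <- splits w) F (map sX a ++ B (c ++ e :: q.1) :: q.2).
rewrite -[LHS]/(\sum_(p <- splits u) H p.1 p.2).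
have H1 a : H a [::] = if w is [::] then 0 else F (map sX a ++ w).
  rewrite /H; case: w @H => [|x w].
    by rewrite big_splits_nil /= Be ?inE ?eqxx // mlin0.
  rewrite big_splits_cons /= Be ?inE ?eqxx // mlin0 // add0r.
  rewrite (splits_head (H := fun u v => F (map sX a ++ B (e :: x :: u) :: v))) ?Bel //.
  by case=> [|y v] // v' _ _; rewrite Be ?inE ?eqxx // mlin0.
have H2 a x : H a [:: x] = - F (map sX a ++ sX x :: w).
  rewrite /H (splits_head (H := fun u v => F (map sX a ++ B ([:: x] ++ e :: u) :: v))) /=.
    by rewrite Ber mlinN.
  by case=> [|y v] // v' _ _; rewrite Be ?inE ?eqxx ?orbT // mlin0.
have H3 a c : (2 <= size c)%N -> H a c = 0.
  move=> c2; rewrite /H big1 // => q _.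
  rewrite Be ?mem_cat ?inE ?eqxx ?orbT ?mlin0 // size_cat /=; lia.
case/lastP: u => [|u x]; first by rewrite big_splits_nil H1 subr0.
rewrite -cats1 (splits_mark u x [::] H) big_splits_nil -cat_rcons cats0 H1.
rewrite (eq_splits (H := fun a c => H a (c ++ [:: x]))
  (H' := fun a c => if c is [::] then H a [:: x] else 0)); last first.
  by move=> a [|y c] _ //; rewrite H3 // size_cat /= addn1.
rewrite (splits_last (H := fun a c => if c is [::] then H a [:: x] else 0)); last first.
  by move=> a [|y c] <- //; rewrite cats0 ltnn.
rewrite H2 addrC map_rcons cat_rcons; congr (_ - _).
by case: (u).
Qed.

(** The unit must form a block of its own, whose value is the unit e'; then b vanishes
    unless there is exactly one further block. *)
Lemma bar_compose_unit u w :
  bar_compose F b (u ++ e :: w) = (if u is [::] then if w is [::] then 0 else F w else 0) +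
    (if w is [::] then if u is [::] then 0 else - sY (F u) else 0).
Proof.
rewrite /bar_compose segs_mark.
have E : \sum_(p <- splits u) \sum_(q <- splits w) \sum_(b0 <- segs p.1) \sum_(c <- segs q.2)
     b (map F (b0 ++ (p.2 ++ e :: q.1) :: c)) =
   \sum_(b0 <- segs u) \sum_(c <- segs w) b (map F b0 ++ e' :: map F c).
  rewrite (splits_last (H := fun p1 p2 => \sum_(q <- splits w) \sum_(b0 <- segs p1) \sum_(c <- segs q.2)
     b (map F (b0 ++ (p2 ++ e :: q.1) :: c)))); last first.
    move=> a c ac lt; rewrite big1 // => q _; rewrite big1 // => i _; rewrite big1 // => j _.
    rewrite map_cat /= Fe ?mlin0 ?mem_cat ?inE ?eqxx ?orbT //.
    by move: lt; rewrite -ac !size_cat /=; lia.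
  rewrite (splits_head (H := fun q1 q2 => \sum_(b0 <- segs u) \sum_(c <- segs q2)
     b (map F (b0 ++ ([::] ++ e :: q1) :: c)))).
    by apply: eq_bigr => i _; apply: eq_bigr => j _; rewrite map_cat /= Fe1.
  move=> a c ac a0; rewrite big1 // => i _; rewrite big1 // => j _.
  rewrite map_cat /= Fe ?mlin0 ?inE ?eqxx //.
rewrite E {E}.
have b0 l l' : (size l + size l' != 1)%N -> b (l ++ e' :: l') = 0.
  move=> h; apply: be; first by rewrite mem_cat inE eqxx orbT.
  by rewrite size_cat /=; lia.
have wh (l : seq X) (bs : seq (seq X)) : flatten bs = l -> all (fun b => 0 < size b < size l)%N bs -> (size bs != 1)%N.
  by case: bs => [|c [|c' bs]] //=; rewrite cats0 => ->; rewrite ltnn !andbF.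
case: u w => [|x u] [|y w].
- by rewrite !segs_nil b0 // addr0.
- rewrite segs_nil addr0 (segs_whole (K := fun c => b (map F [::] ++ e' :: map F c))) //=.
  by move=> bs fl al; apply: (b0 [::]); rewrite size_map add0n; exact: wh fl al.
- rewrite add0r; under eq_bigr => i _ do rewrite segs_nil.
  rewrite (segs_whole (K := fun c => b (map F c ++ [:: e']))) //=.
  by move=> bs fl al; apply: (b0 _ [::]); rewrite size_map addn0; exact: wh fl al.
rewrite addr0.
rewrite segs_first big1 // => p _; rewrite big1 // => i _; rewrite segs_first big1 // => q _.
by rewrite big1 // => j _; apply: b0; rewrite /= !size_map; lia.
Qed.

(** Unitality of B, F and b makes the defect vanish on the unit, which is what
    lets the corrections be chosen to vanish there too. *)
Lemma defect_unit xs : e \in xs -> bar_insert sX B F xs = bar_compose F b xs.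
Proof.
case/splitPr => u w; rewrite bar_insert_unit bar_compose_unit.
case: u w => [|x u] [|y w]; rewrite ?subr0 ?sub0r ?addr0 ?add0r ?oppr0 //.
  by rewrite cats0 Fs.
by rewrite subrr.
Qed.

End Unit.

(** * Lifting multilinear maps out of a projective module *)

Section FreeModule.
Variables (k : comPzRingType) (I : choiceType).

Definition finsupp_pred : pred (I -> k^o) :=
  fun v => `[< exists s : seq I, forall i, i \notin s -> v i = 0 >].

Lemma finsupp_submod_closed : submod_closed finsupp_pred.
Proof.
split=> [|a x y]; rewrite /in_mem /= /finsupp_pred; first by apply/asboolP; exists [::].
move=> /asboolP[s hs] /asboolP[t ht]; apply/asboolP; exists (s ++ t) => i.
rewrite mem_cat negb_or => /andP[/hs xi /ht yi].
by rewrite -[LHS]/(a *: x i + y i) xi yi scaler0 addr0.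
Qed.

HB.instance Definition _ :=
  GRing.isSubmodClosed.Build k (I -> k^o) finsupp_pred finsupp_submod_closed.

Record freemod := Freemod { fcoef :> I -> k^o; _ : finsupp_pred fcoef }.
HB.instance Definition _ := [isSub for fcoef].
HB.instance Definition _ := [Choice of freemod by <:].
HB.instance Definition _ := [SubChoice_isSubLmodule of freemod by <:].

Lemma fsupp_exists (v : freemod) : exists s : seq I, uniq s /\ forall i, i \notin s -> v i = 0.
Proof.
have /asboolP [s hs] : finsupp_pred (fcoef v) by case: v.
by exists (undup s); split=> [|i]; rewrite ?undup_uniq ?mem_undup //; apply: hs.
Qed.

Definition fsupp v := sval (cid (fsupp_exists v)).
Lemma fsupp_uniq v : uniq (fsupp v).
Proof. by rewrite /fsupp; case: cid => s []. Qed.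
Lemma fsupp_out (v : freemod) i : i \notin fsupp v -> v i = 0.
Proof. by rewrite /fsupp; case: cid => s [us h] /=; apply: h. Qed.

Lemma free_basis_proof i : finsupp_pred (fun j => (j == i)%:R).
Proof. by apply/asboolP; exists [:: i] => j; rewrite inE => /negPf ->. Qed.
Definition free_basis i := Freemod (free_basis_proof i).

Section Ext.
Variable N : lmodType k.
Implicit Types (g : I -> N) (v : freemod).

Definition free_extend g (v : freemod) : N := \sum_(i <- fsupp v) (v i : k) *: g i.

Lemma free_extendW g s (v : freemod) : uniq s -> (forall i, i \notin s -> v i = 0) ->
  free_extend g v = \sum_(i <- s) (v i : k) *: g i.
Proof.
move=> us hs; pose t := undup (s ++ fsupp v).
have aux r : uniq r -> {subset r <= t} -> (forall i, i \notin r -> v i = 0) ->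
    \sum_(i <- r) (v i : k) *: g i = \sum_(i <- t) (v i : k) *: g i.
  move=> ur rt hr; rewrite [RHS](bigID (mem r)) /= [X in _ + X]big1 ?addr0 => [|i /hr ->]; last exact: scale0r.
  rewrite -[RHS]big_filter; apply: perm_big; apply: uniq_perm; rewrite ?filter_uniq ?undup_uniq //.
  by move=> i; rewrite mem_filter; case: (boolP (i \in r)) => //= /rt ->.
have -> : free_extend g v = \sum_(i <- t) (v i : k) *: g i.
  apply: aux; first exact: fsupp_uniq.
    by move=> i hi; rewrite mem_undup mem_cat hi orbT.
  by move=> i; apply: fsupp_out.
by rewrite aux // => i hi; rewrite mem_undup mem_cat hi.
Qed.

Lemma free_extend_linear g : linear (free_extend g).
Proof.
move=> a x y; pose s := undup (fsupp x ++ fsupp y).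
have us : uniq s by apply: undup_uniq.
have hx i : i \notin s -> x i = 0.
  by rewrite mem_undup mem_cat negb_or => /andP[h _]; apply: fsupp_out.
have hy i : i \notin s -> y i = 0.
  by rewrite mem_undup mem_cat negb_or => /andP[_ h]; apply: fsupp_out.
have hxy i : i \notin s -> fcoef (a *: x + y) i = 0.
  move=> hi; rewrite -[LHS]/(a * (x i : k) + y i); have -> := hx i hi.
  by rewrite mulr0 add0r hy.
rewrite (free_extendW g us hx) (free_extendW g us hy) (free_extendW g us hxy).
rewrite scaler_sumr -big_split; apply: eq_bigr => i _ /=.
by rewrite scalerA -scalerDl.
Qed.
HB.instance Definition _ g := GRing.isLinear.Build k freemod N *:%R (free_extend g) (free_extend_linear g).

Lemma free_extend_basis g i : free_extend g (free_basis i) = g i.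
Proof.
rewrite (@free_extendW _ [:: i]) // => [|j]; last by rewrite inE /= => /negPf ->.
by rewrite big_seq1 /= eqxx scale1r.
Qed.

Lemma free_extendP g g' g'' a v : (forall i, g i = a *: g' i + g'' i) ->
  free_extend g v = a *: free_extend g' v + free_extend g'' v.
Proof.
move=> h; rewrite /free_extend scaler_sumr -big_split; apply: eq_bigr => i _ /=.
by rewrite h scalerDr !scalerA mulrC.
Qed.

End Ext.

Lemma free_extend_morph (N N' : lmodType k) (q : {linear N -> N'}) g v :
  q (free_extend g v) = free_extend (fun i => q (g i)) v.
Proof. by rewrite /free_extend linear_sum; apply: eq_bigr => i _; rewrite linearZ. Qed.

End FreeModule.

Section ProjectiveLift.
Variables (k : comPzRingType) (P : lmodType k) (G : grading P (int * int)%type).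
Hypothesis Pproj : projective P.
Local Notation I := ((int * int) * P)%type.

(** A dual basis: the coordinates of p give p as a combination of homogeneous
    elements. *)
Lemma dual_basis_exists : exists h : {linear P -> freemod k I},
  forall p, free_extend (fun i : I => gcomp G i.1 i.2) (h p) = p.
Proof.
apply: (Pproj (g := free_extend (fun i : I => gcomp G i.1 i.2)) idfun).
move=> x; exists (\sum_(d <- gsupp G x) free_basis k (d, x)).
by rewrite linear_sum [RHS](gcomp_sum G); apply: eq_bigr => d _ /=; rewrite free_extend_basis.
Qed.

Definition dual_coords : {linear P -> freemod k I} := sval (cid dual_basis_exists).

Lemma dual_coordsK p : free_extend (fun i : I => gcomp G i.1 i.2) (dual_coords p) = p.
Proof. by rewrite /dual_coords; case: cid. Qed.

Variables (M N : lmodType k) (GM : grading M (int * int)%type).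
Variables (q : {linear M -> N}) (c : int * int).

(** A homogeneous preimage is required, and chosen, at each combination of basis
    elements; this makes the lift homogeneous. *)
Definition liftable D y := exists2 z, GM (D + c) z & q z = y.
Definition homog_section D y : M := if pselect (liftable D y) is left h then s2val (cid2 h) else 0.

Lemma homog_sectionP D y : liftable D y -> GM (D + c) (homog_section D y) /\ q (homog_section D y) = y.
Proof. by rewrite /homog_section; case: pselect => // h _; case: cid2. Qed.

(** Expands the arguments one after the other in the dual basis, keeping in degree a
    only the basis elements of degree a, and lifts the values of E on basis elements. *)
Fixpoint graded_lift xs (E : seq P -> N) (D : int * int) : M :=
  if xs is x :: xs' then
    gsum G (fun a xa => free_extend (fun i : I =>
      if i.1 == a then graded_lift xs' (fun ys => E (gcomp G a i.2 :: ys)) (D + a) else 0)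
      (dual_coords xa)) x
  else homog_section D (E [::]).

Lemma graded_lift_linear a x y u w E D :
  graded_lift (u ++ (a *: x + y) :: w) E D = a *: graded_lift (u ++ x :: w) E D + graded_lift (u ++ y :: w) E D.
Proof.
elim: u E D => [|z u IH] E D /=.
  by apply: gsum_linear => d b x' y'; rewrite !linearP.
rewrite /gsum scaler_sumr -big_split; apply: eq_bigr => d _ /=.
apply: free_extendP => i; case: eqP => _; last by rewrite scaler0 addr0.
exact: IH.
Qed.

Lemma graded_liftK xs E D : multilinear E ->
  (forall ds ys, size ys = size xs -> List.Forall2 G ds ys -> liftable (\sum_(d <- ds) d + D) (E ys)) ->
  q (graded_lift xs E D) = E xs.
Proof.
elim: xs E D => [|x xs IH] E D El h /=.
  have := h [::] [::] erefl (List.Forall2_nil _); rewrite big_nil add0r.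
  by case/homog_sectionP.
have -> : E (x :: xs) = \sum_(a <- gsupp G x) E (gcomp G a x :: xs).
  by rewrite {1}[x](gcomp_sum G); exact: (mlin_sum El [::]).
rewrite /gsum linear_sum; apply: eq_bigr => a _ /=.
rewrite free_extend_morph.
have hx := gcomp_homog G a x.
have e1 : gcomp G a x = free_extend (fun i : I => if i.1 == a then gcomp G a i.2 else 0) (dual_coords (gcomp G a x)).
  rewrite -{1}[gcomp G a x](gcomp_homogE hx) -{1}[gcomp G a x]dual_coordsK {1}/free_extend gcomp_big.
  apply: eq_bigr => i _; rewrite gcompZ; congr (_ *: _).
  have hi := gcomp_homog G i.1 i.2.
  case: eqP => [<-|/eqP ne]; first exact: gcomp_homogE.
  by apply: (gcomp_homog0 hi); rewrite eq_sym.
rewrite [X in E (X :: _)]e1; symmetry; apply: etrans (mlin_sum El [::] xs _ _) _.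
apply: eq_bigr => i _; apply: etrans (mlinZ El [::] xs _ _) _; congr (_ *: _); symmetry.
rewrite /=; case: eqP => [_|_]; last by rewrite linear0 (mlin0 El [::]).
apply: IH; first exact: multilinear_cons.
move=> ds ys sy hys; have := h (a :: ds) (gcomp G a i.2 :: ys); rewrite /= sy => /(_ erefl).
rewrite big_cons [D + a]addrC addrA [\sum_(_ <- ds) _ + _]addrC; apply.
by constructor => //; apply: gcomp_homog.
Qed.

Lemma graded_lift_homog ds xs E D : List.Forall2 G ds xs ->
  (forall es ys, size ys = size xs -> List.Forall2 G es ys -> liftable (\sum_(d <- es) d + D) (E ys)) ->
  GM (\sum_(d <- ds) d + D + c) (graded_lift xs E D).
Proof.
move=> h; elim: h E D => [|a x ds' xs' hx _ IH] E D h /=.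
  rewrite big_nil add0r; have := h [::] [::] erefl (List.Forall2_nil _); rewrite big_nil add0r.
  by case/homog_sectionP.
rewrite (gsum_homog _ hx); last by move=> d b x' y'; rewrite !linearP.
apply: submod_sum; first exact: homog_submod.
move=> i _; apply: submodZ; first exact: homog_submod.
case: eqP => [_|_]; last by case: (homog_submod GM (\sum_(d <- a :: ds') d + D + c)).
rewrite big_cons.
have -> : a + \sum_(d <- ds') d + D = \sum_(d <- ds') d + (D + a).
  by rewrite [a + _]addrC -addrA [a + D]addrC.
apply: IH.
move=> es ys sy hys; have := h (a :: es) (gcomp G a i.2 :: ys); rewrite /= sy => /(_ erefl).
rewrite big_cons [D + a]addrC addrA [\sum_(_ <- es) _ + _]addrC; apply.
by constructor => //; apply: gcomp_homog.
Qed.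

End ProjectiveLift.

(** * Splitting off the unit of a projective algebra *)

Section UnitFunctional.
Variables (k : comPzRingType) (n : nat) (v : 'I_n -> k).

Definition spanned x := exists a : 'I_n -> k, x = \sum_l a l * v l.

Lemma spannedD x y : spanned x -> spanned y -> spanned (x + y).
Proof.
move=> [a ->] [b ->]; exists (fun l => a l + b l).
by rewrite -big_split; apply: eq_bigr => l _; rewrite mulrDl.
Qed.

Lemma spannedM c x : spanned x -> spanned (c * x).
Proof.
by move=> [a ->]; exists (fun l => c * a l); rewrite mulr_sumr; apply: eq_bigr => l _; rewrite mulrA.
Qed.

Lemma spanned0 : spanned 0.
Proof. by exists (fun=> 0); rewrite big1 // => l _; rewrite mul0r. Qed.

Lemma spanned_sum (J : Type) (r : seq J) (Q : pred J) (F : J -> k) :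
  (forall j, Q j -> spanned (F j)) -> spanned (\sum_(j <- r | Q j) F j).
Proof. by move=> h; elim/big_rec: _ => [|j x /h hj hx]; [exact: spanned0|exact: spannedD]. Qed.

Lemma spanned_gen l : spanned (v l).
Proof.
exists (fun j => (j == l)%:R); rewrite (bigD1 l) //= eqxx mul1r big1 ?addr0 // => j /negPf ->.
by rewrite mul0r.
Qed.

Lemma spanned_prod (J : Type) (r : seq J) (F F' : J -> k) :
  (forall j, spanned (F j - F' j)) -> spanned (\prod_(j <- r) F j - \prod_(j <- r) F' j).
Proof.
move=> h; elim: r => [|j r IH]; first by rewrite !big_nil subrr; apply: spanned0.
rewrite !big_cons.
have -> : F j * \prod_(j <- r) F j - F' j * \prod_(j <- r) F' j =
  F j * (\prod_(j <- r) F j - \prod_(j <- r) F' j) + \prod_(j <- r) F' j * (F j - F' j).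
  by rewrite !mulrBr [_ * F j]mulrC addrA subrK [_ * F' j]mulrC.
by apply: spannedD; apply: spannedM.
Qed.

Lemma spanned_det m (A A' : 'M[k]_m) :
  (forall i j, spanned (A i j - A' i j)) -> spanned (\det A - \det A').
Proof.
move=> h; rewrite /determinant -sumrB; apply: spanned_sum => p _.
by rewrite -mulrBr; apply: spannedM; apply: spanned_prod.
Qed.

(** The determinant trick: the determinant of 1 - M annihilates v and is congruent to 1
    modulo the ideal generated by v. *)
Lemma nakayama (M : 'M[k]_n) : (forall i j, spanned (M i j)) ->
  (forall l, v l = \sum_i M l i * v i) ->
  exists a : 'I_n -> k, forall l, (1 - \sum_j a j * v j) * v l = 0.
Proof.
move=> hM hv; pose A : 'M[k]_n := 1%:M - M.
have [a ha] : spanned (1 - \det A).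
  rewrite -(det1 k n); apply: spanned_det => i j.
  by rewrite /A !mxE opprB addrC subrK; apply: hM.
exists a => l; rewrite -ha opprB addrC subrK.
pose V : 'cV[k]_n := \col_i v i.
have AV : A *m V = 0.
  apply/matrixP => i j; rewrite mulmxBl mul1mx !mxE [X in _ - X](_ : _ = v i) ?subrr //.
  by rewrite [RHS]hv; apply: eq_bigr => u _; rewrite !mxE.
have : (\adj A *m A) *m V = 0 by rewrite -mulmxA AV mulmx0.
rewrite mul_adj_mx mul_scalar_mx => /matrixP /(_ l ord0); rewrite !mxE => h.
exact: h.
Qed.

End UnitFunctional.

Section UnitSplit.
Variables (k : comPzRingType) (P : lmodType k) (G : grading P (int * int)%type).
Hypothesis Pproj : projective P.
Variables (mu : seq P -> P) (e : P).
Hypotheses (mul : multilinear mu) (mue : forall x, mu [:: x; e] = x).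

(** Let v_l be the coordinates of e in a dual basis. Expanding both factors of
    e = e e gives v = M v with M over the ideal spanned by v, so by nakayama some
    combination lam of the coordinates satisfies (1 - lam e) v = 0. *)
Lemma unit_functional : exists lam : P -> k,
  (forall a x y, lam (a *: x + y) = a * lam x + lam y) /\ lam e *: e = e.
Proof.
set h := dual_coords G Pproj; pose s := fsupp (h e); pose n := size s.
pose x0 : (int * int) * P := ((0, 0), 0).
pose E (i : 'I_n) : P := gcomp G (nth x0 s i).1 (nth x0 s i).2.
pose c (i : 'I_n) (x : P) : k := fcoef (h x) (nth x0 s i).
have cl i a x y : c i (a *: x + y) = a * c i x + c i y by rewrite /c linearP.
have c_sum l (r : seq 'I_n) (f : 'I_n -> k) (g : 'I_n -> P) :
    c l (\sum_(i <- r) f i *: g i) = \sum_(i <- r) f i * c l (g i).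
  elim: r => [|i r IH].
    by rewrite !big_nil; have := cl l (-1) 0 0; rewrite scaler0 addr0 mulN1r addNr.
  by rewrite !big_cons cl IH.
have eE : e = \sum_i c i e *: E i.
  by rewrite -{1}(dual_coordsK G Pproj e) /free_extend (big_nth x0) big_mkord.
pose v i := c i e.
pose M : 'M[k]_n := \matrix_(l, i) \sum_j v j * c l (mu [:: E j; E i]).
have [||a ha] := @nakayama k n v M.
- move=> l i; rewrite mxE; apply: spanned_sum => j _; rewrite mulrC.
  by apply: spannedM; apply: spanned_gen.
- move=> l; have Ej j : E j = \sum_i v i *: mu [:: E j; E i].
    rewrite -{1}[E j]mue {1}eE.
    apply: etrans (mlin_sum mul [:: E j] [::] _ _) _.
    by apply: eq_bigr => i _; apply: (mlinZ mul [:: E j] [::]).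
  rewrite {1}/v eE c_sum.
  under eq_bigr => j _ do rewrite Ej c_sum mulr_sumr.
  rewrite exchange_big; apply: eq_bigr => i _ /=.
  rewrite mxE mulr_suml; apply: eq_bigr => j _.
  by rewrite -/(v j) mulrCA mulrC -mulrA [c l _ * _]mulrC !mulrA.
exists (fun x => \sum_j a j * c j x); split=> [b x y|].
  rewrite mulr_sumr -big_split; apply: eq_bigr => j _ /=.
  by rewrite cl mulrDr mulrCA.
apply/esym/eqP; rewrite -subr_eq0 -{1}[e]scale1r -scalerBl {2}eE scaler_sumr.
apply/eqP; rewrite big1 // => i _; rewrite scalerA.
by rewrite -[c i e]/(v i) ha scale0r.
Qed.

(** Composing lam with the projection to degree (0, 0) makes pi homogeneous. *)
Lemma unit_projector : G (0, 0) e -> exists pi : {linear P -> P},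
  [/\ pi e = 0, forall d x, G d x -> G d (pi x) &
      forall x, exists a, pi x = x - a *: e].
Proof.
move=> Ge; have [lam [laml lame]] := unit_functional.
pose f x := x - lam (gcomp G (0, 0) x) *: e.
have fl : linear f.
  move=> a x y; rewrite /f gcompD gcompZ laml scalerDl scalerBr opprD addrACA.
  by rewrite scalerA.
pose fH := GRing.isLinear.Build k P P *:%R f fl.
pose pi : {linear P -> P} := HB.pack f fH.
exists pi; split=> [|d x hx|x]; last by exists (lam (gcomp G (0, 0) x)).
  by rewrite /pi /= /f (gcomp_homogE Ge) lame subrr.
rewrite /= /f; case: (eqVneq d (0, 0)) => [dE|d0].
  by apply: submodB => //; [exact: homog_submod|apply: submodZ; [exact: homog_submod|rewrite dE]].
rewrite (gcomp_homog0 hx) 1?eq_sym //.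
have -> : lam 0 = 0 by have := laml (-1) 0 0; rewrite scaler0 addr0 mulN1r addNr.
by rewrite scale0r subr0.
Qed.

End UnitSplit.

(** * Solving the equation at one order *)

Lemma gcomp_morph (R : pzRingType) (M N : lmodType R) (I : eqType)
    (G : grading M I) (G' : grading N I) (f : {linear M -> N}) i x :
  (forall i x, G i x -> G' i (f x)) -> gcomp G' i (f x) = f (gcomp G i x).
Proof.
move=> fd; apply: (@gcomp_unique _ _ _ G' (gsupp G x) (fun j => f (gcomp G j x))).
- exact: gsupp_uniq.
- by move=> j; apply/fd/gcomp_homog.
- by move=> j /gcomp_out ->; rewrite linear0.
- by rewrite {1}[x](gcomp_sum G) linear_sum.
Qed.

Section Solve.
Variables (k : comPzRingType) (Hm A : lmodType k).
Variables (GH : grading Hm (int * int)%type) (GA : grading A (int * int)%type).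
Variables (f1 : {linear Hm -> A}) (d : {linear A -> A}) (c : int * int).
Hypothesis f1_deg : forall i x, GH i x -> GA i (f1 x).
Hypothesis d_deg : forall i x, GA i x -> GA (i + c) (d x).
Hypothesis f1_inj : forall x z, f1 x = d z -> x = 0.
Hypothesis f1_surj : forall y, d y = 0 -> exists x z, y = f1 x + d z.
Hypothesis Hproj : projective Hm.
Variables (U : Hm -> Prop) (pi : {linear Hm -> Hm}).
Hypothesis pi_U : forall x, U x -> pi x = 0.
Hypothesis pi_deg : forall i x, GH i x -> GH i (pi x).
Hypothesis piE : forall x, pi x = x \/ exists a e, U e /\ pi x = x - a *: e.

Definition vanishing (N : lmodType k) n (E : seq Hm -> N) :=
  forall xs x, size xs = n -> List.In x xs -> U x -> E xs = 0.

Lemma vanishing_pi (N : lmodType k) n (E : seq Hm -> N) xs : multilinear E ->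
  vanishing n E -> size xs = n -> E (map pi xs) = E xs.
Proof.
move=> El Ev; suff gen u : size (u ++ xs) = n -> E (u ++ map pi xs) = E (u ++ xs).
  exact: (gen [::]).
elim: xs u => //= x xs IH u sz.
rewrite -cat_rcons IH; last by rewrite -sz !size_cat size_rcons /= addSnnS.
rewrite cat_rcons.
have [-> //|[a [e [Ue ->]]]] := piE x.
rewrite mlinB // mlinZ // (Ev (u ++ e :: xs) e) ?scaler0 ?subr0 //.
  by rewrite -sz !size_cat.
by apply: List.in_or_app; right; left.
Qed.

Variables (n : nat) (E : seq Hm -> A) (D : int * int).
Hypothesis El : multilinear E.
Hypothesis Edeg : forall ds xs, size xs = n -> List.Forall2 GH ds xs ->
  GA (\sum_(i <- ds) i + D) (E xs).
Hypothesis Ed : forall xs, size xs = n -> d (E xs) = 0.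
Hypothesis Ev : vanishing n E.

Let pick xs (h : size xs = n) : exists x, exists z, E xs = f1 x + d z := f1_surj (Ed h).

(** Minus the cohomology class of E, transported along f_1; the lists of other sizes
    are sent to 0. *)
Definition solve_op xs : Hm :=
  if eqVneq (size xs) n is EqNotNeq h then - sval (cid (pick h)) else 0.

Lemma solve_opP xs : size xs = n -> exists z, E xs = - f1 (solve_op xs) + d z.
Proof.
move=> sz; rewrite /solve_op; case: eqVneq => [h|/eqP //].
by case: cid => x [z hz] /=; exists z; rewrite linearN opprK.
Qed.

(** Injectivity of f_1 on cohomology. Multilinearity, homogeneity and the vanishing on
    units of solve_op all follow from it. *)
Lemma solve_op_unique xs y z : size xs = n -> E xs = - f1 y + d z -> solve_op xs = y.
Proof.
move=> sz hz; have [w hw] := solve_opP sz.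
apply/eqP; rewrite -subr_eq0; apply/eqP; apply: (@f1_inj _ (w - z)).
rewrite !linearB /=; move: hw; rewrite hz => /(congr1 (+%R (f1 (solve_op xs)))).
by rewrite [in RHS]addrA subrr add0r => <-; rewrite addrA addrK.
Qed.

Lemma solve_op_out xs : size xs != n -> solve_op xs = 0.
Proof. by rewrite /solve_op; case: eqVneq. Qed.

Lemma solve_op_multilinear : multilinear solve_op.
Proof.
move=> a x y u w; have szE z : size (u ++ z :: w) = (size u + size w).+1.
  by rewrite size_cat /= addnS.
have [sz|ne] := eqVneq (size u + size w).+1 n; last first.
  by rewrite !solve_op_out ?szE // scaler0 addr0.
have [z1 h1] := @solve_opP (u ++ x :: w) (etrans (szE x) sz).
have [z2 h2] := @solve_opP (u ++ y :: w) (etrans (szE y) sz).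
apply: (@solve_op_unique _ _ (a *: z1 + z2)); first by rewrite szE.
by rewrite El h1 h2 (linearP f1) (linearP d) scalerDr scalerN opprD addrACA.
Qed.

Lemma solve_op_degree ds xs : size xs = n -> List.Forall2 GH ds xs ->
  GH (\sum_(i <- ds) i + D) (solve_op xs).
Proof.
move=> sz h; have [z hz] := solve_opP sz.
suff -> : solve_op xs = gcomp GH (\sum_(i <- ds) i + D) (solve_op xs) by apply: gcomp_homog.
set i := _ + D; apply: (@solve_op_unique _ _ (gcomp GA (i - c) z)) => //.
have hE := Edeg sz h; rewrite -/i in hE.
rewrite -(gcomp_d d_deg) subrK -{1}(gcomp_homogE hE) hz gcompD; congr (_ + _).
have := gcompZ GA i (-1) (f1 (solve_op xs)); rewrite !scaleN1r => ->; congr (- _).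
exact: gcomp_morph.
Qed.

Lemma solve_op_vanishing : vanishing n solve_op.
Proof.
move=> xs x sz xin Ux; apply: (@solve_op_unique _ _ 0) => //.
by rewrite (Ev sz xin Ux) (linear0 f1) (linear0 d) oppr0 addr0.
Qed.

Let E' xs := E xs + f1 (solve_op xs).

Let E'lin : multilinear E'.
Proof.
move=> a x y u w; rewrite /E' El solve_op_multilinear linearP /=.
by rewrite scalerDr addrACA.
Qed.

Let E'liftable ds ys : size ys = n -> List.Forall2 GH ds ys ->
  liftable GA d (- c) (\sum_(i <- ds) i + D) (E' ys).
Proof.
move=> sz h; set i := _ + D.
have [z hz] := solve_opP sz.
have e : E' ys = d z by rewrite /E' hz addrAC addNr add0r.
exists (gcomp GA (i - c) z); first exact: gcomp_homog.
rewrite -(gcomp_d d_deg) subrK -e gcomp_homogE //.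
apply: submodD; first exact: homog_submod.
  exact: Edeg.
by apply/f1_deg/solve_op_degree.
Qed.

(** Projecting the arguments along pi makes the lift vanish on units. *)
Definition solve_htp xs : A := graded_lift GH Hproj GA d (- c) (map pi xs) E' D.

Lemma solve_htp_multilinear : multilinear solve_htp.
Proof.
by move=> a x y u w; rewrite /solve_htp !map_cat /= linearP graded_lift_linear.
Qed.

Lemma solve_htpP xs : size xs = n -> E xs = d (solve_htp xs) - f1 (solve_op xs).
Proof.
move=> sz; rewrite /solve_htp graded_liftK //; last first.
  by move=> ds ys; rewrite size_map sz => sy; apply: E'liftable.
rewrite (vanishing_pi E'lin _ sz); first by rewrite /E' addrK.
by move=> ys y sy yin Uy; rewrite /E' (Ev sy yin Uy) (solve_op_vanishing sy yin Uy) linear0 addr0.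
Qed.

Lemma solve_htp_degree ds xs : size xs = n -> List.Forall2 GH ds xs ->
  GA (\sum_(i <- ds) i + D - c) (solve_htp xs).
Proof.
move=> sz h; apply: graded_lift_homog; first by rewrite -[ds]map_id; apply: Forall2_map2 h.
by move=> es ys; rewrite size_map sz => sy; apply: E'liftable.
Qed.

Lemma solve_htp_vanishing : vanishing n solve_htp.
Proof.
move=> xs x sz xin Ux; have [u [w xE]] := List.in_split _ _ xin.
rewrite xE /solve_htp.
have -> : map pi (u ++ x :: w) = map pi u ++ 0 :: map pi w.
  by rewrite map_cat /= (pi_U Ux).
apply: (mlin0 (F := fun ys => graded_lift GH Hproj GA d (- c) ys E' D)) => a y z p q.
exact: graded_lift_linear.
Qed.

Lemma solve_exists : exists (op : seq Hm -> Hm) (htp : seq Hm -> A),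
  [/\ multilinear op /\ multilinear htp,
      forall ds xs, size xs = n -> List.Forall2 GH ds xs ->
        GH (\sum_(i <- ds) i + D) (op xs) /\ GA (\sum_(i <- ds) i + D - c) (htp xs),
      vanishing n op /\ vanishing n htp
    & forall xs, size xs = n -> E xs = d (htp xs) - f1 (op xs)].
Proof.
exists solve_op, solve_htp; split; [split|move=> ds xs sz h; split|split|].
- exact: solve_op_multilinear.
- exact: solve_htp_multilinear.
- exact: solve_op_degree.
- exact: solve_htp_degree.
- exact: solve_op_vanishing.
- exact: solve_htp_vanishing.
- exact: solve_htpP.
Qed.

End Solve.

(** * Bidegrees of insertions and compositions *)

Section Degrees.
Variables (k : comPzRingType) (s : nat).

Definition bdeg : int * int := (s%:Z, 1 - s%:Z).

(** In this form identities between bidegrees are linear in the sizes of the lists. *)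
Lemma bideg_opE n : bideg_op s n = bdeg + bdeg - bdeg *+ n.
Proof.
elim: n => [|n IH].
  by rewrite /bideg_op mulr0n subr0; congr (_, _); rewrite /=; lia.
rewrite [bdeg *+ _]mulrS opprD [- _ + _]addrC addrA -IH /bideg_op /bdeg.
have -> : n.+1%:Z = n%:Z + 1 by lia.
by congr (_, _); rewrite /= opprD addrA mulrDl mulN1r.
Qed.

Lemma bideg_morE n : bideg_mor s n = bdeg - bdeg *+ n.
Proof.
have -> : bideg_mor s n = bideg_op s n - bdeg.
  by rewrite /bideg_mor /bideg_op /bdeg; congr (_, _); rewrite /=; lia.
by rewrite bideg_opE addrAC addrK.
Qed.

Variables (V W : lmodType k).
Variables (G : grading V (int * int)%type) (G' : grading W (int * int)%type).

Lemma submod_splits (T : Type) (P : W -> Prop) (xs : seq T) (K : seq T -> seq T -> W) : submod P ->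
  (forall u v, u ++ v = xs -> P (K u v)) -> P (\sum_(p <- splits xs) K p.1 p.2).
Proof.
move=> Ps h; rewrite (big_splits_iota xs K); apply: submod_sum => // i _.
by apply: h; rewrite cat_take_drop.
Qed.

Lemma submod_splits3 (T : Type) (P : W -> Prop) (xs : seq T) K : submod P ->
  (forall u v w, u ++ v ++ w = xs -> P (K u v w)) -> P (splits3 xs K).
Proof.
move=> Ps h; apply: (submod_splits (K := fun a c => \sum_(q <- splits c) K a q.1 q.2)) => // u v uv.
by apply: (submod_splits (K := K u)) => // a c ac; apply: h; rewrite ac.
Qed.

Lemma submod_segs (T : Type) (P : W -> Prop) (xs : seq T) K : submod P ->
  (forall bs, flatten bs = xs -> all (fun b => 0 < size b)%N bs -> P (K bs)) ->
  P (\sum_(bs <- segs xs) K bs).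
Proof.
move=> Ps h; rewrite (big_segs_comps K (leqnn _)) big_seq.
apply: submod_sum => // sh; rewrite mem_comps // => /andP[a /eqP b]; apply: h.
  by apply: reshapeKr; rewrite b.
have rK : map size (reshape sh xs) = sh by apply: reshapeKl; rewrite b.
by move: a; rewrite -{1}rK all_map.
Qed.

Lemma Forall2_homog_map (g : V -> V) ds xs : (forall d x, G d x -> G d (g x)) ->
  List.Forall2 G ds xs -> List.Forall2 G ds (map g xs).
Proof. by move=> h hx; rewrite -[ds]map_id; apply: Forall2_map2 hx. Qed.

Lemma bar_insert_degree (sg : V -> V) (B : seq V -> V) (F : seq V -> W) :
  (forall d x, G d x -> G d (sg x)) -> multilinear F -> B [::] = 0 ->
  of_degree G G (bideg_op s) B -> of_degree G G' (bideg_mor s) F ->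
  of_degree G G' (bideg_op s) (bar_insert sg B F).
Proof.
move=> sd Fl B0 Bd Fd ds xs xs0 h; apply: submod_splits3; first exact: homog_submod.
move=> u v w uvw; have [v0|v0] := pselect (v = [::]).
  by rewrite v0 B0 (mlin0 Fl); case: (homog_submod G' (\sum_(d <- ds) d + bideg_op s (size xs))).
rewrite -uvw in h.
have [du [dvw [hu [hvw dE]]]] := List.Forall2_app_inv_r _ _ h.
have [dv [dw [hv [hw dE']]]] := List.Forall2_app_inv_r _ _ hvw.
have := Fd (du ++ (\sum_(d <- dv) d + bideg_op s (size v)) :: dw) (map sg u ++ B v :: w).
rewrite dE dE' -uvw !big_cat big_cons /= !size_cat /= size_map.
have -> : \sum_(d <- du) d + (\sum_(d <- dv) d + bideg_op s (size v) + \sum_(d <- dw) d) +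
    bideg_mor s (size u + (size w).+1)%N =
  \sum_(d <- du) d + (\sum_(d <- dv) d + \sum_(d <- dw) d) + bideg_op s (size u + (size v + size w)).
  rewrite !bideg_opE bideg_morE !mulrnDr mulrS.
  move: (bdeg) (\sum_(d <- du) d) (\sum_(d <- dv) d) (\sum_(d <- dw) d) (bdeg *+ size u)
    (bdeg *+ size v) (bdeg *+ size w) => [t1 t2] [a1 a2] [b1 b2] [c1 c2] [p1 p2] [q1 q2] [r1 r2].
  by congr (_, _); rewrite /=; lia.
apply; first by case: (u).
apply: List.Forall2_app; first exact: Forall2_homog_map.
by constructor => //; apply: Bd.
Qed.

Lemma bar_compose_degree (F : seq V -> W) (b : seq W -> W) :
  of_degree G G' (bideg_mor s) F -> of_degree G' G' (bideg_op s) b ->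
  of_degree G G' (bideg_op s) (bar_compose F b).
Proof.
move=> Fd bd ds xs xs0 h; apply: submod_segs; first exact: homog_submod.
move=> bs fl al.
have [es he hE] : exists2 es, List.Forall2 G' es (map F bs) &
    \sum_(d <- es) d = \sum_(d <- ds) d + bdeg *+ size bs - bdeg *+ size xs.
  rewrite -fl in h *; elim: bs ds al h {fl} => [|b0 bs IH] ds /= => [_ h|/andP[b00 al] h].
    by inversion h; exists [::]; rewrite ?big_nil ?mulr0n ?addr0 ?subr0.
  have [d1 [d2 [h1 [h2 ->]]]] := List.Forall2_app_inv_r _ _ h.
  have [es he hE] := IH _ al h2.
  exists (\sum_(d <- d1) d + bideg_mor s (size b0) :: es).
    by constructor => //; apply: Fd => // b0E; rewrite b0E in b00.
  rewrite big_cons hE bideg_morE big_cat size_cat mulrnDr mulrS /=.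
  move: (bdeg) (\sum_(d <- d1) d) (\sum_(d <- d2) d) (bdeg *+ size b0) (bdeg *+ size bs)
    (bdeg *+ size (flatten bs)) => [t1 t2] [a1 a2] [c1 c2] [p1 p2] [q1 q2] [r1 r2].
  by congr (_, _); rewrite /=; lia.
have := bd es (map F bs); rewrite hE size_map.
have -> : \sum_(d <- ds) d + bdeg *+ size bs - bdeg *+ size xs + bideg_op s (size bs) =
    \sum_(d <- ds) d + bideg_op s (size xs).
  rewrite !bideg_opE.
  move: (bdeg) (\sum_(d <- ds) d) (bdeg *+ size bs) (bdeg *+ size xs) => [q1 q2] [a1 a2] [c1 c2] [p1 p2].
  by congr (_, _); rewrite /=; lia.
apply=> //; case: (bs) fl xs0 => // <- /=; by [].
Qed.

Lemma bar_degree (t : {linear V -> V}) delta (g : seq V -> W) :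
  (forall d x, G d x -> G d (t x)) ->
  of_degree G G' delta g -> of_degree G G' delta (bar t g).
Proof.
move=> td gd ds xs xs0 h; rewrite bar_nonempty // -(size_twist t xs).
apply: gd; first by case: (xs) xs0.
elim: h => {ds xs xs0} [|d x ds xs hx h IH] /=; constructor => //.
by elim: (size xs) => //= n; apply: td.
Qed.

Lemma spar_degree d (x : series G) : series_grading G d x -> series_grading G d (spar G x).
Proof. exact: bpar_degree. Qed.

Lemma susp_sign_degree (t : {linear V -> V}) : (forall d x, G d x -> G d (t x)) ->
  forall d x, G d x -> G d (susp_sign t x).
Proof.
move=> td d x hx; rewrite /susp_sign -scaleN1r; apply: submodZ; first exact: homog_submod.
exact: td.
Qed.

End Degrees.

(** * Liftings of the operations of H and of the morphism f *)

Definition vpar (k : comPzRingType) (V : lmodType k) (G : grading V (int * int)%type) :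
  {linear V -> V} := bpar G.

Section Context.
Variables (k : comPzRingType) (s : nat) (V M : lmodType k).
Variables (GH : grading V (int * int)%type) (GA : grading M (int * int)%type).
Variables (H : bainf s GH) (A : bainf s GA) (Ah : deformation A) (f : bmor H A).
Hypothesis H1 : forall c, bop H [:: c] = 0.

Local Notation X := (series GH).
Local Notation Y := (series GA).
Local Notation hX := (@hmul k V GH).
Local Notation hY := (@hmul k M GA).
Local Notation sX := (susp_sign (spar GH)).
Local Notation sY := (susp_sign (spar GA)).

Definition bar_dop : seq Y -> Y := bar (spar GA) (dop Ah).
Definition bar_bop : seq V -> V := bar (vpar GH) (bop H).
Definition bar_bfun : seq V -> M := bar (vpar GH) (bfun f).
Definition isunit (x : V) := bunit H = Some x.

Lemma bar_dop_hmlin : hmlin hY hY bar_dop.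
Proof. exact: bar_series_hmlin (dop_hmultilinear Ah). Qed.

Lemma bar_dop_nil : bar_dop [::] = 0.
Proof. by []. Qed.

Lemma bar_dop_flat ys : bar_insert sY bar_dop bar_dop ys = 0.
Proof. exact: (Ainf_ins_bar (dop_hmultilinear Ah) (dop_bidegree Ah) (dop_ainf Ah)). Qed.

Lemma bar_dop_degree : of_degree (series_grading GA) (series_grading GA) (bideg_op s) bar_dop.
Proof. exact: (bar_degree (@spar_degree _ _ GA) (dop_bidegree Ah)). Qed.

Lemma map_at0_twist (W : lmodType k) (G : grading W (int * int)%type) (ys : seq (series G)) :
  map (fun y : series G => y 0%N) (twist (spar G) ys) = twist (vpar G) (map (fun y : series G => y 0%N) ys).
Proof.
elim: ys => //= y ys ->; congr (_ :: _); rewrite size_map.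
by elim: (size ys) => //= n <-; rewrite /= bpar_coef.
Qed.

Lemma bar_dop_at0 ys : bar_dop ys 0%N = bar (vpar GA) (bop A) (map (fun y : Y => y 0%N) ys).
Proof.
case: ys => [//|y ys]; rewrite /bar_dop bar_nonempty // bar_nonempty // -map_at0_twist.
exact: (dop_mod_h Ah).
Qed.

Lemma bar_dop1_at0 y : bar_dop [:: y] 0%N = bdiff A (y 0%N).
Proof. by rewrite bar_dop_at0. Qed.

Lemma bar_bop_multilinear : multilinear bar_bop.
Proof. exact: bar_multilinear (Ainf_multilinear (bop_ainf H)). Qed.

Lemma bar_bfun_multilinear : multilinear bar_bfun.
Proof. exact: bar_multilinear (Ainf_mor_multilinear (bfun_ainf f)). Qed.

Lemma vpar_degree (W : lmodType k) (G : grading W (int * int)%type) d x : G d x -> G d (vpar G x).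
Proof. exact: bpar_degree. Qed.

Lemma bar_bop_degree : of_degree GH GH (bideg_op s) bar_bop.
Proof. exact: bar_degree (@vpar_degree _ GH) (bop_bidegree H). Qed.

Lemma bar_bfun_degree : of_degree GH GA (bideg_mor s) bar_bfun.
Proof. exact: bar_degree (@vpar_degree _ GH) (bfun_bidegree f). Qed.

Lemma op_vpar (W : lmodType k) (G : grading W (int * int)%type) (m : bainf s G) v :
  v <> [::] -> bop m (map (vpar G) v) = signb (odd (size v)) (vpar G (bop m v)).
Proof.
move=> v0; rewrite /vpar (mlin_bpar (Ainf_multilinear (bop_ainf m)) (bop_bidegree m) v0).
by rewrite parity_bideg_op.
Qed.

Lemma mor_vpar v :
  v <> [::] -> bfun f (map (vpar GH) v) = signb (~~ odd (size v)) (vpar GA (bfun f v)).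
Proof.
move=> v0; rewrite /vpar (mlin_bpar (Ainf_mor_multilinear (bfun_ainf f)) (bfun_bidegree f) v0).
by rewrite parity_bideg_mor.
Qed.

(** The A-infinity relations are only given on homogeneous arguments; multilinearity
    extends them to all of them. *)
Lemma bar_relation vs :
  bar_insert (susp_sign (vpar GH)) bar_bop bar_bfun vs = bar_compose bar_bfun (bar (vpar GA) (bop A)) vs.
Proof.
have opl := bar_bop_multilinear; have morl := bar_bfun_multilinear.
have bl : multilinear (bar (vpar GA) (bop A)) by apply: bar_multilinear (Ainf_multilinear (bop_ainf A)).
case: vs => [|v vs].
  rewrite /bar_insert /splits3 !big_splits_nil /bar_compose segs_nil /=.
  exact: (mlin0 morl [::] [::]).
apply: (@mlin_eq _ _ _ _ GH).
- apply: (@hmlin_multilinear _ _ _ \0 \0); apply: (hmlin_bar_insert (hX := \0) (hZ := \0)).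
  + by move=> x; rewrite /= linear0.
  + exact: multilinear_hmlin.
  + exact: multilinear_hmlin.
- apply: (@hmlin_multilinear _ _ _ \0 \0); apply: (hmlin_bar_compose (hX := \0) (hY := \0) (hZ := \0)).
  + exact: multilinear_hmlin.
  + exact: multilinear_hmlin.
move=> ds [|y ys] // _ h; have y0 : y :: ys <> [::] by [].
have ht : List.Forall2 (tot GH) (map (fun d => d.1 + d.2) ds) (y :: ys).
  rewrite -[y :: ys]map_id; apply: Forall2_map2 h => d x; exact: homog_tot.
have he : List.Forall2 (eigen (vpar GH)) (map (fun d => d.1 + d.2) ds) (y :: ys).
  rewrite -[X in List.Forall2 _ X _]map_id -[y :: ys]map_id; apply: Forall2_map2 ht => d x; exact: bpar_tot.
have := Ainf_mor_relation (bfun_ainf f) y0 ht.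
rewrite (insertions_bar (Ainf_multilinear (bop_ainf H)) (Ainf_mor_multilinear (bfun_ainf f)) (@op_vpar _ _ H) y0 he).
rewrite (compositions_bar (Ainf_mor_multilinear (bfun_ainf f)) (Ainf_multilinear (bop_ainf A)) mor_vpar y0 he).
by move/(congr1 (signb (eps [seq d.1 + d.2 | d <- ds]))); rewrite !signbK addbb.
Qed.

(** Candidates for the coefficients of the operations of H_h and of the lift of f, in
    bar form. *)
Record lifting (beta : nat -> seq V -> V) (phi : nat -> seq V -> M) : Prop := Lifting {
  lifting_op : family GH GH (bideg_op s) beta;
  lifting_mor : family GH GA (bideg_mor s) phi;
  lifting_op0 : forall xs, beta 0%N xs = bar_bop xs;
  lifting_mor0 : forall xs, phi 0%N xs = bar_bfun xs;
  lifting_unit : forall r xs x, (0 < r)%N -> List.In x xs -> isunit x -> beta r xs = 0 /\ phi r xs = 0 }.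

Section Lifting.
Variables (beta : nat -> seq V -> V) (phi : nat -> seq V -> M).
Hypothesis lift_bp : lifting beta phi.
Local Notation B := (@extend k V V GH GH beta).
Local Notation F := (@extend k V M GH GA phi).

Lemma lifting_op_hmlin : hmlin hX hX B. Proof. exact: extend_hmlin (lifting_op lift_bp). Qed.
Lemma lifting_mor_hmlin : hmlin hX hY F. Proof. exact: extend_hmlin (lifting_mor lift_bp). Qed.
Lemma lifting_op_nil : B [::] = 0. Proof. exact: extend_nil (lifting_op lift_bp). Qed.
Lemma lifting_mor_nil : F [::] = 0. Proof. exact: extend_nil (lifting_mor lift_bp). Qed.

Lemma lifting_op_arity1 x : hord 1 (B [:: x]).
Proof.
by case=> // _; rewrite (extend_at0 (lifting_op lift_bp)) (lifting_op0 lift_bp) /bar_bop bar_nonempty //= H1.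
Qed.

Lemma lifting_mor_arity1 z : F [:: z] 0%N = bfun f [:: z 0%N].
Proof. by rewrite (extend_at0 (lifting_mor lift_bp)) (lifting_mor0 lift_bp). Qed.

Lemma lifting_op_susp_sign v : B (map sX v) = - sX (B v).
Proof.
have [-> /=|v0] := pselect (v = [::]).
  by rewrite lifting_op_nil /susp_sign linear0 !oppr0.
have Bm := extend_hmultilinear (lifting_op lift_bp).
rewrite mlin_susp_sign; last exact: Bm.1.
by rewrite (op_spar Bm (extend_degree (lifting_op lift_bp)) v0) signbK addbb /susp_sign opprK.
Qed.

Lemma lifting_mor_susp_sign v : F (map sX v) = sY (F v).
Proof.
have [-> /=|v0] := pselect (v = [::]).
  by rewrite lifting_mor_nil /susp_sign linear0 oppr0.
have Fm := extend_hmultilinear (lifting_mor lift_bp).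
rewrite mlin_susp_sign; last exact: Fm.1.
rewrite (mor_spar Fm (extend_degree (lifting_mor lift_bp)) v0) signbK /susp_sign.
by rewrite addbN addbb.
Qed.

(** Modulo h the defect vanishes because f is a morphism. *)
Lemma defect_at0 xs : defect B F bar_dop xs 0%N = 0.
Proof.
pose at0 (W : lmodType k) (G : grading W (int * int)%type) (y : series G) := y 0%N.
have E1 : bar_insert sX B F xs 0%N = bar_insert (susp_sign (vpar GH)) bar_bop bar_bfun (map (@at0 V GH) xs).
  rewrite /bar_insert splits3_coef splits3_map; apply: eq_splits3 => u v w _.
  rewrite (extend_at0 (lifting_mor lift_bp)) (lifting_mor0 lift_bp) map_cat /=.
  rewrite -(lifting_op0 lift_bp) (extend_at0 (lifting_op lift_bp)); congr (bar_bfun (_ ++ _)).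
  by rewrite -!map_comp; apply: eq_map => x;
    rewrite -[LHS]/(- (bpar (series_grading GH) x 0%N)) bpar_coef.
have E2 : bar_compose F bar_dop xs 0%N = bar_compose bar_bfun (bar (vpar GA) (bop A)) (map (@at0 V GH) xs).
  rewrite /bar_compose coef_sum segs_map; apply: eq_bigr => bs _.
  rewrite bar_dop_at0 -!map_comp; congr (bar _ _ _); apply: eq_map => v /=.
  by rewrite (extend_at0 (lifting_mor lift_bp)) (lifting_mor0 lift_bp).
by rewrite /defect coefB E1 E2 bar_relation subrr.
Qed.

Lemma defect_degree :
  of_degree (series_grading GH) (series_grading GA) (bideg_op s) (defect B F bar_dop).
Proof.
move=> ds xs xs0 h; rewrite /defect.
apply: (submodB (homog_submod (series_grading GA) (\sum_(d <- ds) d + bideg_op s (size xs)))).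
  apply: (@bar_insert_degree _ s _ _ (series_grading GH) (series_grading GA) sX B F _ _ _ _ _ ds xs xs0 h); last exact: extend_degree (lifting_mor lift_bp).
  - exact: (susp_sign_degree (@spar_degree _ _ GH)).
  - exact: hmlin_multilinear lifting_mor_hmlin.
  - exact: lifting_op_nil.
  - exact: extend_degree (lifting_op lift_bp).
apply: (@bar_compose_degree _ s _ _ (series_grading GH) (series_grading GA) F bar_dop _ _ ds xs xs0 h); first exact: extend_degree (lifting_mor lift_bp).
exact: bar_dop_degree.
Qed.

End Lifting.
End Context.

(** * Liftings and units *)

Lemma list_InP (T : eqType) (x : T) s : reflect (List.In x s) (x \in s).
Proof.
apply: (iffP idP); elim: s => //= y s IH; rewrite inE.
  by move=> /orP[/eqP ->|/IH]; [left|right].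
by move=> [->|/IH ->]; rewrite ?eqxx ?orbT.
Qed.

Lemma In_twist (k : comPzRingType) (X : lmodType k) (t : X -> X) e vs :
  t e = e -> List.In e vs -> List.In e (twist t vs).
Proof.
move=> te; elim: vs => //= v vs IH [->|/IH]; [left|by right].
by elim: (size vs) => //= n ->.
Qed.

Section Units.
Variables (k : comPzRingType) (s : nat) (V M : lmodType k).
Variables (GH : grading V (int * int)%type) (GA : grading M (int * int)%type).
Variables (H : bainf s GH) (A : bainf s GA) (Ah : deformation A) (f : bmor H A).
Variables (beta : nat -> seq V -> V) (phi : nat -> seq V -> M).
Hypothesis lift_bp : lifting f beta phi.
Local Notation X := (series GH).
Local Notation Y := (series GA).
Local Notation B := (@extend k V V GH GH beta).
Local Notation F := (@extend k V M GH GA phi).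
Local Notation sX := (susp_sign (spar GH)).
Local Notation sY := (susp_sign (spar GA)).

Lemma spar_cst (W : lmodType k) (G : grading W (int * int)%type) e :
  G (0, 0) e -> spar G (cst G e) = cst G e.
Proof.
move=> Ge; have h : series_grading G (0, 0) (cst G e) by apply: cst_homog.
by rewrite -[LHS]/(bpar _ _) (bpar_homog h).
Qed.

Lemma vpar_unit (W : lmodType k) (G : grading W (int * int)%type) e :
  G (0, 0) e -> vpar G e = e.
Proof. by move=> Ge; rewrite -[LHS]/(bpar _ _) (bpar_homog Ge). Qed.

(** Unitality of all the reductions is unitality on power series. *)
Lemma dop_unit (W : lmodType k) (G : grading W (int * int)%type) (C : bainf s G)
    (D : deformation C) e : bunit C = Some e ->
  [/\ forall y, dop D [:: cst G e; y] = y, forall y, dop D [:: y; cst G e] = y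
    & forall v, cst G e \in v -> size v != 2%N -> dop D v = 0].
Proof.
move=> ue; have hu N : strict_unit (trunc_grading (tot G) N) (reduction (N := N) (dop D)) (trunc_const N e).
  by have := dop_unitary D N; rewrite ue.
have tc N : trunc N (cst G e) = trunc_const N e by rewrite -(trunc_lift_const G N) trunc_liftK.
have hd := dop_hmultilinear D.
have eqS (y z : series G) : (forall N, trunc N y = trunc N z) -> y = z.
  move=> h; apply/eqP; rewrite -subr_eq0; apply/eqP; apply: hord_all => R.
  apply: (@hord_le _ _ _ _ R.+1) => //; apply/trunc_eq0.
  by rewrite truncD truncN h subrr.
split=> [y|y|v ev sv]; apply: eqS => N; rewrite (reductionE _ _ hd) /= ?tc.
- exact: strict_unitl (hu N) _.
- exact: strict_unitr (hu N) _.
rewrite (strict_unit_vanish (hu N)) ?size_map //.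
by rewrite -tc; apply: map_f.
Qed.

Variable e : V.
Hypothesis ue : isunit H e.

Lemma unit_homog : GH (0, 0) e.
Proof. by have := bunit_bidegree H; rewrite ue. Qed.

Lemma unit_strict : strict_unit (tot GH) (bop H) e.
Proof. by have := bunit_unitary H; rewrite ue. Qed.

Lemma unit_image : exists2 e', bunit A = Some e' & bfun f [:: e] = e' /\
  forall xs, e \in xs -> (2 <= size xs)%N -> bfun f xs = 0.
Proof.
have := bfun_unitary f; rewrite /unitary_mor ue.
by case: (bunit A) => // e' h; exists e'.
Qed.

(** Arity two is excluded because of the product with the unit at order 0. *)
Lemma beta_unit r ys : size ys != 2%N -> List.In e ys -> beta r ys = 0.
Proof.
move=> sz ye; case: r => [|r]; last by case: (lifting_unit lift_bp (r := r.+1) _ ye ue).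
rewrite (lifting_op0 lift_bp) /bar_bop; case: ys ye sz => // y ys ye sz.
rewrite bar_nonempty // (strict_unit_vanish unit_strict) ?size_twist //.
by apply/list_InP; apply: In_twist => //; apply: vpar_unit; apply: unit_homog.
Qed.

Lemma phi_unit r ys : (2 <= size ys)%N -> List.In e ys -> phi r ys = 0.
Proof.
move=> sz ye; case: r => [|r]; last by case: (lifting_unit lift_bp (r := r.+1) _ ye ue).
have [e' _ [_ h]] := unit_image.
rewrite (lifting_mor0 lift_bp) /bar_bfun; case: ys ye sz => // y ys ye sz.
rewrite bar_nonempty // h ?size_twist //.
by apply/list_InP; apply: In_twist => //; apply: vpar_unit; apply: unit_homog.
Qed.

Lemma B_unitl x : B [:: cst GH e; x] = x.
Proof.
apply: series_ext => R; rewrite (extend_coefE (lifting_op lift_bp)) /=.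
rewrite big_ord_recl [X in _ + X]big1 ?addr0 => [|i _]; last first.
  rewrite big1 // => j _; rewrite cst_coef /=.
  exact: (mlin0 (fam_lin (lifting_op lift_bp) _) [::]).
rewrite subn0 big_ord_recr /= big1 ?add0r => [|i _].
  rewrite subnn cst_coef /= (lifting_op0 lift_bp) /bar_bop bar_nonempty //=.
  by rewrite -[bpar _ _]/(vpar _ _) (vpar_unit unit_homog) (strict_unitl unit_strict).
rewrite cst_coef /=; have lt : (0 < R - i)%N by rewrite subn_gt0.
by case: (lifting_unit lift_bp lt (xs := [:: e; x i]) (x := e)) => //; left.
Qed.

Lemma B_unitr x : B [:: x; cst GH e] = - sX x.
Proof.
apply: series_ext => R; rewrite (extend_coefE (lifting_op lift_bp)) /=.
under eq_bigr => i _ do (rewrite big_ord_recl big1 ?addr0 /=; [rewrite subn0 | by move=> j _; rewrite cst_coef /=; exact: (mlin0 (fam_lin (lifting_op lift_bp) _) [:: x i])]).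
rewrite big_ord_recr /= big1 ?add0r => [|i _].
  rewrite subnn cst_coef /= (lifting_op0 lift_bp) /bar_bop bar_nonempty //= (strict_unitr unit_strict).
  rewrite -[RHS]/(- - (bpar (series_grading GH) x R)) opprK bpar_coef.
  by [].
rewrite cst_coef /=; have lt : (0 < R - i)%N by rewrite subn_gt0.
by case: (lifting_unit lift_bp lt (xs := [:: x i; e]) (x := e)) => //; right; left.
Qed.

Lemma F_unit1 e' : bunit A = Some e' -> F [:: cst GH e] = cst GA e'.
Proof.
move=> ue'; apply: series_ext => R; rewrite -[[:: cst GH e]]/(map (cst GH) [:: e]).
rewrite (extend_cst (lifting_mor lift_bp)) cst_coef; case: R => [|R] /=.
  rewrite (lifting_mor0 lift_bp) /bar_bfun bar_nonempty //=.
  by have [e1 ue1 [-> _]] := unit_image; move: ue'; rewrite ue1 => -[].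
by case: (lifting_unit lift_bp (r := R.+1) (xs := [:: e]) (x := e)) => //; left.
Qed.

Lemma defect_on_unit xs : cst GH e \in xs -> defect B F (bar_dop Ah) xs = 0.
Proof.
move=> xe; have [e' ue' [_ _]] := unit_image.
have Ge' : GA (0, 0) e' by have := bunit_bidegree A; rewrite ue'.
have [dl dr dv] := dop_unit Ah ue'.
rewrite /defect (@defect_unit _ _ _ sX sY B F (bar_dop Ah) (cst GH e) (cst GA e')) ?subrr //.
- exact: hmlin_multilinear (lifting_mor_hmlin lift_bp).
- exact: hmlin_multilinear (bar_dop_hmlin Ah).
- exact: (lifting_mor_susp_sign lift_bp).
- by rewrite /= /susp_sign (spar_cst unit_homog).
- exact: B_unitl.
- exact: B_unitr.
- move=> v ev sv; apply: (extend_unit (lifting_op lift_bp) (n := size v) (e := e)) => //.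
    by move=> r ys sy; apply: beta_unit; rewrite sy.
  exact/list_InP.
- by move=> y; rewrite /bar_dop bar_nonempty //= -[bpar _ _]/(spar _ _) (spar_cst Ge') dl.
- move=> y; rewrite /bar_dop bar_nonempty //= dr.
  by rewrite /susp_sign opprK.
- move=> v ev sv; rewrite /bar_dop; case: v ev sv => // y v ev sv; rewrite bar_nonempty //.
  rewrite dv ?size_twist //; apply/list_InP; apply: In_twist; first exact: spar_cst.
  exact/list_InP.
- exact: F_unit1.
- move=> v ev sv; apply: (extend_unit (lifting_mor lift_bp) (n := size v) (e := e)) => //.
    by move=> r ys sy; apply: phi_unit; rewrite sy.
  exact/list_InP.
Qed.

End Units.

(** * Killing the defect one weight at a time *)

Section Construction.
Variables (k : comPzRingType) (s : nat) (V M : lmodType k).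
Variables (GH : grading V (int * int)%type) (GA : grading M (int * int)%type).
Variables (H : bainf s GH) (A : bainf s GA) (Ah : deformation A) (f : bmor H A).
Hypothesis H1 : forall c, bop H [:: c] = 0.
Hypothesis f_qi : bquasi_iso f.
Local Notation X := (series GH).
Local Notation Y := (series GA).
Local Notation extB beta := (@extend k V V GH GH beta).
Local Notation extF phi := (@extend k V M GH GA phi).
Local Notation Defect beta phi := (defect (extB beta) (extF phi) (bar_dop Ah)).

Definition mor1 (x : V) : M := bfun f [:: x].
Lemma mor1_linear : linear mor1.
Proof. by move=> a x y; apply: (Ainf_mor_multilinear (bfun_ainf f) a x y [::] [::]). Qed.
HB.instance Definition _ := GRing.isLinear.Build k V M *:%R mor1 mor1_linear.

Lemma mor1_degree i x : GH i x -> GA i (mor1 x).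
Proof.
move=> hx; have := @bfun_bidegree _ _ _ _ _ _ _ _ f [:: i] [:: x].
rewrite big_seq1 /bideg_mor /= subrr !mul0r addr0; apply=> //.
by constructor.
Qed.

Lemma mor1_inj x z : mor1 x = bdiff A z -> x = 0.
Proof.
move=> xz; have [fd [phi [bphi hphi]]] := f_qi.
have dx y : bdiff H y = 0 by apply: H1.
have cx : coh_class (bdiff H) x = 0.
  apply: (bij_inj bphi); rewrite linear0 (hphi _ (dx x)).
  have dfx : bdiff A (bfun f [:: x]) = 0.
    by rewrite -(fd x) /= dx -/(mor1 0) linear0.
  by apply: (coh_class_eq0 dfx).2; exists z.
by have [y ->] := (coh_class_eq0 (dx x)).1 cx; apply: dx.
Qed.

Lemma mor1_surj y : bdiff A y = 0 -> exists x z, y = mor1 x + bdiff A z.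
Proof.
move=> dy; have [fd [phi [[psi psiK phiK] hphi]]] := f_qi.
have [x dx xE] := coh_class_surj (psi (coh_class (bdiff A) y)).
have dfx : bdiff A (mor1 x) = 0 by rewrite -[mor1 x]/(bfun f [:: x]) -(fd x) dx -/(mor1 0) linear0.
have e : coh_class (bdiff A) (mor1 x) = coh_class (bdiff A) y.
  by rewrite -[mor1 x]/(bfun f [:: x]) -hphi // -xE phiK.
have dyx : bdiff A (y - mor1 x) = 0 by rewrite linearB /= dy dfx subrr.
have [|z hz] := (coh_class_eq0 dyx).1.
  have := coh_class_lin (-1) dfx dy; rewrite !scaleN1r => h.
  by rewrite addrC h e addNr.
by exists x, z; rewrite -hz addrC subrK.
Qed.

Lemma projector_exists : projective V -> exists pi : {linear V -> V},
  [/\ forall x, isunit H x -> pi x = 0, forall i x, GH i x -> GH i (pi x) &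
      forall x, pi x = x \/ exists a e, isunit H e /\ pi x = x - a *: e].
Proof.
move=> Vp; rewrite /isunit; case ue: (bunit H) => [e|]; last first.
  by exists idfun; split=> // x; left.
have uu : unitary (tot GH) (bop H) (Some e) by rewrite -ue; apply: bunit_unitary.
have ud : GH (0, 0) e by have := bunit_bidegree H; rewrite ue.
have [pi [pe pd pE]] := unit_projector Vp (Ainf_multilinear (bop_ainf H)) (strict_unitr uu) ud.
exists pi; split=> // [x [<-] //|x].
by have [a ax] := pE x; right; exists a, e.
Qed.

(** Order 0 is included in every weight, since it is correct from the start. *)
Definition defect_below w beta phi := forall xs r,
  (r == 0)%N || (r + size xs < w)%N -> Defect beta phi xs r = 0.

Section Step.
Variables (w : nat) (beta : nat -> seq V -> V) (phi : nat -> seq V -> M).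
Hypotheses (lift_bp : lifting f beta phi) (small : defect_below w beta phi).

Lemma curvature_defect r n xs : (r + n <= w)%N -> size xs = n ->
  (forall ys q, (q + size ys < r + n)%N -> curvature (extB beta) ys q = 0) ->
  mor1 (curvature (extB beta) xs r) = bdiff A (Defect beta phi xs r).
Proof.
move=> rnw sz hc.
apply: (@defect_step _ _ _ _ _ (extB beta) (extF phi) (bar_dop Ah) (lifting_op_hmlin lift_bp) (lifting_mor_hmlin lift_bp)
  (bar_dop_hmlin Ah) (lifting_op_nil lift_bp) mor1 (bdiff A) r n) => //.
- exact: lifting_op_susp_sign lift_bp.
- exact: lifting_mor_susp_sign lift_bp.
- exact: bar_dop_flat.
- exact: lifting_op_arity1 lift_bp.
- exact: lifting_mor_arity1 lift_bp.
- exact: bar_dop1_at0.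
- by move=> ys sy i ir; apply: small; apply/orP; right; lia.
- by move=> ys sy i ir; apply: small; apply/orP; right; lia.
- by move=> ys sy i ir; apply: hc; lia.
- by move=> ys sy i ir; apply: hc; lia.
Qed.

(** The vanishing of the defect forces B B = 0, by injectivity of f_1 on cohomology. *)
Lemma curvature_small ys r : (r + size ys < w)%N -> curvature (extB beta) ys r = 0.
Proof.
have [m] := ubnP (r + size ys)%N; elim: m ys r => // m IH ys r hm hw.
apply: (@mor1_inj _ 0); rewrite (@curvature_defect r (size ys)) ?small ?linear0 //.
- by rewrite hw orbT.
- exact: ltnW.
by move=> zs q hq; apply: IH; lia.
Qed.

Lemma defect_cocycle r xs : (r + size xs = w)%N -> bdiff A (Defect beta phi xs r) = 0.
Proof.
move=> rw; have h := @curvature_defect r (size xs) xs.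
have e : mor1 (curvature (extB beta) xs r) = bdiff A (Defect beta phi xs r).
  by apply: h => //; [rewrite rw|move=> ys q; rewrite rw; apply: curvature_small].
by rewrite -e (mor1_inj e) linear0.
Qed.

(** What has to be added at order r in arity w - r to kill the defect there. *)
Definition correction r (p : (seq V -> V) * (seq V -> M)) :=
  [/\ multilinear p.1 /\ multilinear p.2,
      forall ds xs, (r + size xs)%N = w -> List.Forall2 GH ds xs ->
        GH (\sum_(d <- ds) d + bideg_op s (size xs) + (r%:Z, - r%:Z)) (p.1 xs) /\
        GA (\sum_(d <- ds) d + bideg_mor s (size xs) + (r%:Z, - r%:Z)) (p.2 xs),
      forall xs x, (r + size xs)%N = w -> List.In x xs -> isunit H x -> p.1 xs = 0 /\ p.2 xs = 0
    & forall xs, (r + size xs)%N = w ->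
        Defect beta phi (map (cst GH) xs) r + mor1 (p.1 xs) - bdiff A (p.2 xs) = 0].

Lemma correction_exists : projective V -> forall r, exists p, (0 < r <= w)%N -> correction r p.
Proof.
move=> Vp r; have [rw|_] := boolP (0 < r <= w)%N; last by exists (fun=> 0, fun=> 0).
have [pi [pi1 pi2 pi3]] := projector_exists Vp.
pose n := (w - r)%N.
have sw xs : (r + size xs)%N = w <-> size xs = n by rewrite /n; lia.
pose E xs := Defect beta phi (map (cst GH) xs) r.
have dh := hmlin_defect (lifting_op_hmlin lift_bp) (lifting_mor_hmlin lift_bp) (bar_dop_hmlin Ah).
have El : multilinear E.
  exact: coef_multilinear (hmlin_multilinear dh).
have E0 : E [::] = 0.
  by rewrite /E (defect0 (lifting_mor_hmlin lift_bp) (lifting_op_nil lift_bp) (bar_dop_nil Ah)).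
have Edeg ds xs : size xs = n -> List.Forall2 GH ds xs ->
    GA (\sum_(d <- ds) d + (bideg_op s n + (r%:Z, - r%:Z))) (E xs).
  move=> sz h; rewrite -sz; case: xs sz h => [|x xs] sz h.
    by rewrite E0; case: (homog_submod GA (\sum_(d <- ds) d + (bideg_op s (size (Nil V)) + (r%:Z, - r%:Z)))).
  have h' : List.Forall2 (series_grading GH) ds (map (cst GH) (x :: xs)).
    by rewrite -[ds]map_id; apply: Forall2_map2 h => d y; apply: cst_homog.
  have y0 : map (cst GH) (x :: xs) <> [::] by [].
  have := defect_degree Ah lift_bp y0 h'; rewrite size_map => /(_ r).
  by rewrite addrA.
have Ed xs : size xs = n -> bdiff A (E xs) = 0.
  by move=> sz; apply: defect_cocycle; rewrite size_map sz /n; lia.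
have Ev : vanishing (isunit H) n E.
  move=> xs x sz xin ux; rewrite /E (defect_on_unit Ah lift_bp ux) //.
  by apply/list_InP; apply: List.in_map.
have [op [htp [[h1 h1'] h2 [h3 h3'] h4]]] := solve_exists mor1_degree
  (fun i x => @bdiff_degree _ _ _ _ A i x) mor1_inj mor1_surj Vp pi1 pi2 pi3 El Edeg Ed Ev.
exists (op, htp) => _; rewrite /correction -[(op, htp).1]/op -[(op, htp).2]/htp.
split=> // [ds xs /sw sz h|xs x /sw sz xin ux|xs /sw sz].
- have [g1 g2] := h2 ds xs sz h; rewrite sz -!addrA; split=> //.
  move: g2; rewrite !addrA; congr (homog GA _ _).
  rewrite !bideg_opE bideg_morE mulr1n.
  move: (bdeg s) (\sum_(d <- ds) d) (bdeg s *+ n) => [t1 t2] [a1 a2] [c1 c2].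
  by congr (_, _); rewrite /=; lia.
- by rewrite (h3 xs x) ?(h3' xs x).
- by rewrite -/(E xs) (h4 xs sz) subrK subrr.
Qed.

(** All entries of weight w are corrected simultaneously: a correction at (r, n) is not
    seen by the defect at another (r', n') of the same weight, since one of
    r' < r and n' < n holds. *)
Lemma lifting_step : projective V -> exists beta' phi', [/\ lifting f beta' phi', defect_below w.+1 beta' phi'
  & forall r xs, (r + size xs)%N != w -> beta' r xs = beta r xs /\ phi' r xs = phi r xs].
Proof.
move=> Vp; have [c hc] := choice (correction_exists Vp).
pose active r (xs : seq V) := [&& (0 < r)%N, (0 < size xs)%N & (r + size xs)%N == w].
pose beta' r xs := if active r xs then beta r xs + (c r).1 xs else beta r xs.
pose phi' r xs := if active r xs then phi r xs + (c r).2 xs else phi r xs.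
have act r xs : active r xs -> [/\ (0 < r)%N, (0 < size xs)%N, (r + size xs)%N = w & correction r (c r)].
  by move=> /and3P[r0 x0 /eqP rw]; split=> //; apply: hc; rewrite r0 -rw leq_addr.
have actE r u x v y : active r (u ++ x :: v) = active r (u ++ y :: v).
  by rewrite /active !size_cat.
have ok' : lifting f beta' phi'; first split.
- split=> [r a x y u v|r|r ds xs xs0 h].
  + rewrite /beta' (actE r u _ v 0) (actE r u x v 0) (actE r u y v 0); case: ifP => [/act [_ _ _ [[l _] _ _ _]]|_].
      by rewrite l (fam_lin (lifting_op lift_bp)) scalerDr addrACA.
    exact: (fam_lin (lifting_op lift_bp)).
  + by rewrite /beta' /active andbF (fam_nil (lifting_op lift_bp)).
  + rewrite /beta'; have h0 := fam_deg (lifting_op lift_bp) r xs0 h; case: ifP => // /act [_ _ rw [_ hd _ _]].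
    by apply: submodD => //; [exact: homog_submod|case: (hd ds xs rw h)].
- split=> [r a x y u v|r|r ds xs xs0 h].
  + rewrite /phi' (actE r u _ v 0) (actE r u x v 0) (actE r u y v 0); case: ifP => [/act [_ _ _ [[_ l] _ _ _]]|_].
      by rewrite l (fam_lin (lifting_mor lift_bp)) scalerDr addrACA.
    exact: (fam_lin (lifting_mor lift_bp)).
  + by rewrite /phi' /active andbF (fam_nil (lifting_mor lift_bp)).
  + rewrite /phi'; have h0 := fam_deg (lifting_mor lift_bp) r xs0 h; case: ifP => // /act [_ _ rw [_ hd _ _]].
    by apply: submodD => //; [exact: homog_submod|case: (hd ds xs rw h)].
- by move=> xs; rewrite /beta' /=; apply: (lifting_op0 lift_bp).
- by move=> xs; rewrite /phi' /=; apply: (lifting_mor0 lift_bp).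
- move=> r xs x r0 xin ux; have [b0 p0] := lifting_unit lift_bp r0 xin ux.
  rewrite /beta' /phi'; case: ifP => // /act [_ _ rw [_ _ hu _]].
  by have [-> ->] := hu xs x rw xin ux; rewrite b0 p0 !addr0.
have agree r xs : (r + size xs)%N != w -> beta' r xs = beta r xs /\ phi' r xs = phi r xs.
  by move=> /negPf rw; rewrite /beta' /phi' /active rw !andbF.
exists beta', phi'; split=> //.
have pert R n xs : (0 < R)%N -> (0 < n)%N -> (R + n <= w)%N -> size xs = n ->
  Defect beta' phi' xs R = Defect beta phi xs R +
    mor1 ((extB beta' xs - extB beta xs) R) - bdiff A ((extF phi' xs - extF phi xs) R).
  move=> R0 n0 Rn sz.
  apply: (@defect_perturb _ _ _ _ _ (extB beta) (extB beta') (extF phi) (extF phi') (bar_dop Ah)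
    (lifting_mor_hmlin lift_bp) (bar_dop_hmlin Ah) (lifting_op_hmlin ok') (lifting_mor_hmlin ok') (lifting_op_nil ok') mor1 (bdiff A) R n) => //.
  - exact: lifting_op_arity1 ok'.
  - exact: lifting_mor_arity1 lift_bp.
  - exact: bar_dop1_at0.
  - move=> ys sy; apply: (extend_sub_hord (lifting_op lift_bp) (lifting_op ok') (n := size ys)) => // r zs rR sz'.
    by case: (agree r zs); [lia|].
  - move=> ys sy; apply: (extend_sub_hord (lifting_op lift_bp) (lifting_op ok') (n := size ys)) => // r zs rR sz'.
    by case: (agree r zs); [lia|].
  - move=> ys sy; apply: (extend_sub_hord (lifting_mor lift_bp) (lifting_mor ok') (n := size ys)) => // r zs rR sz'.
    by case: (agree r zs); [lia|].
  - move=> ys sy; apply: (extend_sub_hord (lifting_mor lift_bp) (lifting_mor ok') (n := size ys)) => // r zs rR sz'.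
    by case: (agree r zs); [lia|].
have small0 : defect_below w beta' phi'.
  move=> xs [|R]; first by rewrite (defect_at0 Ah ok').
  case: xs => [|x xs]; first by rewrite (defect0 (lifting_mor_hmlin ok') (lifting_op_nil ok') (bar_dop_nil Ah)).
  set n := size _ => /orP[//|hw]; rewrite (pert _ n) //; last by apply: ltnW.
  rewrite small ?hw ?orbT //.
  have -> : (extB beta' (x :: xs) - extB beta (x :: xs)) R.+1 = 0.
    rewrite coefB (eq_extend_coef_series (lifting_op lift_bp) (lifting_op ok') (n := n)) ?subrr // => r ys rR sy.
    by case: (agree r ys); [lia|].
  have -> : (extF phi' (x :: xs) - extF phi (x :: xs)) R.+1 = 0.
    rewrite coefB (eq_extend_coef_series (lifting_mor lift_bp) (lifting_mor ok') (n := n)) ?subrr // => r ys rR sy.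
    by case: (agree r ys); [lia|].
  by rewrite !linear0 !addr0.
move=> xs r /orP[/eqP ->|]; first by rewrite (defect_at0 Ah ok').
rewrite ltnS leq_eqVlt => /orP[/eqP rw|rw]; last by apply: small0; rewrite rw orbT.
case: r rw => [|R] rw; first by rewrite (defect_at0 Ah ok').
have [xs0|x0] := posnP (size xs).
  by rewrite (size0nil xs0) (defect0 (lifting_mor_hmlin ok') (lifting_op_nil ok') (bar_dop_nil Ah)).
have dh := hmlin_defect (lifting_op_hmlin ok') (lifting_mor_hmlin ok') (bar_dop_hmlin Ah).
apply: (hmlin_cst (R := R.+2) (n := size xs) dh) => // vs sz i.
rewrite ltnS leq_eqVlt => /orP[/eqP ->|iR]; last first.
  by apply: small0; rewrite size_map sz; apply/orP; right; lia.
rewrite (pert _ (size xs)) ?size_map ?rw //.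
have av : active R.+1 vs by rewrite /active sz x0 rw eqxx.
have [_ _ rw' [_ _ _ hE]] := act _ _ av.
rewrite !coefB !(extend_cst (lifting_op ok')) !(extend_cst (lifting_op lift_bp)) !(extend_cst (lifting_mor ok')) !(extend_cst (lifting_mor lift_bp)).
have addBK (U : zmodType) (p q : U) : p + q - p = q by rewrite addrC addKr.
rewrite /beta' /phi' av !addBK; exact: (hE vs rw').
Qed.

End Step.
End Construction.

(** * The transferred deformation *)

Section Limit.
Variables (k : comPzRingType) (s : nat) (V M : lmodType k).
Variables (GH : grading V (int * int)%type) (GA : grading M (int * int)%type).
Variables (H : bainf s GH) (A : bainf s GA) (Ah : deformation A) (f : bmor H A).
Hypothesis H1 : forall c, bop H [:: c] = 0.
Hypothesis f_qi : bquasi_iso f.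
Hypothesis Vproj : projective V.
Local Notation extB beta := (@extend k V V GH GH beta).
Local Notation extF phi := (@extend k V M GH GA phi).
Local Notation Defect beta phi := (defect (extB beta) (extF phi) (bar_dop Ah)).
Local Notation fams := ((nat -> seq V -> V) * (nat -> seq V -> M))%type.

Definition lifting_below w (p : fams) := lifting f p.1 p.2 /\ defect_below GH Ah w p.1 p.2.

Definition agree_off w (p p' : fams) := forall r xs, (r + size xs)%N != w ->
  p'.1 r xs = p.1 r xs /\ p'.2 r xs = p.2 r xs.

Lemma lifting_below_init : exists p, lifting_below 0 p.
Proof.
pose beta r xs := if r == 0%N then bar_bop H xs else 0.
pose phi r xs := if r == 0%N then bar_bfun f xs else 0.
suff lift_bp : lifting f beta phi.
  exists (beta, phi); split=> // xs r; rewrite ltn0 orbF => /eqP ->.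
  exact: (defect_at0 Ah lift_bp).
split=> //.
- split=> [r a x y u w|r|r ds xs xs0 h]; rewrite /beta; case: eqP => [r0|_] //.
  + exact: bar_bop_multilinear.
  + by rewrite scaler0 addr0.
  + by rewrite r0 addr0; apply: bar_bop_degree.
  + by case: (homog_submod GH (\sum_(d <- ds) d + bideg_op s (size xs) + (r%:Z, - r%:Z))).
- split=> [r a x y u w|r|r ds xs xs0 h]; rewrite /phi; case: eqP => [r0|_] //.
  + exact: bar_bfun_multilinear.
  + by rewrite scaler0 addr0.
  + by rewrite r0 addr0; apply: bar_bfun_degree.
  + by case: (homog_submod GA (\sum_(d <- ds) d + bideg_mor s (size xs) + (r%:Z, - r%:Z))).
by case.
Qed.

Lemma lifting_below_chain : exists st : nat -> fams, forall w, lifting_below w (st w) /\ agree_off w (st w) (st w.+1).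
Proof.
have stepP (wp : nat * fams) : exists p', lifting_below wp.1 wp.2 -> lifting_below wp.1.+1 p' /\ agree_off wp.1 wp.2 p'.
  case: wp => w p; have [[okp sm]|ng] := pselect (lifting_below w p); last by exists p.
  have [beta' [phi' [ok' sm' ag]]] := lifting_step H1 f_qi okp sm Vproj.
  by exists (beta', phi').
have [g hg] := choice stepP; have [p0 hp0] := lifting_below_init.
pose st w := iteri w (fun i p => g (i, p)) p0.
have good_st w : lifting_below w (st w).
  by elim: w => //= w IH; case: (hg (w, st w) IH).
by exists st => w; split=> //; case: (hg (w, st w) (good_st w)).
Qed.

(** The entry (r, n) no longer changes once the weight exceeds r + n, and the defect
    at (r, n) only involves entries of at most that order and arity. *)
Lemma transfer_exists : exists beta phi, lifting f beta phi /\ forall xs, Defect beta phi xs = 0.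
Proof.
have [st hst] := lifting_below_chain.
have stable w w' r xs : (r + size xs < w)%N -> (w <= w')%N ->
    (st w').1 r xs = (st w).1 r xs /\ (st w').2 r xs = (st w).2 r xs.
  move=> rw; elim: w' => [|w' IH]; first by rewrite leqn0 => /eqP ->.
  rewrite leq_eqVlt => /orP[/eqP -> //|]; rewrite ltnS => ww.
  have [e1 e2] := IH ww; have [_ /(_ r xs) ag] := hst w'.
  by case: ag => [|-> ->]; [lia|].
pose beta r xs := (st (r + size xs).+1).1 r xs.
pose phi r xs := (st (r + size xs).+1).2 r xs.
have lim w r xs : (r + size xs < w)%N -> (st w).1 r xs = beta r xs /\ (st w).2 r xs = phi r xs.
  by move=> rw; apply: stable.
have okst w : lifting f (st w).1 (st w).2 by case: (hst w) => -[].
have szE r u x v y : (r + size (u ++ x :: v) < (r + size (u ++ y :: v : seq V)).+1)%N.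
  by rewrite !size_cat /=.
have okl : lifting f beta phi.
  split.
  - split=> [r a x y u v|r|r ds xs xs0 h]; last exact: (fam_deg (lifting_op (okst _)) r xs0 h).
      have [<- _] := lim _ _ _ (szE r u (a *: x + y) v 0).
      have [<- _] := lim _ _ _ (szE r u x v 0); have [<- _] := lim _ _ _ (szE r u y v 0).
      exact: (fam_lin (lifting_op (okst _))).
    exact: (fam_nil (lifting_op (okst _))).
  - split=> [r a x y u v|r|r ds xs xs0 h]; last exact: (fam_deg (lifting_mor (okst _)) r xs0 h).
      have [_ <-] := lim _ _ _ (szE r u (a *: x + y) v 0).
      have [_ <-] := lim _ _ _ (szE r u x v 0); have [_ <-] := lim _ _ _ (szE r u y v 0).
      exact: (fam_lin (lifting_mor (okst _))).
    exact: (fam_nil (lifting_mor (okst _))).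
  - by move=> xs; apply: (lifting_op0 (okst _)).
  - by move=> xs; apply: (lifting_mor0 (okst _)).
  - by move=> r xs x r0 xin ux; apply: (lifting_unit (okst _) r0 xin ux).
exists beta, phi; split=> // xs; apply: series_ext => R.
have [/size0nil ->|x0] := posnP (size xs).
  by rewrite (defect0 (lifting_mor_hmlin okl) (lifting_op_nil okl) (bar_dop_nil Ah)).
set n := size xs in x0; pose w := (R + n).+1.
have loc1 r ys : (r <= R)%N -> (size ys <= n)%N -> beta r ys = (st w).1 r ys.
  by move=> rR sy; case: (lim w r ys) => [|-> _ //]; rewrite /w; lia.
have loc2 r ys : (r <= R)%N -> (size ys <= n)%N -> phi r ys = (st w).2 r ys.
  by move=> rR sy; case: (lim w r ys) => [|_ -> //]; rewrite /w; lia.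
have okw := okst w.
have hB q ys : (q <= R.+1)%N -> (size ys <= n)%N -> hord q (extB beta ys - extB (st w).1 ys).
  move=> qR sy; apply: (extend_sub_hord (lifting_op okw) (lifting_op okl) (n := size ys)) => // r zs rq sz.
  by apply: loc1; lia.
have hF q ys : (q <= R.+1)%N -> (size ys <= n)%N -> hord q (extF phi ys - extF (st w).2 ys).
  move=> qR sy; apply: (extend_sub_hord (lifting_mor okw) (lifting_mor okl) (n := size ys)) => // r zs rq sz.
  by apply: loc2; lia.
rewrite (@defect_perturb _ _ _ _ _ (extB (st w).1) (extB beta) (extF (st w).2) (extF phi) (bar_dop Ah)
    (lifting_mor_hmlin okw) (bar_dop_hmlin Ah) (lifting_op_hmlin okl) (lifting_mor_hmlin okl) (lifting_op_nil okl) (mor1 f) (bdiff A) R n) //.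
- rewrite (hB R.+1 xs) // (hF R.+1 xs) // !linear0 !addr0.
  by case: (hst w) => -[_ sm] _; rewrite sm // /w ltnS leqnn orbT.
- exact: lifting_op_arity1 okl.
- exact: lifting_mor_arity1 okw.
- exact: bar_dop1_at0.
- by move=> ys sy; apply: hB => //; apply: ltnW.
- by move=> ys sy; apply: hB => //; rewrite sy.
- by move=> ys sy; apply: hF => //; apply: ltnW.
- by move=> ys sy; apply: hF => //; rewrite sy.
Qed.

Section Transfer.
Variables (beta : nat -> seq V -> V) (phi : nat -> seq V -> M).
Hypotheses (lift_bp : lifting f beta phi) (flat0 : forall xs, Defect beta phi xs = 0).
Local Notation B := (extB beta).
Local Notation F := (extF phi).

Lemma transfer_curvature xs : bar_insert (susp_sign (spar GH)) B B xs = 0.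
Proof.
apply: series_ext => r; have sm : defect_below GH Ah (r + size xs).+1 beta phi by move=> ys q _; rewrite flat0.
exact: (curvature_small H1 f_qi lift_bp sm (ltnSn _)).
Qed.

Definition transfer_op := bar (spar GH) B.
Definition transfer_mor := bar (spar GH) F.

(** The suspension twist is an involution. *)
Lemma barK (U : lmodType k) (g : seq (series GH) -> U) : g [::] = 0 ->
  bar (spar GH) (bar (spar GH) g) =1 g.
Proof.
move=> g0 [|x xs]; first by rewrite g0.
rewrite bar_nonempty // bar_nonempty; last by [].
by rewrite twistK //; apply: sparK.
Qed.

Lemma transfer_op_hmultilinear : hmultilinear transfer_op.
Proof. exact/hmultilinear_hmlin/(bar_series_hmlin (extend_hmultilinear (lifting_op lift_bp))). Qed.

Lemma transfer_mor_hmultilinear : hmultilinear transfer_mor.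
Proof. exact/hmultilinear_hmlin/(bar_series_hmlin (extend_hmultilinear (lifting_mor lift_bp))). Qed.

Lemma transfer_op_degree : of_degree (series_grading GH) (series_grading GH) (bideg_op s) transfer_op.
Proof. exact: bar_degree (@spar_degree _ _ GH) (extend_degree (lifting_op lift_bp)). Qed.

Lemma transfer_mor_degree : of_degree (series_grading GH) (series_grading GA) (bideg_mor s) transfer_mor.
Proof. exact: bar_degree (@spar_degree _ _ GH) (extend_degree (lifting_mor lift_bp)). Qed.

Lemma bar_transfer_op : bar (spar GH) transfer_op = B.
Proof. by apply/funext; apply: barK; apply: (lifting_op_nil lift_bp). Qed.

Lemma bar_transfer_mor : bar (spar GH) transfer_mor = F.
Proof. by apply/funext; apply: barK; apply: (lifting_mor_nil lift_bp). Qed.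

Lemma transfer_op_ainf N : Ainf (trunc_grading (tot GH) N) (reduction (N := N) transfer_op).
Proof.
apply: (ins_bar_Ainf transfer_op_hmultilinear transfer_op_degree) => xs.
by rewrite bar_transfer_op; apply: transfer_curvature.
Qed.

Lemma transfer_mor_ainf N : Ainf_mor (trunc_grading (tot GH) N) (trunc_grading (tot GA) N)
  (reduction (N := N) transfer_op) (reduction (N := N) (dop Ah)) (reduction (N := N) transfer_mor).
Proof.
apply: (comp_bar_Ainf_mor transfer_op_hmultilinear (dop_hmultilinear Ah) transfer_mor_hmultilinear transfer_op_degree transfer_mor_degree) => xs.
by rewrite bar_transfer_op bar_transfer_mor; apply: flat0.
Qed.

Lemma transfer_op_unitary N : unitary (trunc_grading (tot GH) N) (reduction (N := N) transfer_op)
  (omap (trunc_const N) (bunit H)).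
Proof.
case ue: (bunit H) => [e|] //=.
have se : spar GH (cst GH e) = cst GH e by apply: spar_cst; apply: unit_homog ue.
split.
- move=> i; rewrite ffunE; have := unit_homog ue => /homog_tot he.
  by case: eqP => // _; case: (homog_submod (tot GH) 0).
- move=> x; rewrite /reduction /= trunc_lift_const -[bpar _ _]/(spar _ _) se.
  by rewrite (B_unitl lift_bp ue) trunc_liftK.
- move=> x; rewrite /reduction /= trunc_lift_const -[bpar _ _]/(spar _ _).
  rewrite (B_unitr lift_bp ue) /susp_sign opprK.
  by rewrite sparK trunc_liftK.
move=> xs ex sz; rewrite /reduction /transfer_op.
have ein : List.In (cst GH e) (map (@trunc_lift _ _ GH N) xs).
  by rewrite -(trunc_lift_const GH N); apply: List.in_map; apply/list_InP.
case: xs ex sz ein => // x xs _ sz ein.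
rewrite bar_nonempty //.
rewrite (extend_unit (lifting_op lift_bp) (n := size (x :: xs)) (e := e)).
- by apply/trunc_eq0.
- by move=> r ys sy; apply: (beta_unit lift_bp ue); rewrite sy.
- by rewrite size_twist size_map.
exact: In_twist.
Qed.

Lemma transfer_mor_unitary N : unitary_mor (omap (trunc_const N) (bunit H)) (omap (trunc_const N) (bunit A))
  (reduction (N := N) transfer_mor).
Proof.
have := bfun_unitary f; case ue: (bunit H) => [e|]; case ue': (bunit A) => [e'|] //= _.
have se : spar GH (cst GH e) = cst GH e by apply: spar_cst; apply: unit_homog ue.
split.
  rewrite /reduction /= trunc_lift_const (F_unit1 lift_bp ue ue').
  by rewrite -(trunc_lift_const GA N) trunc_liftK.
move=> xs ex sz; rewrite /reduction /transfer_mor.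
have ein : List.In (cst GH e) (map (@trunc_lift _ _ GH N) xs).
  by rewrite -(trunc_lift_const GH N); apply: List.in_map; apply/list_InP.
case: xs ex sz ein => // x xs _ sz ein.
rewrite bar_nonempty //.
rewrite (extend_unit (lifting_mor lift_bp) (n := size (x :: xs)) (e := e)).
- by apply/trunc_eq0.
- by move=> r ys sy; apply: (phi_unit lift_bp ue); rewrite sy.
- by rewrite size_twist size_map.
exact: In_twist.
Qed.

Lemma mod_h_bar_extend (W : lmodType k) (G : grading W (int * int)%type) delta gam (g : seq V -> W) xs :
  family GH G delta gam -> (forall xs, gam 0%N xs = bar (vpar GH) g xs) -> xs <> [::] ->
  mod_h (bar (spar GH) (@extend k V W GH G gam) xs) = g (map (@mod_h _ _ _) xs).
Proof.
move=> fam g0 xs0; rewrite /mod_h bar_nonempty // (extend_at0 fam) g0.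
rewrite map_at0_twist bar_nonempty; last by case: (xs) xs0.
by rewrite twistK //; apply: bparK.
Qed.

Definition transfer_deformation : deformation H :=
  @Deformation _ _ _ _ H transfer_op transfer_op_hmultilinear transfer_op_degree transfer_op_ainf transfer_op_unitary
    (fun xs => mod_h_bar_extend (lifting_op lift_bp) (lifting_op0 lift_bp)).

Definition transfer_dmor : dmor f transfer_deformation Ah :=
  @DMor _ _ _ _ _ _ _ _ f transfer_deformation Ah transfer_mor transfer_mor_hmultilinear transfer_mor_degree transfer_mor_ainf
    transfer_mor_unitary (fun xs => mod_h_bar_extend (lifting_mor lift_bp) (lifting_mor0 lift_bp)).

End Transfer.
End Limit.

(** * Exactness of cones of power series complexes *)

Section QuasiIsoCriterion.
Variables (R : pzRingType) (M N : lmodType R).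
Variables (d : {linear M -> M}) (d' : {linear N -> N}) (g : {linear M -> N}).
Hypothesis gd : forall x, g (d x) = d' (g x).
Hypothesis g_inj : forall x z, d x = 0 -> g x = d' z -> exists w, x = d w.
Hypothesis g_surj : forall y, d' y = 0 -> exists x w, d x = 0 /\ y = g x + d' w.

(** The map induced on classes, defined through representatives. *)
Lemma quasi_isoI : quasi_iso d d' g.
Proof.
split=> //.
pose phi (c : cohomology d) : cohomology d' := coh_class d' (g (sval (cid2 (coh_class_surj c)))).
have gz x : d x = 0 -> d' (g x) = 0 by move=> dx; rewrite -gd dx linear0.
have classB (K : lmodType R) (e : {linear K -> K}) x y : e x = 0 -> e y = 0 ->
    coh_class e x = coh_class e y <-> exists z, x - y = e z.
  move=> ex ey; have exy : e (x - y) = 0 by rewrite linearB /= ex ey subrr.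
  rewrite -coh_class_eq0 //.
  have -> : x - y = (-1) *: y + x by rewrite scaleN1r addrC.
  rewrite coh_class_lin // scaleN1r addrC.
  by split=> [->|/eqP]; [rewrite subrr|rewrite subr_eq0 => /eqP].
have phiE x : d x = 0 -> phi (coh_class d x) = coh_class d' (g x).
  move=> dx; rewrite /phi; case: cid2 => y dy /= xy.
  have [z hz] := (classB _ d _ _ dx dy).1 xy.
  apply/classB; rewrite ?gz //; exists (- g z).
  by rewrite -linearB -opprB hz !linearN gd.
have phi_lin : linear phi.
  move=> a c c'; have [x dx ->] := coh_class_surj c; have [y dy ->] := coh_class_surj c'.
  rewrite -coh_class_lin // !phiE //; last by rewrite linearP dx dy scaler0 addr0.
  by rewrite linearP coh_class_lin // gz.
pose phiL := GRing.isLinear.Build R (cohomology d) (cohomology d') *:%R phi phi_lin.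
pose phi' : {linear cohomology d -> cohomology d'} := HB.pack phi phiL.
exists phi'; split; last exact: phiE.
have inj : injective phi'.
  apply: raddf_inj => c; have [x dx ->] := coh_class_surj c; rewrite /= phiE // => h.
  have [z hz] := (coh_class_eq0 (gz _ dx)).1 h.
  by apply: (coh_class_eq0 dx).2; apply: g_inj hz.
have surj c' : exists c, phi' c = c'.
  have [y dy ->] := coh_class_surj c'; have [x [w [dx yE]]] := g_surj dy.
  exists (coh_class d x); rewrite /= phiE //; apply/classB; rewrite ?gz //.
  by exists (- w); rewrite yE opprD addrA subrr add0r linearN.
have [psi hpsi] := choice surj.
by exists psi => // c; apply: inj; rewrite hpsi.
Qed.

End QuasiIsoCriterion.

Lemma unshift_degree (i c : int * int) (n : int) :
  (((i.1 + n, i.2 - n) - c).1 - n, ((i.1 + n, i.2 - n) - c).2 + n) = i - c.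
Proof. by case: i c => [a b] [a' b']; congr (_, _); rewrite /=; lia. Qed.

Section Cone.
Variables (k : comPzRingType) (V M : lmodType k).
Variables (GH : grading V (int * int)%type) (GA : grading M (int * int)%type).
Local Notation X := (series GH).
Local Notation Y := (series GA).
Variables (D1 : {linear X -> X}) (d1 : {linear Y -> Y}) (F1 : {linear X -> Y}).
Variables (m1 : {linear V -> M}) (d : {linear M -> M}) (c : int * int).
Hypotheses (D1h : forall x, D1 (hmul x) = hmul (D1 x)) (d1h : forall y, d1 (hmul y) = hmul (d1 y)).
Hypothesis F1h : forall x, F1 (hmul x) = hmul (F1 x).
Hypotheses (D1_0 : forall x, D1 x 0%N = 0) (d1_0 : forall y, d1 y 0%N = d (y 0%N)).
Hypothesis F1_0 : forall x, F1 x 0%N = m1 (x 0%N).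
Hypotheses (DD : forall x, D1 (D1 x) = 0) (dd : forall y, d1 (d1 y) = 0).
Hypothesis FD : forall x, F1 (D1 x) = d1 (F1 x).
Hypothesis D1_deg : forall i x, series_grading GH i x -> series_grading GH (i + c) (D1 x).
Hypothesis d1_deg : forall i y, series_grading GA i y -> series_grading GA (i + c) (d1 y).
Hypothesis F1_deg : forall i x, series_grading GH i x -> series_grading GA i (F1 x).
Hypothesis m1_deg : forall i x, GH i x -> GA i (m1 x).
Hypothesis d_deg : forall i x, GA i x -> GA (i + c) (d x).
Hypothesis m1_inj : forall x z, m1 x = d z -> x = 0.
Hypothesis m1_surj : forall y, d y = 0 -> exists x z, y = m1 x + d z.

Lemma hmul_iter (U U' : lmodType k) (G : grading U (int * int)%type) (G' : grading U' (int * int)%type)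
    (g : series G -> series G') n x :
  (forall x, g (hmul x) = hmul (g x)) ->
  g (iter n (@hmul _ _ _) x) = iter n (@hmul _ _ _) (g x).
Proof. by move=> gh; elim: n => //= n <-. Qed.

Lemma hord_map (U U' : lmodType k) (G : grading U (int * int)%type) (G' : grading U' (int * int)%type)
    (g : series G -> series G') n x :
  (forall x, g (hmul x) = hmul (g x)) -> hord n x -> hord n (g x).
Proof. by move=> gh /hord_iter [z ->]; rewrite hmul_iter //; apply: iter_hord. Qed.

Lemma iter_hmulE0 (U : lmodType k) (G : grading U (int * int)%type) n (x : series G) :
  iter n (@hmul _ _ _) x = 0 -> x = 0.
Proof.
move=> h; apply: (@iter_hmul_inj _ _ _ n); rewrite h.
by elim: n {h} => //= n <-; rewrite linear0.
Qed.

Lemma hord_shift (U : lmodType k) (G : grading U (int * int)%type) n (x : series G) :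
  x 0%N = 0 -> hord n.+1 (iter n (@hmul _ _ _) x).
Proof.
move=> x0 i; rewrite ltnS leq_eqVlt => /orP[/eqP ->|]; last exact: iter_hord.
by have := iter_hmul_coef n x 0; rewrite addn0 => ->.
Qed.

Section Homogeneous.
Variables (i : int * int) (x : X) (y : Y).
Hypothesis hy : series_grading GA i y.
Hypotheses (Dx : D1 x = 0) (Fx : F1 x + d1 y = 0).

(** Modulo h^N the pair p is a primitive of the cycle (x, y) of the cone of F1. *)
Definition approx N (p : X * Y) :=
  [/\ series_grading GH i p.1, series_grading GA (i - c) p.2,
      hord N (x + D1 p.1) & hord N (y - F1 p.1 - d1 p.2)].

(** The error is h^N times a cycle (x', y') of the cone. The constant term of x' is
    mapped by m1 to a boundary, hence vanishes; that of y' is then a cocycle, hence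
    m1 h0 + d w0, and h^N (h0, w0) is the correction. *)
Lemma approx_step N p : approx N p -> exists p', [/\ approx N.+1 p',
  hord N (p'.1 - p.1) & hord N (p'.2 - p.2)].
Proof.
case: p => h w [/= hh hw /hord_iter [x' ex] /hord_iter [y' ey]].
have Dx' : D1 x' = 0.
  by apply: (@iter_hmulE0 _ _ N); rewrite -hmul_iter // -ex linearD /= Dx DD addr0.
have Fx' : F1 x' + d1 y' = 0.
  apply: (@iter_hmulE0 _ _ N); rewrite iter_hmulD -!hmul_iter // -ex -ey.
  by rewrite linearD !linearB /= FD dd subr0 addrACA Fx add0r subrr.
have F0 : m1 (x' 0%N) = d (- y' 0%N).
  apply/eqP; rewrite linearN -addr_eq0 -F1_0 -d1_0 -coefD.
  by rewrite Fx'.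
have x'0 := m1_inj F0.
have [|h0 [w0 e0]] := @m1_surj (y' 0%N).
  by apply: oppr_inj; rewrite -linearN -F0 x'0 linear0 oppr0.
pose j := (i.1 + N%:Z, i.2 - N%:Z).
have hy' : GA j (y' 0%N).
  have : series_homog i (iter N (@hmul _ _ _) y').
    rewrite -ey; apply: (submodB (homog_submod (series_grading GA) i)); last first.
      by rewrite -[i](subrK c); apply: d1_deg.
    apply: (submodB (homog_submod (series_grading GA) i)) => //.
    exact: F1_deg.
  by move=> /(_ N); have := iter_hmul_coef N y' 0; rewrite addn0 => ->.
have e1 : y' 0%N = m1 (gcomp GH j h0) + d (gcomp GA (j - c) w0).
  rewrite -(gcomp_homogE hy') e0 gcompD -(gcomp_d d_deg) subrK.
  by congr (_ + _); apply: gcomp_morph.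
set h1 := gcomp GH j h0 in e1; set w1 := gcomp GA (j - c) w0 in e1.
pose u := iter N (@hmul _ _ GH) (cst GH h1); pose v := iter N (@hmul _ _ GA) (cst GA w1).
exists (h + u, w + v); split; rewrite /= ?[_ + u]addrC ?[_ + v]addrC ?addrK; try exact: iter_hord.
rewrite addrC [v + w]addrC; split=> /=.
- apply: (submodD (homog_submod (series_grading GH) i)) => //.
  have := iter_hmul_homog N (cst_homog (gcomp_homog GH j h0)).
  by rewrite /= addrK subrK -surjective_pairing.
- apply: (submodD (homog_submod (series_grading GA) (i - c))) => //.
  have := iter_hmul_homog N (cst_homog (gcomp_homog GA (j - c) w0)).
  by rewrite unshift_degree.
- rewrite linearD /= addrA ex hmul_iter // -iter_hmulD.
  by apply: hord_shift; rewrite coefD D1_0 x'0 addr0.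
have -> : y - F1 (h + u) - d1 (w + v) = (y - F1 h - d1 w) - (F1 u + d1 v).
  by rewrite (linearD F1) (linearD d1) /= !opprD !addrA [y - F1 h - F1 u + _]addrAC.
rewrite ey /u /v (hmul_iter _ _ F1h) (hmul_iter _ _ d1h) -iter_hmulD.
have -> (z z' : Y) : iter N (@hmul _ _ _) z - iter N (@hmul _ _ _) z' = iter N (@hmul _ _ _) (z - z').
  by apply/eqP; rewrite subr_eq -iter_hmulD subrK.
by apply: hord_shift; rewrite coefB coefD F1_0 d1_0 !cst_coef /= e1 subrr.
Qed.

Lemma cone_exact_homog : exists h w, x + D1 h = 0 /\ y = F1 h + d1 w.
Proof.
have stepP (np : nat * (X * Y)) : exists p', approx np.1 np.2 ->
    [/\ approx np.1.+1 p', hord np.1 (p'.1 - np.2.1) & hord np.1 (p'.2 - np.2.2)].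
  have [ap|np'] := pselect (approx np.1 np.2); last by exists np.2.
  by have [p' hp'] := approx_step ap; exists p'.
have [g hg] := choice stepP.
pose st N := iteri N (fun j p => g (j, p)) (0 : X, 0 : Y).
have good N : approx N (st N).
  elim: N => [|N IH]; last by case: (hg (N, st N) IH).
  split=> //; first by case: (homog_submod (series_grading GH) i).
  by case: (homog_submod (series_grading GA) (i - c)).
have agree N N' : (N <= N')%N -> hord N ((st N').1 - (st N).1) /\ hord N ((st N').2 - (st N).2).
  elim: N' => [|N' IH]; first by rewrite leqn0 => /eqP ->; rewrite !subrr.
  rewrite leq_eqVlt => /orP[/eqP ->|]; first by rewrite !subrr.
  rewrite ltnS => NN; have [h1 h2] := IH NN; have [_ h3 h4] := hg (N', st N') (good N').
  split.
    by rewrite -[(st N'.+1).1](subrK (st N').1) -addrA; apply: hordD => //; apply: hord_le h3.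
  by rewrite -[(st N'.+1).2](subrK (st N').2) -addrA; apply: hordD => //; apply: hord_le h4.
have hsP : shifted_homog GH i (fun r => (st r.+1).1 r).
  by move=> r; case: (good r.+1) => h _ _ _; apply: h.
have wsP : shifted_homog GA (i - c) (fun r => (st r.+1).2 r).
  by move=> r; case: (good r.+1) => _ h _ _; apply: h.
pose h : X := Series (series_proof (in_sum1 (shifted_submod GH) hsP)).
pose w : Y := Series (series_proof (in_sum1 (shifted_submod GA) wsP)).
have hN N : hord N (h - (st N).1).
  move=> r rN; rewrite coefB; have [e _] := agree _ _ rN.
  by have := e r (ltnSn r); rewrite coefB => /eqP; rewrite subr_eq0 => /eqP ->; rewrite subrr.
have wN N : hord N (w - (st N).2).
  move=> r rN; rewrite coefB; have [_ e] := agree _ _ rN.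
  by have := e r (ltnSn r); rewrite coefB => /eqP; rewrite subr_eq0 => /eqP ->; rewrite subrr.
exists h, w; split.
  apply: hord_all => N; have [_ _ e _] := good N.
  have -> : x + D1 h = x + D1 (st N).1 + D1 (h - (st N).1) by rewrite linearB /= addrA addrAC addrK.
  by apply: hordD => //; apply: hord_map.
apply/eqP; rewrite -subr_eq0; apply/eqP; apply: hord_all => N; have [_ _ _ e] := good N.
have -> : y - (F1 h + d1 w) = (y - F1 (st N).1 - d1 (st N).2)
    - (F1 (h - (st N).1) + d1 (w - (st N).2)).
  rewrite (linearB F1) (linearB d1) /=.
  move: (F1 h) (d1 w) (F1 (st N).1) (d1 (st N).2) => p q r t.
  have -> : p - r + (q - t) = p + q - (r + t) by rewrite addrACA -opprD.
  by rewrite -[y - r - t]addrA -opprD opprB addrA subrK.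
apply: hordD => //; apply: hordN; apply: hordD; exact: hord_map.
Qed.

End Homogeneous.

(** Homogeneous components reduce this to cone_exact_homog, where homogeneity makes the
    infinite sum of the corrections a power series. *)
Lemma cone_exact x y : D1 x = 0 -> F1 x + d1 y = 0 ->
  exists h w, x + D1 h = 0 /\ y = F1 h + d1 w.
Proof.
move=> Dx Fx.
have pieces (i : int * int) : exists p : X * Y,
    gcomp (series_grading GH) (i + c) x + D1 p.1 = 0 /\
    gcomp (series_grading GA) i y = F1 p.1 + d1 p.2.
  have [|||h [w hw]] := @cone_exact_homog i (gcomp (series_grading GH) (i + c) x)
    (gcomp (series_grading GA) i y); last by exists (h, w).
  - exact: gcomp_homog.
  - by rewrite -(gcomp_d D1_deg) Dx gcomp0.
  - by rewrite -(gcomp_d d1_deg) -(gcomp_morph _ _ F1_deg) -gcompD Fx gcomp0.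
have [p hp] := choice pieces.
pose S := undup (gsupp (series_grading GA) y ++ map (fun i => i - c) (gsupp (series_grading GH) x)).
have uS : uniq S by apply: undup_uniq.
exists (\sum_(i <- S) (p i).1), (\sum_(i <- S) (p i).2).
rewrite !linear_sum -big_split.
rewrite {1}(gcomp_sumW (s := map (fun i => i + c) S) (G := series_grading GH) (x := x)).
- rewrite big_map -big_split big1 => [|i _]; last by case: (hp i).
  split=> //; rewrite {1}(gcomp_sumW (s := S) (G := series_grading GA) (x := y)) //.
    by apply: eq_bigr => i _; case: (hp i).
  by move=> i hi; rewrite mem_undup mem_cat hi.
- by rewrite map_inj_uniq //; apply: addIr.
move=> i hi; apply/mapP; exists (i - c); rewrite ?subrK //.
by rewrite mem_undup mem_cat; apply/orP; right; apply: (map_f (fun j => j - c)).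
Qed.

(** Exactness of the cone at (0, y) is surjectivity, and at (x, - z) injectivity, of F1
    on cohomology. *)
Lemma cone_quasi_iso : quasi_iso D1 d1 F1.
Proof.
apply: quasi_isoI => // [x z Dx Fx|y dy].
  have [|h [w [e _]]] := @cone_exact x (- z) Dx; first by rewrite Fx linearN subrr.
  by exists (- h); rewrite linearN; apply/eqP; rewrite -addr_eq0 e.
have [|h [w [e ye]]] := @cone_exact 0 y (linear0 D1); first by rewrite linear0 add0r.
by exists h, w; split=> //; move: e; rewrite add0r.
Qed.

End Cone.

(** * Transfer of deformations along f *)

Section TransferQuasiIso.
Variables (k : comPzRingType) (s : nat) (V M : lmodType k).
Variables (GH : grading V (int * int)%type) (GA : grading M (int * int)%type).
Variables (H : bainf s GH) (A : bainf s GA) (Ah : deformation A) (f : bmor H A).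
Hypothesis H1 : forall c, bop H [:: c] = 0.
Hypothesis f_qi : bquasi_iso f.
Hypothesis Vproj : projective V.

Definition dmor1 (D : deformation H) (F : dmor f D Ah) (x : series GH) := dfun F [:: x].
Lemma dmor1_linear D (F : dmor f D Ah) : linear (dmor1 F).
Proof. by move=> a x y; apply: ((dfun_hmultilinear F).1 a x y [::] [::]). Qed.
HB.instance Definition _ D F := GRing.isLinear.Build k _ _ *:%R (@dmor1 D F) (dmor1_linear F).

Lemma bar_insert1 (X Z : lmodType k) (sg : X -> X) (b : seq X -> X) (g : seq X -> Z) x :
  multilinear g -> b [::] = 0 -> bar_insert sg b g [:: x] = g [:: b [:: x]].
Proof.
move=> gl b0; rewrite /bar_insert (splits3_whole (K := fun u v w => g (map sg u ++ b v :: w))) //.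
by move=> u [|y v] w // _ _; rewrite b0 mlin0.
Qed.

Lemma bar_compose1 (X Y Z : lmodType k) (F : seq X -> Y) (g : seq Y -> Z) x :
  bar_compose F g [:: x] = g [:: F [:: x]].
Proof.
rewrite /bar_compose (segs_whole (K := fun bs => g (map F bs))) //.
by case=> [|b bs] //= _; case: (size b) => [|[]].
Qed.

Lemma transfer_quasi_iso : exists (Hh : deformation H) (F : dmor f Hh Ah), dquasi_iso F.
Proof.
have [beta [phi [lift_bp flat0]]] := transfer_exists Ah H1 f_qi Vproj.
pose D := transfer_deformation H1 f_qi lift_bp flat0.
pose F : dmor f D Ah := transfer_dmor H1 f_qi lift_bp flat0.
exists D, F; split=> //.
have op1 (W : lmodType k) (G : grading W (int * int)%type) (C : bainf s G) (E : deformation C) i x :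
    series_grading G i x -> series_grading G (i + bideg_op s 1) (ddiff E x).
  move=> hx; have := @dop_bidegree _ _ _ _ _ E [:: i] [:: x].
  by rewrite big_seq1; apply=> //; constructor.
have curv := transfer_curvature H1 f_qi lift_bp flat0.
have Bl := hmlin_multilinear (lifting_op_hmlin lift_bp); have Fl := hmlin_multilinear (lifting_mor_hmlin lift_bp).
have bl := hmlin_multilinear (bar_dop_hmlin Ah).
apply: (@cone_quasi_iso _ _ _ _ _ (ddiff D) (ddiff Ah) (dmor1 F) (mor1 f) (bdiff A) (bideg_op s 1)).
- by move=> x; apply: ((dop_hmultilinear D).2 x [::] [::]).
- by move=> x; apply: ((dop_hmultilinear Ah).2 x [::] [::]).
- by move=> x; apply: ((dfun_hmultilinear F).2 x [::] [::]).
- by move=> x; apply: (lifting_op_arity1 H1 lift_bp).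
- exact: bar_dop1_at0.
- exact: (lifting_mor_arity1 lift_bp).
- by move=> x; have := curv [:: x]; rewrite (bar_insert1 _ _ Bl (lifting_op_nil lift_bp)).
- by move=> y; have := bar_dop_flat Ah [:: y]; rewrite (bar_insert1 _ _ bl (bar_dop_nil Ah)).
- move=> x; apply/eqP; rewrite -subr_eq0; apply/eqP; have := flat0 [:: x].
  by rewrite /defect (bar_insert1 _ _ Fl (lifting_op_nil lift_bp)) bar_compose1.
- exact: op1.
- exact: op1.
- move=> i x hx; have := @dfun_bidegree _ _ _ _ _ _ _ _ _ _ _ F [:: i] [:: x].
  by rewrite big_seq1 /bideg_mor /= subrr !mul0r addr0; apply=> //; constructor.
- exact: mor1_degree.
- by move=> i x; apply: bdiff_degree.
- exact: (mor1_inj H1 f_qi).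
- exact: (mor1_surj f_qi).
Qed.

End TransferQuasiIso.

Theorem theorem3p3 (k : comPzRingType) (s : nat)
    (M : lmodType k) (G : grading M (int * int)%type) (A : bainf s G)
    (A_flat : flat A) (Ah : deformation A)
    (H : bainf s (bcoh_grading A)) (H_model : compatible_model H)
    (f : bmor H A) (f_qi : bquasi_iso f) :
  (exists (Hh : deformation H) (F : dmor f Hh Ah), dquasi_iso F) /\
  (forall Hh1 Hh2 : deformation H,
    (exists F1 : dmor f Hh1 Ah, dquasi_iso F1) ->
    (exists F2 : dmor f Hh2 Ah, dquasi_iso F2) ->
    quasi_isomorphic (Deformed Hh1) (Deformed Hh2)).
Proof.
split.
  by case: H_model => H1 _ _ _; apply: transfer_quasi_iso.
move=> Hh1 Hh2 [F1 q1] [F2 q2].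
apply: (Relation_Operators.rst_trans _ _ _ (Deformed Ah)).
  by apply: Relation_Operators.rst_step; exists f, F1.
by apply: Relation_Operators.rst_sym; apply: Relation_Operators.rst_step; exists f, F2.
Qed.
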